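(* Let $\mathcal{G}=(\mathcal{G}^{(0)},\mathcal{G}^{(1)},r,s)$ be a row-finite directed graph. Then the tensor algebra associated to $\mathcal{G}$ has the unique extension property.
   Context: Row-finite means $|r^{-1}(p)|<\infty$ for every vertex $p\in\mathcal{G}^{(0)}$. A $C^*$-correspondence $X$ over a $C^*$-algebra $A$ is a right Hilbert $A$-module with a $*$-homomorphism $\phi_X\colon A\to\mathcal{L}(X)$. A representation of $X$ is a pair $(\pi,t)$ of a $*$-homomorphism $\pi$ of $A$ and a linear map $t$ of $X$ into a $C^*$-algebra with $\pi(a)t(\xi)=t(\phi_X(a)\xi)$ and $t(\xi)^*t(\eta)=\pi(\langle\xi,\eta\rangle_X)$. $\mathcal{T}_X$ is the universal $C^*$-algebra for representations of $X$, and the tensor algebra $\mathcal{T}_X^+$ is the norm-closed subalgebra of $\mathcal{T}_X$ generated by the universal copies of $A$ and $X$. The $C^*$-correspondence $X_\mathcal{G}$ of the graph is over $A_\mathcal{G}=c_0(\mathcal{G}^{(0)})$: it is the completion of the finitely supported functions $u\colon\mathcal{G}^{(1)}\to\mathbb{C}$ with inner product $\langle u,v\rangle(p)=\sum_{s(e)=p}\overline{u_e}v_e$, right action $(ux)_e=u_ex_{s(e)}$ and left action $(\phi(x)u)_e=x_{r(e)}u_e$. The tensor algebra associated to $\mathcal{G}$ is $\mathcal{T}_{X_\mathcal{G}}^+$. Its $C^*$-envelope is the Cuntz-Krieger algebra $C^*(\mathcal{G})$, the universal $C^*$-algebra generated by mutually orthogonal projections $p_v$ ($v\in\mathcal{G}^{(0)}$)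 and partial isometries $s_e$ ($e\in\mathcal{G}^{(1)}$) with $s_e^*s_e=p_{s(e)}$ for all $e$ and $p_v=\sum_{e\in r^{-1}(v)}s_es_e^*$ when $0<|r^{-1}(v)|<\infty$; under this identification the tensor algebra is the norm-closed algebra generated by the $p_v$ and $s_e$. A $C^*$-cover of an operator algebra $\mathcal{A}$ is a pair $(C,j)$ with $j\colon\mathcal{A}\to C$ a completely isometric homomorphism and $C=C^*(j(\mathcal{A}))$. The $C^*$-envelope $(C^*_{\mathrm{env}}(\mathcal{A}),\iota)$ is the $C^*$-cover such that every $C^*$-cover $(C,j)$ admits a $*$-epimorphism $\Phi\colon C\to C^*_{\mathrm{env}}(\mathcal{A})$ with $\Phi\circ j=\iota$. A dilation of a completely contractive representation $\rho\colon\mathcal{A}\to\mathcal{B}(H)$ is a completely contractive representation $\nu\colon\mathcal{A}\to\mathcal{B}(K)$, $K\supseteq H$, with $P_H\nu(\cdot)|_H=\rho$; it is trivial if $H$ reduces $\nu(\mathcal{A})$. $\rho$ is maximal if all its dilations are trivial. $\mathcal{A}$ has the unique extension property if the restriction to $\mathcal{A}$ (i.e. to $\iota(\mathcal{A})$) of every faithful representation of $C^*_{\mathrm{env}}(\mathcal{A})$ on a Hilbert space is maximal. *)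

(* Defs.v *)
From HB Require Import structures.
From mathcomp Require Export all_boot all_order all_algebra.
From mathcomp Require Export complex.
From mathcomp Require Export all_classical all_reals all_analysis.

Set Implicit Arguments.
Unset Strict Implicit.
Unset Printing Implicit Defensive.

Import Order.TTheory GRing.Theory Num.Theory.
Import numFieldNormedType.Exports.

Local Open Scope classical_set_scope.
Local Open Scope complex_scope.
Local Open Scope ring_scope.

(* R[i] as a bundled field: passing the bare type where a field is expected
   would leave a [reverse_coercion] in the terms, which blocks rewriting. *)
Notation complexField R := (complex_complex__canonical__Num_NumField R).
Notation complexClosedField R :=
  (complex_complex__canonical__Num_ClosedField R).

(** * C*-algebras *)

(* Not necessarily unital, hence not built on MathComp's rings.  The norm of a
   normed module over R[i] takes its values in R[i]. *)
Record cstar_algebra (R : realType) := CStarAlgebra {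
  cstar_carrier :> completeNormedModType (complexField R);
  cmul : cstar_carrier -> cstar_carrier -> cstar_carrier;
  adj : cstar_carrier -> cstar_carrier;
  cmulA : forall a b c, cmul a (cmul b c) = cmul (cmul a b) c;
  cmulDl : forall a b c, cmul (a + b) c = cmul a c + cmul b c;
  cmulDr : forall a b c, cmul a (b + c) = cmul a b + cmul a c;
  cmulZl : forall (k : R[i]) a b, cmul (k *: a) b = k *: cmul a b;
  cmulZr : forall (k : R[i]) a b, cmul a (k *: b) = k *: cmul a b;
  adjK : forall a, adj (adj a) = a;
  adjD : forall a b, adj (a + b) = adj a + adj b;
  adjZ : forall (k : R[i]) a, adj (k *: a) = k^* *: adj a;
  adjM : forall a b, adj (cmul a b) = cmul (adj b) (adj a);
  cnormM : forall a b, `|cmul a b| <= `|a| * `|b|;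
  cnorm_adjM : forall a, `|cmul (adj a) a| = `|a| ^+ 2
}.

Arguments cmul {R _}.
Arguments adj {R _}.

Declare Scope cstar_scope.
Notation "a ** b" := (cmul a b) (at level 40, left associativity) : cstar_scope.
Local Open Scope cstar_scope.

Definition cpositive (R : realType) (A : cstar_algebra R) (a : A) : Prop :=
  exists b : A, a = adj b ** b.

Record star_hom (R : realType) (A B : cstar_algebra R) (f : A -> B) : Prop :=
  StarHom {
    star_hom_lin : forall (k : R[i]) a b, f (k *: a + b) = k *: f a + f b;
    star_hom_mul : forall a b, f (a ** b) = f a ** f b;
    star_hom_adj : forall a, f (adj a) = adj (f a)
  }.

Record closed_subalgebra (R : realType) (C : cstar_algebra R) (A : set C) :
    Prop := ClosedSubalgebra {
  subalg_closed : closed A;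
  subalg_0 : A 0;
  subalg_lin : forall (k : R[i]) a b, A a -> A b -> A (k *: a + b);
  subalg_mul : forall a b, A a -> A b -> A (a ** b)
}.

Definition cstar_subalgebra (R : realType) (C : cstar_algebra R) (A : set C) :
  Prop := closed_subalgebra A /\ (forall a, A a -> A (adj a)).

Definition closed_subalgebra_gen (R : realType) (C : cstar_algebra R)
  (S : set C) : set C := smallest (@closed_subalgebra R C) S.

Definition cstar_gen (R : realType) (C : cstar_algebra R) (S : set C) : set C :=
  smallest (@cstar_subalgebra R C) S.

(** * Hilbert spaces and representations of operator algebras *)

(* The form [dot] is linear in its first argument. *)
Record hilbert_space (R : realType) := HilbertSpace {
  hilbert_carrier :> completeNormedModType (complexField R);
  dot : {dot hilbert_carrier for (@Num.conj (complexClosedField R))};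
  hilbert_normE : forall x, `|x| ^+ 2 = dot x x
}.

Arguments dot {R _}.

(* Here and below, an operator algebra is a norm-closed subalgebra [A] of a
   C*-algebra [C]; maps on [A] are maps on [C] whose values outside [A] are
   irrelevant. *)
Record is_rep (R : realType) (C : cstar_algebra R) (A : set C)
    (H : hilbert_space R) (rho : C -> {linear H -> H}) : Prop := IsRep {
  rep_cont : forall a, A a -> continuous (rho a);
  rep_lin : forall (k : R[i]) a b, A a -> A b ->
    forall x, rho (k *: a + b) x = k *: rho a x + rho b x;
  rep_mul : forall a b, A a -> A b -> forall x, rho (a ** b) x = rho a (rho b x)
}.

Definition is_star_rep (R : realType) (C : cstar_algebra R)
    (H : hilbert_space R) (pi : C -> {linear H -> H}) : Prop :=
  is_rep setT pi /\
  (forall a x y, dot (pi a x) y = dot x (pi (adj a) y)).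

Definition faithful (R : realType) (C : cstar_algebra R) (H : hilbert_space R)
    (pi : C -> {linear H -> H}) : Prop :=
  forall a, (forall x, pi a x = 0) -> a = 0.

(** * Matrix norms, complete contractions and complete isometries *)

(* [opmx_norm F] is the norm of the operator matrix [F] acting on the Hilbert
   direct sum of [n] copies of [H]. *)
Definition opmx_bound (R : realType) (H : hilbert_space R) (n : nat)
    (F : 'I_n -> 'I_n -> {linear H -> H}) : set R :=
  [set k : R | 0 <= k /\ forall x : 'I_n -> H,
     \sum_i `|\sum_j F i j (x j)| ^+ 2
       <= (k ^+ 2)%:C * \sum_j `|x j| ^+ 2].

Definition opmx_norm (R : realType) (H : hilbert_space R) (n : nat)
    (F : 'I_n -> 'I_n -> {linear H -> H}) : \bar R :=
  ereal_inf [set k%:E | k in opmx_bound F].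

(* The C*-norm of M_n(C), as the supremum over all representations of C on
   Hilbert spaces (any faithful one attains it). *)
Definition cmx_norm (R : realType) (C : cstar_algebra R) (n : nat)
    (a : 'M[C]_n) : \bar R :=
  ereal_sup [set y | exists (H : hilbert_space R) (pi : C -> {linear H -> H}),
     is_star_rep pi /\ y = opmx_norm (fun i j => pi (a i j))].

Definition completely_contractive (R : realType) (C : cstar_algebra R)
    (A : set C) (H : hilbert_space R) (rho : C -> {linear H -> H}) : Prop :=
  forall (n : nat) (a : 'M[C]_n), (forall i j, A (a i j)) ->
    (opmx_norm (fun i j => rho (a i j)) <= cmx_norm a)%E.

Definition completely_isometric (R : realType) (C D : cstar_algebra R)
    (A : set C) (f : C -> D) : Prop :=
  forall (n : nat) (a : 'M[C]_n), (forall i j, A (a i j)) ->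
    cmx_norm (map_mx f a) = cmx_norm a.

Definition is_cc_rep (R : realType) (C : cstar_algebra R) (A : set C)
    (H : hilbert_space R) (rho : C -> {linear H -> H}) : Prop :=
  is_rep A rho /\ completely_contractive A rho.

(** * C*-covers and the C*-envelope *)

Record is_cstar_cover (R : realType) (T : cstar_algebra R) (A : set T)
    (C : cstar_algebra R) (j : T -> C) : Prop := IsCStarCover {
  cover_lin : forall (k : R[i]) a b, A a -> A b ->
    j (k *: a + b) = k *: j a + j b;
  cover_mul : forall a b, A a -> A b -> j (a ** b) = j a ** j b;
  cover_isom : completely_isometric A j;
  cover_gen : cstar_gen (j @` A) = setT
}.

Definition is_cstar_envelope (R : realType) (T : cstar_algebra R) (A : set T)
    (E : cstar_algebra R) (iota : T -> E) : Prop :=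
  is_cstar_cover A iota /\
  forall (C : cstar_algebra R) (j : T -> C), is_cstar_cover A j ->
    exists Phi : C -> E,
      [/\ star_hom Phi, set_surj setT setT Phi
        & forall a, A a -> Phi (j a) = iota a].

(** * Dilations, maximality and the unique extension property *)

(* The inclusion of H in K is an arbitrary linear isometry [V]. *)
Record is_dilation (R : realType) (C : cstar_algebra R) (A : set C)
    (H : hilbert_space R) (rho : C -> {linear H -> H})
    (K : hilbert_space R) (V : {linear H -> K}) (nu : C -> {linear K -> K}) :
    Prop := IsDilation {
  dilation_isom : forall x y, dot (V x) (V y) = dot x y;
  dilation_cc : is_cc_rep A nu;
  dilation_compress : forall a, A a -> forall x y,
    dot (nu a (V x)) (V y) = dot (rho a x) y
}.

Definition orthocompl (R : realType) (K : hilbert_space R) (M : set K) :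
  set K := [set y | forall x, M x -> dot x y = 0].

Definition reduces (R : realType) (C : cstar_algebra R) (A : set C)
    (K : hilbert_space R) (nu : C -> {linear K -> K}) (M : set K) : Prop :=
  forall a, A a ->
    (forall x, M x -> M (nu a x)) /\
    (forall y, orthocompl M y -> orthocompl M (nu a y)).

Definition is_maximal (R : realType) (C : cstar_algebra R) (A : set C)
    (H : hilbert_space R) (rho : C -> {linear H -> H}) : Prop :=
  is_cc_rep A rho /\
  forall (K : hilbert_space R) (V : {linear H -> K}) (nu : C -> {linear K -> K}),
    is_dilation A rho V nu -> reduces A nu (range V).

Definition unique_extension_property (R : realType) (T : cstar_algebra R)
    (A : set T) : Prop :=
  forall (E : cstar_algebra R) (iota : T -> E), is_cstar_envelope A iota ->
  forall (H : hilbert_space R) (pi : E -> {linear H -> H}),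
    is_star_rep pi -> faithful pi -> is_maximal (iota @` A) pi.

(** * C*-correspondences and their tensor algebras *)

(* The last two axioms say that [left_act] is a *-homomorphism into the
   adjointable operators: adjointable maps are automatically linear, bounded
   and right A-linear. *)
Record correspondence (R : realType) (A : cstar_algebra R) := Correspondence {
  corr_carrier :> completeNormedModType (complexField R);
  right_act : corr_carrier -> A -> corr_carrier;
  inner : corr_carrier -> corr_carrier -> A;
  left_act : A -> corr_carrier -> corr_carrier;
  right_actDl : forall x y a,
    right_act (x + y) a = right_act x a + right_act y a;
  right_actDr : forall x a b,
    right_act x (a + b) = right_act x a + right_act x b;
  right_actZl : forall (k : R[i]) x a,
    right_act (k *: x) a = k *: right_act x a;
  right_actZr : forall (k : R[i]) x a,
    right_act x (k *: a) = k *: right_act x a;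
  right_actM : forall x a b, right_act x (a ** b) = right_act (right_act x a) b;
  innerD : forall x y z, inner x (y + z) = inner x y + inner x z;
  innerZ : forall (k : R[i]) x y, inner x (k *: y) = k *: inner x y;
  inner_act : forall x y a, inner x (right_act y a) = inner x y ** a;
  inner_adj : forall x y, adj (inner x y) = inner y x;
  inner_ge0 : forall x, cpositive (inner x x);
  inner_normE : forall x, `|x| ^+ 2 = `|inner x x|;
  left_act_lin : forall (k : R[i]) a b x,
    left_act (k *: a + b) x = k *: left_act a x + left_act b x;
  left_actM : forall a b x, left_act (a ** b) x = left_act a (left_act b x);
  left_act_adj : forall a x y,
    inner (left_act a x) y = inner x (left_act (adj a) y)
}.

Arguments right_act {R A _}.
Arguments inner {R A _}.
Arguments left_act {R A _}.

Record is_corr_rep (R : realType) (A : cstar_algebra R) (X : correspondence A)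
    (B : cstar_algebra R) (pi : A -> B) (t : X -> B) : Prop := IsCorrRep {
  corr_rep_hom : star_hom pi;
  corr_rep_lin : forall (k : R[i]) x y, t (k *: x + y) = k *: t x + t y;
  corr_rep_left : forall a x, pi a ** t x = t (left_act a x);
  corr_rep_inner : forall x y, adj (t x) ** t y = pi (inner x y)
}.

Definition is_toeplitz_algebra (R : realType) (A : cstar_algebra R)
    (X : correspondence A) (T : cstar_algebra R) (pi : A -> T) (t : X -> T) :
    Prop :=
  [/\ is_corr_rep pi t,
      cstar_gen (range pi `|` range t) = setT
    & forall (B : cstar_algebra R) (sigma : A -> B) (tau : X -> B),
        is_corr_rep sigma tau ->
        exists Phi : T -> B,
          [/\ star_hom Phi, forall a, Phi (pi a) = sigma a
            & forall x, Phi (t x) = tau x]].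

Definition tensor_algebra (R : realType) (A : cstar_algebra R)
    (X : correspondence A) (T : cstar_algebra R) (pi : A -> T) (t : X -> T) :
  set T := closed_subalgebra_gen (range pi `|` range t).

(** * Directed graphs and their correspondences *)

Record digraph := Digraph {
  vertex : choiceType;
  edge : choiceType;
  rng : edge -> vertex;
  src : edge -> vertex
}.

Definition row_finite (G : digraph) : Prop :=
  forall p : vertex G, finite_set [set e : edge G | rng e = p].

(* [ev] identifies the C*-algebra [A] with c_0(I): pointwise operations,
   functions vanishing at infinity on the discrete set [I], supremum norm. *)
Record is_c0 (R : realType) (I : choiceType) (A : cstar_algebra R)
    (ev : A -> I -> R[i]) : Prop := IsC0 {
  c0_lin : forall (k : R[i]) a b p, ev (k *: a + b) p = k * ev a p + ev b p;
  c0_mul : forall a b p, ev (a ** b) p = ev a p * ev b p;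
  c0_adj : forall a p, ev (adj a) p = (ev a p)^*;
  c0_range : range ev =
    [set f : I -> R[i] | forall eps : R, 0 < eps ->
       finite_set [set p | eps%:C <= `|f p|]];
  c0_norm : forall a (k : R), 0 <= k ->
    `|a| <= k%:C <-> (forall p, `|ev a p| <= k%:C)
}.

Definition finsupp_fun (R : realType) (I : choiceType) : set (I -> R[i]) :=
  [set u | finite_set [set e | u e != 0]].

(* [chi] exhibits [X] as the completion of the finitely supported functions on
   the edges of [G]; its values at other functions are irrelevant. *)
Record is_graph_correspondence (R : realType) (G : digraph)
    (A : cstar_algebra R) (ev : A -> vertex G -> R[i])
    (X : correspondence A) (chi : (edge G -> R[i]) -> X) : Prop :=
  IsGraphCorrespondence {
  graph_corr_c0 : is_c0 ev;
  graph_corr_lin : forall (k : R[i]) u v, finsupp_fun u -> finsupp_fun v ->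
    chi (fun e => k * u e + v e) = k *: chi u + chi v;
  graph_corr_dense : closure (chi @` @finsupp_fun R (edge G)) = setT;
  graph_corr_inner : forall u v, finsupp_fun u -> finsupp_fun v ->
    forall p, ev (inner (chi u) (chi v)) p =
      \sum_(e \in [set e : edge G | src e = p]) (u e)^* * v e;
  graph_corr_right : forall u a, finsupp_fun u ->
    right_act (chi u) a = chi (fun e => u e * ev a (src e));
  graph_corr_left : forall u a, finsupp_fun u ->
    left_act a (chi u) = chi (fun e => ev a (rng e) * u e)
}.

(* Main.v *)
From HB Require Import structures.
Require Import Defs.
From mathcomp Require Import ring lra.

(** The tensor algebra is generated by the vertex projections p_v and the
    partial isometries s_e.  Let rho on H be the restriction of a faithful
    representation of the envelope, and let nu on K be a dilation of rho, with
    H inside K.  Each nu(p_v) is a contractive idempotent whose compression to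
    H is a projection, and this forces H to reduce it ([proj_reduced]).  Next,
    nu(s_e) h lies in H for h in H, because its norm is at most that of
    rho(p_s(e)) h, which is the norm of its compression rho(s_e) h
    ([isometry_intertwined]).  What remains is that nu(s_e) preserves the
    orthogonal complement of H.  For v = r(e) the row (nu(s_g)), g in r^-1(v),
    is a contraction, as nu is completely contractive and r^-1(v) is finite.
    If the Cuntz-Krieger relation p_v = sum s_g s_g^* holds in the envelope, the
    corresponding row on H is coisometric onto rho(p_v) H, and a contraction has
    no room left to map a vector orthogonal to H onto something with a component
    in rho(p_v) H ([row_orth], [edge_iso_coinvariant]).  These properties pass
    to norm limits and hence to the whole tensor algebra ([tensor_reduced]).

    So the heart of the matter is the Cuntz-Krieger relation at v = r(f), for a
    given edge f, in the envelope: the element gap_v = p_v - sum s_g s_g^* of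
    the Toeplitz algebra T has to become 0 there.  As the envelope is a quotient
    of every C*-cover, one cover in which gap_v vanishes is enough
    ([envelope_gap]).  Take star representations of T on spaces H_i that attain
    all matrix norms ([rep_family_norming]).  Every H_i is enlarged to a space
    on which gap_v acts as 0 and where H_i is invariant for the tensor algebra,
    with the action that it had.  To this end one adds a copy of gap_v H_i that
    s_f maps onto gap_v H_i, and lets the other edges act freely on this copy.
    The summands that arise are indexed by the paths from s(f) that do not begin
    by traversing f.  If f is a loop, the new copy lies under p_v and has to be
    covered in turn, so the process is repeated with infinitely many copies, each
    one mapped onto the previous one by s_f.  The operators obtained are weighted
    shifts on a Hilbert sum ([shift_op]); they satisfy the Toeplitz relations
    ([edge_edge], [diag_edge]) and the relation at v ([edge_sum]).  The
    C*-algebra that they generate is the required cover: passing to an invariant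
    subspace that attains the norms shows that it is completely isometric on the
    tensor algebra ([model_norm], [corestriction_cover]).

    The operator theory behind this is as follows: star representations are
    contractive ([star_rep_contractive]), Hilbert sums exist ([l2_sum]), the
    bounded operators on a Hilbert space and the closed star subalgebras of a
    C*-algebra are C*-algebras ([bounded_operators], [cstar_sub]), and a
    representation of a correspondence may be prescribed on a family of vectors
    with dense span ([corr_rep_extension]). *)

Set Implicit Arguments.
Unset Strict Implicit.
Unset Printing Implicit Defensive.
Import Order.TTheory GRing.Theory Num.Theory.
Import numFieldNormedType.Exports.
Local Open Scope classical_set_scope.
Local Open Scope complex_scope.
Local Open Scope ring_scope.
Local Open Scope cstar_scope.

(** * Real-valued norms, limits and inner products *)

(** The norm of a normed module over R[i] is complex-valued; its real part lives
    in the ordered field R, where estimates can be combined freely. *)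
Definition nr (R : realType) (V : normedZmodType (complexField R)) (x : V) : R :=
  complex.Re `|x|.

Section Norm.
Context {R : realType} {V : normedZmodType (complexField R)}.
Implicit Types x y z : V.

Lemma nrE x : `|x| = (nr x)%:C.
Proof.
have := normr_ge0 x; rewrite lecE /nr; case: (`|x|) => a b /=.
by case/andP => /eqP-> _.
Qed.

Lemma nr_ge0 x : 0 <= nr x.
Proof. by have := normr_ge0 x; rewrite nrE ler0c. Qed.

Lemma nr_eq0 x : nr x = 0 -> x = 0.
Proof. by move=> x0; apply/normr0_eq0; rewrite nrE x0. Qed.

Lemma nr_gt0 x : x != 0 -> 0 < nr x.
Proof.
by move=> x0; rewrite lt_neqAle nr_ge0 andbT eq_sym; apply: contra_neq x0 => /nr_eq0.
Qed.

Lemma nr0 : nr (0 : V) = 0.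
Proof. by rewrite /nr normr0. Qed.

Lemma nrN x : nr (- x) = nr x.
Proof. by rewrite /nr normrN. Qed.

Lemma nrBC x y : nr (x - y) = nr (y - x).
Proof. by rewrite /nr distrC. Qed.

Lemma nrD x y : nr (x + y) <= nr x + nr y.
Proof. by have := ler_normD x y; rewrite !nrE -rmorphD /= lecR. Qed.

Lemma nrB x y : nr (x - y) <= nr x + nr y.
Proof. by rewrite -[nr y]nrN nrD. Qed.

Lemma nrBD z x y : nr (x - y) <= nr (x - z) + nr (z - y).
Proof. by rewrite -[x - y](subrKA z) nrD. Qed.

Lemma nr_small x : (forall e : R, 0 < e -> nr x <= e) -> x = 0.
Proof.
move=> h; apply: nr_eq0; apply/eqP; rewrite eq_le nr_ge0 andbT.
by apply/ler_addgt0Pr => e e0; rewrite add0r h.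
Qed.

End Norm.

Section NormC.
Context {R : realType}.
Implicit Types k z : R[i].

Lemma nrC_real (a : R) : nr (a%:C : complexField R) = `|a|.
Proof. by rewrite /nr /Num.norm /= expr0n/= addr0 sqrtr_sqr. Qed.

Lemma nrCM k z : nr (k * z : complexField R) = nr (k : complexField R) * nr (z : complexField R).
Proof. by apply/complexI; rewrite rmorphM /= -!nrE normrM. Qed.

Lemma nrZ (V : normedModType (complexField R)) k (x : V) :
  nr (k *: x) = nr (k : complexField R) * nr x.
Proof. by apply/complexI; rewrite rmorphM /= -!nrE normrZ. Qed.

Lemma nrZr (V : normedModType (complexField R)) (a : R) (x : V) :
  nr (a%:C *: x) = `|a| * nr x.
Proof. by rewrite nrZ nrC_real. Qed.

Lemma conjCE k : Num.conj (k : complexClosedField R) = conjc k.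
Proof. reflexivity. Qed.
Lemma nr_conj k : nr (conjc k : complexField R) = nr (k : complexField R).
Proof. by rewrite /nr normcJ. Qed.

Lemma nr_sqr k : (nr (k : complexField R) ^+ 2)%:C = k * conjc k.
Proof. by rewrite rmorphXn /= -nrE sqr_normc. Qed.

Lemma le_Re_nr k : complex.Re k <= nr (k : complexField R).
Proof.
have := normc_ge_Re k; rewrite (nrE (k : complexField R)) lecR.
by apply: le_trans; exact: ler_norm.
Qed.
End NormC.


Lemma posC_real (R : realType) (e : R[i]) : 0 < e -> exists2 a : R, 0 < a & e = a%:C.
Proof. by case: e => a b; rewrite ltcE /= => /andP[/eqP-> ?]; exists a. Qed.

Section Topology.
Context {R : realType} {V : normedModType (complexField R)}.
Implicit Types (x y : V) (A : set V).

Lemma nbhs_nrP x (B : set V) :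
  nbhs x B <-> exists2 a : R, 0 < a & forall y, nr (x - y) < a -> B y.
Proof.
split=> [/nbhs_ballP[e /posC_real[a a0 ->] eB]|[a a0 aB]].
  exists a => // y xy; apply: eB; rewrite -ball_normE /ball_ /=.
  by rewrite nrE ltcR.
apply/nbhs_ballP; exists a%:C; first by rewrite /= ltcR.
by move=> y; rewrite -ball_normE /ball_ /= nrE ltcR; exact: aB.
Qed.

Lemma nr_closedP A : closed A <->
  forall x, (forall e : R, 0 < e -> exists2 y, A y & nr (x - y) <= e) -> A x.
Proof.
split=> [cA x h|h x cx].
  apply: cA => B /nbhs_nrP[a a0 aB].
  have [y Ay xy] := h (a / 2) (divr_gt0 a0 (ltr0Sn _ 1)).
  by exists y; split=> //; apply: aB; lra.
apply: h => e e0; have /cx[y [Ay /= xy]] : nbhs x [set y | nr (x - y) < e].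
  by apply/nbhs_nrP; exists e.
by exists y => //; exact: ltW.
Qed.

Lemma nr_closureP A x :
  closure A x <-> forall e : R, 0 < e -> exists2 y, A y & nr (x - y) <= e.
Proof.
split=> [cx e e0|h B /nbhs_nrP[a a0 aB]].
  have /cx[y [Ay /= xy]] : nbhs x [set y | nr (x - y) < e].
    by apply/nbhs_nrP; exists e.
  by exists y => //; exact: ltW.
have [y Ay xy] := h (a / 2) (divr_gt0 a0 (ltr0Sn _ 1)).
by exists y; split=> //; apply: aB; lra.
Qed.
End Topology.

Section Complete.
Context {R : realType} {V : completeNormedModType (complexField R)}.

(** A modulus r for the tails of u is also a modulus for the distance to the
    limit, which is the form in which all limits below are used. *)
Lemma cauchy_seq_cvg (u : nat -> V) (r : nat -> R) :
  (forall n m, (n <= m)%N -> nr (u m - u n) <= r n) ->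
  (forall e : R, 0 < e -> exists N, r N <= e) ->
  exists l, forall n, nr (l - u n) <= r n.
Proof.
move=> ur r0.
have cu : cauchy (u @ \oo).
  apply/cauchy_ballP => e /posC_real[a a0 ->].
  have [N rN] := r0 (a / 3) (divr_gt0 a0 (ltr0Sn _ 2)).
  exists (u @` [set n | (N <= n)%N], u @` [set n | (N <= n)%N]) => /=.
    by split; exists N => // n Nn; exists n.
  move=> [_ _] [[n Nn <-] [m Nm <-]] /=.
  rewrite -ball_normE /ball_ /= nrE ltcR.
  have := ur _ _ Nn; have := ur _ _ Nm; have := nrBD (u N) (u n) (u m).
  rewrite [nr (u N - u m)]nrBC; lra.
have /cvg_ex[l ul] : cvg (u @ \oo) by apply: cauchy_cvg.
exists l => n; apply/ler_addgt0Pr => e e0.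
have /ul[N _ hN] : nbhs l [set y | nr (l - y) < e] by apply/nbhs_nrP; exists e.
have /= h1 := hN _ (leq_maxl N n).
have := ur _ _ (leq_maxr N n); have := nrBD (u (maxn N n)) l (u n); lra.
Qed.
End Complete.

Section Hilbert.
Context {R : realType} {H : hilbert_space R}.
Implicit Types (x y z : H) (k : R[i]).

Lemma dotC x y : dot y x = conjc (dot x y).
Proof.
by rewrite (@hermitian_subproof _ _ _ _ (dot (h := H))) /= expr0 mul1r conjCE.
Qed.

Lemma dotDl x y z : dot (x + y) z = dot x z + dot y z.
Proof. exact: linearDl. Qed.

Lemma dotZl k x y : dot (k *: x) y = k * dot x y.
Proof. exact: linearZl_LR. Qed.

Lemma dotDr x y z : dot x (y + z) = dot x y + dot x z.
Proof. exact: linearDr. Qed.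

Lemma dotZr k x y : dot x (k *: y) = conjc k * dot x y.
Proof. by rewrite dotC dotZl rmorphM /= -dotC. Qed.

Lemma dotNl x y : dot (- x) y = - dot x y. Proof. exact: linearNl. Qed.
Lemma dotNr x y : dot x (- y) = - dot x y. Proof. exact: linearNr. Qed.
Lemma dotBl x y z : dot (x - y) z = dot x z - dot y z.
Proof. by rewrite dotDl dotNl. Qed.
Lemma dotBr x y z : dot x (y - z) = dot x y - dot x z.
Proof. by rewrite dotDr dotNr. Qed.
Lemma dot0l x : dot 0 x = 0. Proof. exact: linear0l. Qed.
Lemma dot0r x : dot x 0 = 0. Proof. exact: linear0r. Qed.

Lemma dot_suml (I : Type) (s : seq I) (P : pred I) (F : I -> H) x :
  dot (\sum_(i <- s | P i) F i) x = \sum_(i <- s | P i) dot (F i) x.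
Proof. exact: linear_sumlz. Qed.

Lemma dot_sumr (I : Type) (s : seq I) (P : pred I) (F : I -> H) x :
  dot x (\sum_(i <- s | P i) F i) = \sum_(i <- s | P i) dot x (F i).
Proof. exact: linear_sumr. Qed.

Lemma dotxx x : dot x x = (nr x ^+ 2)%:C.
Proof. by rewrite -hilbert_normE nrE rmorphXn. Qed.

Lemma dot_inj x y : (forall z, dot x z = dot y z) -> x = y.
Proof.
move=> xy; apply/eqP; rewrite -subr_eq0; apply/eqP/nr_eq0/eqP.
have /eqP := dotxx (x - y); rewrite dotBl xy subrr eq_sym.
by rewrite -(rmorph0 (real_complex R)) (inj_eq (@complexI _)) sqrf_eq0.
Qed.

Lemma nrD2 x y : nr (x + y) ^+ 2 = nr x ^+ 2 + 2 * complex.Re (dot x y) + nr y ^+ 2.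
Proof.
apply: complexI; rewrite -dotxx dotDl !dotDr [dot y x]dotC !dotxx.
case: (dot x y) => a b; apply/eqP; rewrite eq_complex /=; apply/andP; split; apply/eqP; ring.
Qed.

Lemma nrB2 x y : nr (x - y) ^+ 2 = nr x ^+ 2 - 2 * complex.Re (dot x y) + nr y ^+ 2.
Proof. by rewrite nrD2 nrN dotNr; case: (dot x y) => a b /=; ring. Qed.

(** Expand the square of the norm of |y|^2 x - <x,y> y. *)
Lemma cauchy_schwarz x y : nr (dot x y : complexField R) <= nr x * nr y.
Proof.
have [->|y0] := eqVneq y 0; first by rewrite dot0r !nr0 mulr0.
have Y0 : 0 < nr y by exact: nr_gt0.
set d := dot x y.
have : 0 <= nr ((nr y ^+ 2)%:C *: x - d *: y) ^+ 2 by exact: sqr_ge0.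
rewrite nrB2 nrZr nrZ dotZl dotZr -/d.
have -> : complex.Re ((nr y ^+ 2)%:C * (conjc d * d)) = nr y ^+ 2 * nr (d : complexField R) ^+ 2.
  by rewrite [conjc d * d]mulrC -nr_sqr -rmorphM.
rewrite ger0_norm ?sqr_ge0 // => h.
rewrite -(@ler_pXn2r _ 2) ?nnegrE ?mulr_ge0 ?nr_ge0 //.
have : 0 <= nr y ^+ 2 * (nr x ^+ 2 * nr y ^+ 2 - nr (d : complexField R) ^+ 2) by move: h; nra.
by rewrite pmulr_rge0 ?exprn_gt0 // subr_ge0 exprMn.
Qed.
End Hilbert.

(** * Star representations are contractive *)

Section CStar.
Context {R : realType} {A : cstar_algebra R}.
Implicit Types a b c : A.

Lemma adjZc (k : R[i]) a : adj (k *: a) = conjc k *: adj a.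
Proof. exact: adjZ. Qed.
Lemma cmul0l a : 0 ** a = 0.
Proof. by rewrite -[0 in LHS](scale0r (0 : A)) cmulZl scale0r. Qed.
Lemma cmul0r a : a ** 0 = 0.
Proof. by rewrite -[0 in LHS](scale0r (0 : A)) cmulZr scale0r. Qed.
Lemma cmulNl a b : (- a) ** b = - (a ** b).
Proof. by rewrite -[- a]scaleN1r cmulZl scaleN1r. Qed.
Lemma cmulNr a b : a ** (- b) = - (a ** b).
Proof. by rewrite -[- b]scaleN1r cmulZr scaleN1r. Qed.
Lemma cmulBl a b c : (a - b) ** c = a ** c - b ** c.
Proof. by rewrite cmulDl cmulNl. Qed.
Lemma cmulBr a b c : a ** (b - c) = a ** b - a ** c.
Proof. by rewrite cmulDr cmulNr. Qed.
Lemma adj0 : adj (0 : A) = 0.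
Proof. by rewrite -[0 in LHS](scale0r (0 : A)) adjZc conjc0 scale0r. Qed.
Lemma adjN a : adj (- a) = - adj a.
Proof. by rewrite -[- a]scaleN1r adjZc rmorphN1 scaleN1r. Qed.
Lemma adjB a b : adj (a - b) = adj a - adj b.
Proof. by rewrite adjD adjN. Qed.
Lemma cmul_suml (I : Type) (s : seq I) (P : pred I) (F : I -> A) b :
  (\sum_(i <- s | P i) F i) ** b = \sum_(i <- s | P i) F i ** b.
Proof. by apply: (big_morph (fun a => a ** b)) => [? ?|]; [exact: cmulDl|exact: cmul0l]. Qed.
Lemma cmul_sumr (I : Type) (s : seq I) (P : pred I) (F : I -> A) b :
  b ** (\sum_(i <- s | P i) F i) = \sum_(i <- s | P i) b ** F i.
Proof. by apply: (big_morph (fun a => b ** a)) => [? ?|]; [exact: cmulDr|exact: cmul0r]. Qed.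
Lemma adj_sum (I : Type) (s : seq I) (P : pred I) (F : I -> A) :
  adj (\sum_(i <- s | P i) F i) = \sum_(i <- s | P i) adj (F i).
Proof. by apply: (big_morph adj) => [? ?|]; [exact: adjD|exact: adj0]. Qed.

Lemma nr_cmul a b : nr (a ** b) <= nr a * nr b.
Proof. by have := cnormM a b; rewrite !nrE -rmorphM lecR. Qed.

Lemma nr_adjM a : nr (adj a ** a) = nr a ^+ 2.
Proof. by apply/complexI; rewrite rmorphXn /= -!nrE cnorm_adjM. Qed.

(** By the C*-identity, |b|^2 = |b^* b| <= |b^*| |b|. *)
Lemma nr_adj a : nr (adj a) = nr a.
Proof.
suff le b : nr b <= nr (adj b).
  by apply/eqP; rewrite eq_le le andbT -{2}(adjK a) le.
have [->|b0] := eqVneq b 0; first by rewrite adj0 nr0.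
have B0 : 0 < nr b by exact: nr_gt0.
by rewrite -(ler_pM2r B0) -expr2 -nr_adjM nr_cmul.
Qed.

(** The equation says that g = 1 - (1 - h)^(1/2), but without a unit.  The map
    g |-> (h + g^2)/2 is a contraction of the ball of radius rho = (1 + |h|)/2,
    and g is its fixed point; the iterates of 0 are self-adjoint. *)
Lemma sqrt_one_minus (h : A) : adj h = h -> nr h < 1 ->
  exists2 g, adj g = g & g + g - g ** g = h.
Proof.
move=> hh h1; pose f g := (1 / 2 : R)%:C *: (h + g ** g).
pose rho : R := (1 + nr h) / 2.
have h0 := nr_ge0 h.
have rho1 : rho < 1 by rewrite /rho; lra.
have rho0 : 0 < rho by rewrite /rho; lra.
pose u n := iter n f 0.
have nh : `|1 / 2 : R| = 1 / 2 by rewrite ger0_norm //; lra.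
have un n : nr (u n) <= rho.
  elim: n => [|n IH]; first by rewrite nr0 ltW.
  rewrite /= /f nrZr nh; have := nrD h (u n ** u n); have := nr_cmul (u n) (u n).
  by have := nr_ge0 (u n); rewrite /rho in IH *; nra.
have ua n : adj (u n) = u n.
  by elim: n => [|n IH]; rewrite ?adj0 //= /f adjZc conjc_real adjD adjM !IH hh.
have fl g g' : nr g <= rho -> nr g' <= rho -> nr (f g - f g') <= rho * nr (g - g').
  move=> gr gr'; rewrite /f -scalerBr nrZr nh opprD addrACA subrr add0r.
  have -> : g ** g - g' ** g' = g ** (g - g') + (g - g') ** g'.
    by rewrite cmulBl cmulBr addrA subrK.
  have := nrD (g ** (g - g')) ((g - g') ** g').
  have := nr_cmul g (g - g'); have := nr_cmul (g - g') g'.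
  by have := nr_ge0 (g - g'); nra.
have us n : nr (u n.+1 - u n) <= rho ^+ n.
  elim: n => [|n IH]; first by rewrite expr0 subr0; exact: le_trans (un 1%N) (ltW rho1).
  rewrite exprS; apply: le_trans (fl _ _ (un n.+1) (un n)) _.
  by rewrite ler_pM2l.
have um n m : nr (u (n + m)%N - u n) <= rho ^+ n * (1 - rho ^+ m) / (1 - rho).
  elim: m => [|m IH]; first by rewrite addn0 subrr nr0 expr0 subrr mulr0 mul0r.
  rewrite addnS; have := nrBD (u (n + m)%N) (u (n + m).+1) (u n).
  have := us (n + m)%N; rewrite exprD exprS.
  have -> : rho ^+ n * (1 - rho * rho ^+ m) / (1 - rho) =
    rho ^+ n * (1 - rho ^+ m) / (1 - rho) + rho ^+ n * rho ^+ m.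
    by field; rewrite subr_eq0 gt_eqF.
  lra.
have [g gl] : exists l, forall n, nr (l - u n) <= rho ^+ n / (1 - rho).
  apply: cauchy_seq_cvg => [n m nm|e e0].
    rewrite -(subnKC nm); apply: le_trans (um _ _) _.
    rewrite ler_pM2r ?invr_gt0 ?subr_gt0 // ler_piMr ?exprn_ge0 ?ltW //.
    by rewrite ltrBlDr ltrDl exprn_gt0.
  have /cvgrPdist_le/(_ (e * (1 - rho))) : (fun n => rho ^+ n) @ \oo --> (0 : R).
    by apply: cvg_expr; rewrite ger0_norm // ltW.
  case; first by rewrite mulr_gt0 // subr_gt0.
  move=> N _ /(_ N (leqnn N)) /=; rewrite sub0r normrN ger0_norm ?exprn_ge0 ?(ltW rho0) // => h'.
  by exists N; rewrite ler_pdivrMr // subr_gt0.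
have small (e : R) : 0 < e -> exists n, nr (g - u n) <= e /\ nr (u n.+1 - u n) <= e.
  move=> e0.
  have /cvgrPdist_le/(_ (e * (1 - rho))) : (fun n => rho ^+ n) @ \oo --> (0 : R).
    by apply: cvg_expr; rewrite ger0_norm // ltW.
  case; first by rewrite mulr_gt0 // subr_gt0.
  move=> N _ /(_ N (leqnn N)) /=; rewrite sub0r normrN ger0_norm ?exprn_ge0 ?(ltW rho0) // => h'.
  exists N; split; last by apply: le_trans (us N) _; nra.
  by apply: le_trans (gl N) _; rewrite ler_pdivrMr // subr_gt0.
have gr : nr g <= rho.
  apply/ler_addgt0Pr => e e0; have [n [gn _]] := small e e0.
  by have := nrD (g - u n) (u n); rewrite subrK; have := un n; lra.
exists g.
  apply/eqP; rewrite -subr_eq0; apply/eqP/nr_small => e e0.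
  have [n [gn _]] := small (e / 2) (divr_gt0 e0 (ltr0Sn _ 1)).
  have := nrBD (u n) (adj g) g; rewrite -{1}(ua n) -adjB nr_adj [nr (u n - g)]nrBC.
  lra.
have fg : f g = g.
  apply/eqP; rewrite -subr_eq0; apply/eqP/nr_small => e e0.
  have [n [gn gn']] := small (e / 3) (divr_gt0 e0 (ltr0Sn _ 2)).
  have := nrBD (f (u n)) (f g) g; have := fl _ _ gr (un n).
  have := nrBD (u n) (f (u n)) g; rewrite -/(u n.+1) [nr (u n - g)]nrBC.
  have := nr_ge0 (g - u n); nra.
have : (2 : R)%:C *: f g = (2 : R)%:C *: g by rewrite fg.
rewrite /f scalerA -rmorphM mulrCA divff ?pnatr_eq0 // mulr1 rmorph1 scale1r.
rewrite rmorphD rmorph1 scalerDl scale1r => <-.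
by rewrite addrK.
Qed.
End CStar.

Section StarRep.
Context {R : realType} {A : cstar_algebra R} {H : hilbert_space R}.
Variables (pi : A -> {linear H -> H}) (spi : is_star_rep pi).

Lemma star_repD a b x : pi (a + b) x = pi a x + pi b x.
Proof.
have := rep_lin (proj1 spi) 1 (I : setT a) (I : setT b) x.
by rewrite !scale1r.
Qed.

Lemma star_rep0 x : pi 0 x = 0.
Proof.
by apply: (addIr (pi 0 x)); rewrite -star_repD !add0r.
Qed.

Lemma star_repZ k a x : pi (k *: a) x = k *: pi a x.
Proof.
have := rep_lin (proj1 spi) k (I : setT a) (I : setT 0) x.
by rewrite !addr0 star_rep0 addr0.
Qed.

Lemma star_repN a x : pi (- a) x = - pi a x.
Proof. by rewrite -scaleN1r star_repZ scaleN1r. Qed.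

Lemma star_repB a b x : pi (a - b) x = pi a x - pi b x.
Proof. by rewrite star_repD star_repN. Qed.

Lemma star_repM a b x : pi (a ** b) x = pi a (pi b x).
Proof. exact: (rep_mul (proj1 spi)). Qed.

Lemma star_rep_sum (I : Type) (s : seq I) (P : pred I) (F : I -> A) x :
  pi (\sum_(i <- s | P i) F i) x = \sum_(i <- s | P i) pi (F i) x.
Proof. by apply: (big_morph (fun a => pi a x)) => [? ?|]; [exact: star_repD|exact: star_rep0]. Qed.

Lemma star_rep_adj a x y : dot (pi a x) y = dot x (pi (adj a) y).
Proof. exact: (proj2 spi). Qed.

Lemma star_rep_adjr a x y : dot x (pi a y) = dot (pi (adj a) x) y.
Proof. by rewrite star_rep_adj adjK. Qed.

Lemma star_rep_nr2 a x : (nr (pi a x) ^+ 2)%:C = dot (pi (adj a ** a) x) x.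
Proof. by rewrite star_repM -[in RHS]star_rep_adjr dotxx. Qed.

(** Let |a| < r and write h = a^* a / r^2 as 2g - g^2 with g self-adjoint.  Then
    |x|^2 - <pi(h) x, x> = |x - pi(g) x|^2 >= 0, that is, |pi(a) x| <= r |x|. *)
Lemma star_rep_contractive a x : nr (pi a x) <= nr a * nr x.
Proof.
suff le (r : R) : nr a < r -> nr (pi a x) <= r * nr x.
  apply/ler_addgt0Pr => e e0; have x0 := nr_ge0 x.
  have d0 : 0 < e / (nr x + 1) by rewrite divr_gt0 //; lra.
  have := le (nr a + e / (nr x + 1)); rewrite ltrDl d0 => /(_ isT) h.
  apply: le_trans h _; rewrite mulrDl lerD2l -mulrA ler_piMr ?(ltW e0) //.
  by rewrite mulrC ler_pdivrMr; lra.
move=> ar; have r0 : 0 < r by apply: le_lt_trans ar; exact: nr_ge0.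
have r2 : 0 < r ^+ 2 by rewrite exprn_gt0.
pose h : A := ((r ^+ 2)^-1)%:C *: (adj a ** a).
have [] := @sqrt_one_minus _ _ h.
- by rewrite /h adjZc conjc_real adjM adjK.
- rewrite /h nrZr nr_adjM ger0_norm ?invr_ge0 ?ltW // mulrC ltr_pdivrMr // mul1r.
  by rewrite ltr_pXn2r ?nnegrE ?nr_ge0 // ltW.
move=> g gg gh.
have : (nr (pi a x) ^+ 2)%:C = (r ^+ 2)%:C * dot (pi h x) x.
  rewrite star_rep_nr2 star_repZ dotZl mulrA -rmorphM divff ?gt_eqF //.
  by rewrite mul1r.
rewrite -gh star_repB star_repD star_repM dotBl dotDl [dot (pi g (pi g x)) x]star_rep_adj gg dotxx.
move=> e.
have {e} : nr (pi a x) ^+ 2 = r ^+ 2 * (2 * complex.Re (dot (pi g x) x) - nr (pi g x) ^+ 2).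
  have := congr1 (@complex.Re R) e; rewrite /=.
  by case: (dot (pi g x) x) => u v /= ->; ring.
have : 0 <= nr (pi g x - x) ^+ 2 by exact: sqr_ge0.
rewrite nrB2 => pos e.
rewrite -(@ler_pXn2r _ 2) ?nnegrE ?mulr_ge0 ?nr_ge0 ?(ltW r0) // e exprMn ler_pM2l //.
lra.
Qed.
End StarRep.

(** * Banach spaces of families bounded by a gauge *)

(** A recipe for Banach spaces of families x = (x_j), where [bnd x c] stands for
    |x| <= c.  Completeness comes from [bnd_lsc]: the balls are closed under
    approximation on finite sets of indices.  Hilbert sums (the index is the
    summand), operators on a space (the index is the argument) and closed
    subspaces (a single index) are all of this form. *)
Record gauge (R : realType) := Gauge {
  idx : eqType;
  fib : idx -> completeNormedModType (complexField R);
  dom : set (forall j, fib j);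
  bnd : (forall j, fib j) -> R -> Prop;
  dom0 : dom (fun j => 0);
  domP : forall (k : R[i]) x y, dom x -> dom y -> dom (fun j => k *: x j + y j);
  bnd_ge0 : forall x c, bnd x c -> 0 <= c;
  bnd_le : forall x c d, bnd x c -> c <= d -> bnd x d;
  bnd0 : bnd (fun j => 0) 0;
  bndD : forall x y c d, bnd x c -> bnd y d -> bnd (fun j => x j + y j) (c + d);
  bndZ : forall (k : R[i]) x c, bnd x c ->
    bnd (fun j => k *: x j) (nr (k : complexField R) * c);
  dom_bnd : forall x, dom x -> exists c, bnd x c;
  bnd_inf : forall x c, 0 <= c -> (forall e, 0 < e -> bnd x (c + e)) -> bnd x c;
  bnd_coord : forall j, exists2 k, 0 <= k & forall x c, bnd x c -> nr (x j) <= k * c;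
  bnd_lsc : forall y c, 0 <= c ->
    (forall (F : seq idx) (d : R), 0 < d -> exists2 x, bnd x c &
       forall j, j \in F -> nr (x j - y j) <= d) -> bnd y c;
  dom_lim : forall y, (forall e : R, 0 < e -> exists2 x, dom x &
      bnd (fun j => y j - x j) e) -> dom y
}.

Definition gauge_type (R : realType) (g : gauge R) : Type := {x | @dom R g x}.

HB.instance Definition _ (R : realType) (g : gauge R) :=
  gen_eqMixin (gauge_type g).
HB.instance Definition _ (R : realType) (g : gauge R) :=
  gen_choiceMixin (gauge_type g).

Section GaugeModule.
Context {R : realType} (g : gauge R).
Local Notation T := (gauge_type g).
Implicit Types x y z : T.

Lemma gauge_ext x y : (forall j, sval x j = sval y j) -> x = y.
Proof.
case: x y => [x hx] [y hy] /= xy; apply: eq_exist.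
exact: functional_extensionality_dep.
Qed.

Definition gauge0 : T := exist _ _ (dom0 g).

Lemma dom_opp x : dom (fun j => - sval x j).
Proof.
have := domP (-1) (svalP x) (dom0 g); congr dom.
by apply: functional_extensionality_dep => j; rewrite addr0 scaleN1r.
Qed.

Lemma dom_add x y : dom (fun j => sval x j + sval y j).
Proof.
have := domP 1 (svalP x) (svalP y); congr dom.
by apply: functional_extensionality_dep => j; rewrite scale1r.
Qed.

Lemma dom_scale (k : R[i]) x : dom (fun j => k *: sval x j).
Proof.
have := domP k (svalP x) (dom0 g); congr dom.
by apply: functional_extensionality_dep => j; rewrite addr0.
Qed.

Definition gauge_opp x : T := exist _ _ (dom_opp x).
Definition gauge_add x y : T := exist _ _ (dom_add x y).
Definition gauge_scale (k : complexField R) x : T := exist _ _ (dom_scale k x).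

Lemma gauge_addA : associative gauge_add.
Proof. by move=> x y z; apply: gauge_ext => j /=; rewrite addrA. Qed.
Lemma gauge_addC : commutative gauge_add.
Proof. by move=> x y; apply: gauge_ext => j /=; rewrite addrC. Qed.
Lemma gauge_add0 : left_id gauge0 gauge_add.
Proof. by move=> x; apply: gauge_ext => j /=; rewrite add0r. Qed.
Lemma gauge_addN : left_inverse gauge0 gauge_opp gauge_add.
Proof. by move=> x; apply: gauge_ext => j /=; rewrite addNr. Qed.

HB.instance Definition _ := GRing.isZmodule.Build T
  gauge_addA gauge_addC gauge_add0 gauge_addN.

Lemma gauge_scaleA a b x : gauge_scale a (gauge_scale b x) = gauge_scale (a * b) x.
Proof. by apply: gauge_ext => j /=; rewrite scalerA. Qed.
Lemma gauge_scale1 : left_id 1 gauge_scale.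
Proof. by move=> x; apply: gauge_ext => j /=; rewrite scale1r. Qed.
Lemma gauge_scaleDr : right_distributive gauge_scale +%R.
Proof. by move=> k x y; apply: gauge_ext => j /=; rewrite scalerDr. Qed.
Lemma gauge_scaleDl x : {morph gauge_scale^~ x : a b / a + b}.
Proof. by move=> a b; apply: gauge_ext => j /=; rewrite scalerDl. Qed.

HB.instance Definition _ := GRing.Zmodule_isLmodule.Build (complexField R) T
  gauge_scaleA gauge_scale1 gauge_scaleDr gauge_scaleDl.

Definition gauge_norm x : R := inf [set c | bnd (sval x) c].

Lemma gauge_has_inf x : has_inf [set c | bnd (sval x) c].
Proof.
split; first exact: dom_bnd (svalP x).
by exists 0 => c /bnd_ge0.
Qed.

Lemma gauge_norm_ge0 x : 0 <= gauge_norm x.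
Proof. by apply: lb_le_inf (gauge_has_inf x).1 _ => c /bnd_ge0. Qed.

Lemma gauge_norm_bnd x : bnd (sval x) (gauge_norm x).
Proof.
apply: bnd_inf (gauge_norm_ge0 x) _ => e e0.
have [c xc ce] := inf_adherent e0 (gauge_has_inf x).
exact: bnd_le xc (ltW ce).
Qed.

Lemma gauge_norm_le x c : bnd (sval x) c -> gauge_norm x <= c.
Proof. by move=> xc; apply: ge_inf xc; exists 0 => d /bnd_ge0. Qed.

Definition gauge_cnorm x : complexField R := (gauge_norm x)%:C.

Lemma gauge_normD x y : gauge_cnorm (x + y) <= gauge_cnorm x + gauge_cnorm y.
Proof.
rewrite /gauge_cnorm -rmorphD lecR; apply: gauge_norm_le.
exact: bndD (gauge_norm_bnd x) (gauge_norm_bnd y).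
Qed.

Lemma gauge_normZ_le (k : complexField R) x :
  gauge_norm (k *: x) <= nr k * gauge_norm x.
Proof. by apply: gauge_norm_le; exact: bndZ (gauge_norm_bnd x). Qed.

Lemma gauge_normZ (k : complexField R) x :
  gauge_cnorm (k *: x) = `|k| * gauge_cnorm x.
Proof.
rewrite nrE /gauge_cnorm -rmorphM; congr (_%:C).
apply/eqP; rewrite eq_le gauge_normZ_le /=.
have [->|k0] := eqVneq k 0; first by rewrite nr0 mul0r gauge_norm_ge0.
have n0 : 0 < nr k by exact: nr_gt0.
have := gauge_normZ_le k^-1 (k *: x); rewrite scalerA mulVf // scale1r.
move=> h; have kk : nr k * nr k^-1 = 1.
  by rewrite -nrCM divff // nrC_real normr1.
by rewrite -[leRHS]mul1r -kk -mulrA ler_pM2l.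
Qed.

Lemma gauge_norm_eq0 x : gauge_cnorm x = 0 -> x = 0.
Proof.
move=> /(@complexI _ _ 0) x0; apply: gauge_ext => j /=.
have [k _ /(_ _ _ (gauge_norm_bnd x))] := bnd_coord j.
rewrite x0 mulr0 => xj; apply: nr_eq0.
by apply/eqP; rewrite eq_le xj nr_ge0.
Qed.

HB.instance Definition _ := Lmodule_isNormed.Build (complexField R) T
  gauge_normD gauge_normZ gauge_norm_eq0.

Lemma bndP x c : nr x <= c <-> bnd (sval x) c.
Proof.
split=> [xc|]; last exact: gauge_norm_le.
exact: bnd_le (gauge_norm_bnd x) xc.
Qed.

(** The coordinatewise limit of a Cauchy filter is a limit in norm, since the
    balls are closed under approximation on finite sets of coordinates. *)
Lemma gauge_complete (F : set_system T) : ProperFilter F -> cauchy F -> cvg F.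
Proof.
move=> FF cF.
have small (e : R) : 0 < e -> exists2 A, F A & forall x y, A x -> A y -> nr (x - y) <= e.
  move=> e0; have e0' : 0 < e%:C :> complexField R by rewrite ltcR.
  have /cauchy_ballP/(_ e%:C e0') [[A B] /= [FA FB] AB] := cF.
  exists (A `&` B); first exact: filterI.
  move=> x y [Ax _] [_ By]; have := AB (x, y) (conj Ax By).
  by rewrite /= -ball_normE /ball_ /= nrE ltcR => /ltW.
have coord j : exists l, forall e : R, 0 < e ->
    exists2 B, F B & forall x, B x -> nr (sval x j - l) <= e.
  have [k k0 kj] := bnd_coord (g := g) j.
  pose G := (fun x : T => sval x j) @ F.
  have cG : cauchy G.
    apply/cauchy_ballP => e /posC_real[a a0 ->].
    have k1 : 0 < k + 1 by lra.
    have [A FA hA] := small (a / (k + 1) / 2) (divr_gt0 (divr_gt0 a0 k1) (ltr0Sn _ 1)).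
    exists ((fun x : T => sval x j) @` A, (fun x : T => sval x j) @` A) => /=.
      by split; apply: (@filterS _ F _ A) FA => x Ax; exists x.
    move=> [_ _] [[x Ax <-] [y Ay <-]] /=.
    rewrite -ball_normE /ball_ /= nrE ltcR.
    have /bndP/kj /= h := hA _ _ Ax Ay; apply: le_lt_trans h _.
    set u := _ / 2; have -> : a = 2 * u * (k + 1) by rewrite /u; field; rewrite gt_eqF.
    have u0 : 0 < u by rewrite /u !divr_gt0.
    by nra.
  have /cvg_ex[l Gl] : cvg G by apply: cauchy_cvg.
  exists l => e e0; have hl : nbhs l [set y | nr (l - y) < e] by apply/nbhs_nrP; exists e.
  have := Gl _ hl; exists (fun x => nr (l - sval x j) < e) => // x /ltW.
  by rewrite nrBC.
pose y j := sval (cid (coord j)).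
have hy j (e : R) : 0 < e -> exists2 B, F B & forall x, B x -> nr (sval x j - y j) <= e.
  exact: (svalP (cid (coord j))).
have near (e : R) : 0 < e ->
    exists2 A, F A & forall x, A x -> bnd (fun j => y j - sval x j) e.
  move=> e0; have [A FA hA] := small e e0; exists A => // x Ax.
  apply: bnd_lsc (ltW e0) _ => s d d0.
  have [B FB hB] : exists2 B, F B & forall z, B z -> forall j, j \in s -> nr (sval z j - y j) <= d.
    elim: s => [|j s [B FB hB]]; first by exists setT => //; exact: filterT.
    have [D FD hD] := hy j d d0; exists (B `&` D); first exact: filterI.
    by move=> z [Bz Dz] i; rewrite inE => /orP[/eqP->|]; [exact: hD|exact: hB].
  have [z [Az Bz]] : A `&` B !=set0 by exact: (filter_ex (filterI FA FB)).
  exists (sval (z - x)); first by apply/bndP; exact: hA.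
  by move=> j js /=; rewrite opprB addrA subrK; apply: hB.
have Sy : dom y.
  apply: dom_lim => e e0; have [A /filter_ex[x Ax] hA] := near e e0.
  by exists (sval x); [exact: svalP|exact: hA].
apply/cvg_ex; exists (exist _ y Sy : T) => B /nbhs_nrP[e e0 eB].
have [A FA hA] := near (e / 2) (divr_gt0 e0 (ltr0Sn _ 1)).
apply: filterS FA => x Ax; apply: eB.
by have /hA/(bndP ((exist _ y Sy : T) - x)) := Ax; lra.
Qed.

HB.instance Definition _ := Uniform_isComplete.Build T gauge_complete.

End GaugeModule.

Definition gauge_module (R : realType) (g : gauge R) :
  completeNormedModType (complexField R) := gauge_type g.

(** * Hilbert sums *)

(** For e small, (c + e)^2 is as close to c^2 as desired. *)
Lemma sqr_lim (R : realType) (z c : R) : 0 <= c ->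
  (forall e, 0 < e -> z <= (c + e) ^+ 2) -> z <= c ^+ 2.
Proof.
move=> c0 h; apply/ler_addgt0Pr => e e0.
have k0 : 0 < 2 * c + 1 by lra.
pose d := Num.min 1 (e / (2 * c + 1)).
have d0 : 0 < d by rewrite lt_min ltr01 divr_gt0.
have d1 : d <= 1 by rewrite ge_min lexx.
have de : d * (2 * c + 1) <= e by rewrite -ler_pdivlMr // ge_min lexx orbT.
by apply: le_trans (h d d0) _; nra.
Qed.

(** After multiplication by c d the inequality follows, term by term, from
    (d a - c b)^2 >= 0; the bounds are perturbed to make c and d positive. *)
Lemma minkowski2 (R : realType) (J : Type) (s : seq J) (a b : J -> R) (c d : R) :
  0 <= c -> 0 <= d ->
  \sum_(j <- s) a j ^+ 2 <= c ^+ 2 -> \sum_(j <- s) b j ^+ 2 <= d ^+ 2 ->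
  \sum_(j <- s) (a j + b j) ^+ 2 <= (c + d) ^+ 2.
Proof.
move=> c0 d0 ac bd; apply: sqr_lim => [|e e0]; first by lra.
pose c' := c + e / 2; pose d' := d + e / 2.
have c'0 : 0 < c' by rewrite /c'; lra.
have d'0 : 0 < d' by rewrite /d'; lra.
have ac' : \sum_(j <- s) a j ^+ 2 <= c' ^+ 2.
  by apply: le_trans ac _; rewrite ler_pXn2r ?nnegrE ?(ltW c'0) // /c'; lra.
have bd' : \sum_(j <- s) b j ^+ 2 <= d' ^+ 2.
  by apply: le_trans bd _; rewrite ler_pXn2r ?nnegrE ?(ltW d'0) // /d'; lra.
have -> : c + d + e = c' + d' by rewrite /c' /d'; field.
rewrite -(ler_pM2l (mulr_gt0 c'0 d'0)) mulr_sumr.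
have : \sum_(j <- s) c' * d' * (a j + b j) ^+ 2 <=
    \sum_(j <- s) ((c' + d') * d' * a j ^+ 2 + (c' + d') * c' * b j ^+ 2).
  apply: ler_sum => j _; rewrite -subr_ge0.
  have -> : (c' + d') * d' * a j ^+ 2 + (c' + d') * c' * b j ^+ 2 -
    c' * d' * (a j + b j) ^+ 2 = (d' * a j - c' * b j) ^+ 2 by ring.
  exact: sqr_ge0.
rewrite big_split /= -!mulr_sumr => h; apply: le_trans h _.
set A := \sum_(i <- s) a i ^+ 2 in ac' *; set B := \sum_(i <- s) b i ^+ 2 in bd' *.
have h1 : (c' + d') * d' * A <= (c' + d') * d' * c' ^+ 2.
  by rewrite ler_pM2l // mulr_gt0 // addr_gt0.
have h2 : (c' + d') * c' * B <= (c' + d') * c' * d' ^+ 2.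
  by rewrite ler_pM2l // mulr_gt0 // addr_gt0.
apply: le_trans (lerD h1 h2) _.
by rewrite le_eqVlt; apply/orP; left; apply/eqP; ring.
Qed.

Section L2.
Context {R : realType} (J : eqType) (H : J -> hilbert_space R).
Implicit Types (x y z : forall j, H j).

Definition l2_bnd x (c : R) : Prop :=
  0 <= c /\ forall s, uniq s -> \sum_(j <- s) nr (x j) ^+ 2 <= c ^+ 2.

Definition l2_dom : set (forall j, H j) := [set x | exists c, l2_bnd x c].

Lemma l2_bnd0 : l2_bnd (fun j => 0) 0.
Proof. by split=> // s _; rewrite big1 ?expr0n // => j _; rewrite nr0 expr0n. Qed.

Lemma l2_bndD x y c d : l2_bnd x c -> l2_bnd y d -> l2_bnd (fun j => x j + y j) (c + d).
Proof.
move=> [c0 xc] [d0 yd]; split=> [|s us]; first exact: addr_ge0.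
apply: le_trans (minkowski2 c0 d0 (xc s us) (yd s us)).
apply: ler_sum => j _; rewrite ler_pXn2r ?nnegrE ?addr_ge0 ?nr_ge0 //.
exact: nrD.
Qed.

Lemma l2_bndZ (k : R[i]) x c : l2_bnd x c ->
  l2_bnd (fun j => k *: x j) (nr (k : complexField R) * c).
Proof.
move=> [c0 xc]; split=> [|s us]; first by rewrite mulr_ge0 ?nr_ge0.
under eq_bigr do rewrite nrZ exprMn.
by rewrite -mulr_sumr exprMn ler_wpM2l ?sqr_ge0 ?xc.
Qed.

Lemma l2_bnd_le x c d : l2_bnd x c -> c <= d -> l2_bnd x d.
Proof.
move=> [c0 xc] cd; have d0 := le_trans c0 cd; split=> // s us.
by apply: le_trans (xc s us) _; rewrite ler_pXn2r.
Qed.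

Lemma l2_bnd_inf x c : 0 <= c -> (forall e, 0 < e -> l2_bnd x (c + e)) -> l2_bnd x c.
Proof.
move=> c0 h; split=> // s us; apply: sqr_lim => // e e0.
by have [_ ] := h e e0; exact.
Qed.

Lemma l2_bnd_coord j : exists2 k, 0 <= k &
  forall x c, l2_bnd x c -> nr (x j) <= k * c.
Proof.
exists 1 => // x c [c0 xc]; have := xc [:: j] isT; rewrite big_seq1 mul1r.
by rewrite ler_pXn2r // nnegrE nr_ge0.
Qed.

Lemma l2_bnd_lsc y c : 0 <= c ->
  (forall (F : seq J) (d : R), 0 < d -> exists2 x, l2_bnd x c &
       forall j, j \in F -> nr (x j - y j) <= d) -> l2_bnd y c.
Proof.
move=> c0 h; split=> // s us; apply: sqr_lim => // e e0.
pose n : R := (size s)%:R + 1.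
have n0 : 0 < n by rewrite ltr_wpDl ?ler0n.
have [x [_ xc] xy] := h s (e / n) (divr_gt0 e0 n0).
have e1 : \sum_(j <- s) (e / n) ^+ 2 <= e ^+ 2.
  rewrite big_const_seq count_predT iter_addr_0 -mulr_natl exprMn exprVn.
  rewrite mulrCA ler_piMr ?sqr_ge0 // ler_pdivrMr ?exprn_gt0 // mul1r.
  by have : (0 : R) <= (size s)%:R by []; rewrite /n; nra.
apply: le_trans (minkowski2 c0 (ltW e0) (xc s us) e1).
rewrite big_seq [leRHS]big_seq; apply: ler_sum => j js.
rewrite ler_pXn2r ?nnegrE ?addr_ge0 ?nr_ge0 ?divr_ge0 ?(ltW n0) ?(ltW e0) //.
have := nrD (x j) (y j - x j); rewrite addrC subrK [nr (y j - _)]nrBC.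
by have := xy j js; lra.
Qed.

Lemma l2_domP (k : R[i]) x y : l2_dom x -> l2_dom y -> l2_dom (fun j => k *: x j + y j).
Proof.
by move=> [c xc] [d yd]; exists (nr (k : complexField R) * c + d); apply: l2_bndD => //; exact: l2_bndZ.
Qed.

Lemma l2_dom_lim y : (forall e : R, 0 < e -> exists2 x, l2_dom x &
  l2_bnd (fun j => y j - x j) e) -> l2_dom y.
Proof.
move=> /(_ 1 ltr01)[x [c xc] yx]; exists (1 + c).
suff -> : y = (fun j => (y j - x j) + x j) by exact: l2_bndD.
by apply: functional_extensionality_dep => j; rewrite subrK.
Qed.

Definition l2_gauge : gauge R := @Gauge R J (fun j => H j) l2_dom l2_bnd
  (ex_intro _ 0 l2_bnd0) l2_domP (fun x c => @proj1 _ _) l2_bnd_le l2_bnd0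
  l2_bndD l2_bndZ (fun x dx => dx) l2_bnd_inf l2_bnd_coord l2_bnd_lsc l2_dom_lim.

(** Unconditional summation, along the finite sets of indices ordered by
    inclusion. *)
Definition is_sum (f : J -> R[i]) (l : R[i]) : Prop := forall e : R, 0 < e ->
  exists s0 : seq J, forall s, uniq s -> {subset s0 <= s} ->
    nr (\sum_(j <- s) f j - l : complexField R) <= e.

Lemma is_sum_unique f l m : is_sum f l -> is_sum f m -> l = m.
Proof.
move=> fl fm; apply/eqP; rewrite -subr_eq0; apply/eqP/nr_small => e e0.
have e2 : 0 < e / 2 by lra.
have [s hs] := fl _ e2; have [s' hs'] := fm _ e2.
pose u := undup (s ++ s').
have := hs u (undup_uniq _); have := hs' u (undup_uniq _).
move=> h1 h2; have := nrBD (\sum_(j <- u) f j : complexField R) l m.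
rewrite [nr (l - \sum_(j <- u) f j)]nrBC.
have {}h1 : nr (\sum_(j <- u) f j - m : complexField R) <= e / 2.
  by apply: h1 => j; rewrite mem_undup mem_cat => ->; rewrite orbT.
have {}h2 : nr (\sum_(j <- u) f j - l : complexField R) <= e / 2.
  by apply: h2 => j; rewrite mem_undup mem_cat => ->.
lra.
Qed.

Lemma is_sumP (k : R[i]) f g l m : is_sum f l -> is_sum g m ->
  is_sum (fun j => k * f j + g j) (k * l + m).
Proof.
move=> fl gm e e0; pose a := nr (k : complexField R) + 1.
have a0 : 0 < a by rewrite ltr_wpDl ?nr_ge0.
have [s hs] := fl (e / 2 / a) (divr_gt0 (divr_gt0 e0 (ltr0Sn _ 1)) a0).
have [s' hs'] := gm (e / 2) (divr_gt0 e0 (ltr0Sn _ 1)).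
exists (s ++ s') => u uu us.
rewrite big_split /= -mulr_sumr opprD addrACA -mulrBr.
apply: le_trans (nrD _ _) _; rewrite nrCM.
have {}hs : nr (\sum_(j <- u) f j - l : complexField R) <= e / 2 / a.
  by apply: hs => // j js; apply: us; rewrite mem_cat js.
have {}hs' : nr (\sum_(j <- u) g j - m : complexField R) <= e / 2.
  by apply: hs' => // j js; apply: us; rewrite mem_cat js orbT.
have k0 := nr_ge0 (k : complexField R).
set X := nr (_ - l : complexField R) in hs *.
have X0 : 0 <= X := nr_ge0 _.
have : X * a <= e / 2 by rewrite -ler_pdivlMr.
by rewrite /a; nra.
Qed.

Lemma is_sum_eq f g l m : is_sum f l -> (forall j, f j = g j) -> l = m -> is_sum g m.
Proof. by move=> h fg <-; have -> : g = f by apply/funext. Qed.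

Lemma is_sum0 : is_sum (fun _ => 0) 0.
Proof. by move=> e e0; exists [::] => s _ _; rewrite big1 // subrr nr0 ltW. Qed.

Lemma is_sum_conj f l : is_sum f l -> is_sum (fun j => conjc (f j)) (conjc l).
Proof.
move=> fl e e0; have [s hs] := fl e e0; exists s => u uu us.
by rewrite -rmorph_sum -rmorphB nr_conj hs.
Qed.

Lemma sum_subset (f : J -> R) (s t : seq J) : (forall j, 0 <= f j) ->
  uniq s -> uniq t -> {subset s <= t} -> \sum_(j <- s) f j <= \sum_(j <- t) f j.
Proof.
move=> f0 us ut st.
rewrite [leRHS](bigID (fun j => j \in s)) /= -[leLHS]addr0 lerD ?sumr_ge0 //.
rewrite -[leRHS]big_filter (perm_big [seq j <- t | j \in s]) //.
apply: uniq_perm => //; first exact: filter_uniq.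
by move=> j; rewrite mem_filter; case: (boolP (j \in s)) => //= /st.
Qed.

Local Notation T := (gauge_type l2_gauge).

(** The finite sums of squares increase to the least bound for them. *)
Lemma is_sum_nr2 (x : T) : is_sum (fun j => (nr (sval x j) ^+ 2)%:C) (nr x ^+ 2)%:C.
Proof.
have [N0 xN] : l2_bnd (sval x) (nr x) by exact/(bndP (g := l2_gauge)).
move=> e e0.
have [s us hs] : exists2 s, uniq s & nr x ^+ 2 - e <= \sum_(j <- s) nr (sval x j) ^+ 2.
  apply: contrapT => hn.
  have {}hn s : uniq s -> \sum_(j <- s) nr (sval x j) ^+ 2 <= nr x ^+ 2 - e.
    move=> us; rewrite leNgt; apply/negP => /ltW h.
    by apply: hn; exists s.
  have p0 := hn [::] isT; rewrite big_nil in p0.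
  have : nr x <= Num.sqrt (nr x ^+ 2 - e).
    apply/(bndP (g := l2_gauge)); split=> [|s us]; first exact: sqrtr_ge0.
    by rewrite sqr_sqrtr // hn.
  rewrite -(@ler_pXn2r _ 2) ?nnegrE ?sqrtr_ge0 // sqr_sqrtr //; lra.
exists s => u uu su; rewrite -rmorph_sum -rmorphB nrC_real.
have := xN u uu; have := sum_subset (fun j => sqr_ge0 (nr (sval x j))) us uu su.
by rewrite ler_norml; lra.
Qed.

(** By polarization the sum is a combination of four sums of squares. *)
Lemma l2_dot_ex (x y : T) : exists l, is_sum (fun j => dot (sval x j) (sval y j)) l.
Proof.
pose N (z : T) := (nr z ^+ 2)%:C.
pose i : R[i] := 'i%C.
exists (1/4 * N (x + y) + (- (1/4) * N (x - y) +
  (i / 4 * N (x + (i : complexField R) *: y) + (- (i/4) * N (x - (i : complexField R) *: y) + 0)))).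
have P (z : T) := is_sum_nr2 z.
apply: is_sum_eq (is_sumP (1/4) (P _) (is_sumP (-(1/4)) (P _)
  (is_sumP (i/4) (P _) (is_sumP (-(i/4)) (P _) is_sum0)))) _ _ => // j.
rewrite -!dotxx /= !dotDl !dotDr !dotNl !dotNr !dotZl !dotZr.
have ci : conjc i = - i by rewrite /i /conjc; apply/eqP; rewrite eq_complex /= oppr0 !eqxx.
have ii : i * i = -1 by rewrite -expr2 sqr_i.
rewrite ci; set a := dot (sval x j) (sval x j); set b := dot (sval x j) (sval y j).
set c := dot (sval y j) (sval x j); set d := dot (sval y j) (sval y j).
transitivity (b / 2 + c / 2 - i * i * (b / 2) + i * i * (c / 2)); first by field.
by rewrite ii; field.
Qed.

Definition l2_dot (x y : T) : complexField R := sval (cid (l2_dot_ex x y)).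

Implicit Types (u v w : T).

Lemma is_sum_dot u v : is_sum (fun j => dot (sval u j) (sval v j)) (l2_dot u v).
Proof. exact: svalP (cid (l2_dot_ex u v)). Qed.

Lemma l2_dot_conj u v : l2_dot u v = conjc (l2_dot v u).
Proof.
apply: is_sum_unique (is_sum_dot u v) (is_sum_eq (is_sum_conj (is_sum_dot v u)) _ erefl).
by move=> j; rewrite -dotC.
Qed.

Lemma l2_dot_lin (k : R[i]) u w v : l2_dot (k *: u + w) v = k * l2_dot u v + l2_dot w v.
Proof.
apply: is_sum_unique (is_sum_dot _ _)
  (is_sum_eq (is_sumP k (is_sum_dot u v) (is_sum_dot w v)) _ erefl).
by move=> j; rewrite /= dotDl dotZl.
Qed.

Lemma l2_dot0 v : l2_dot 0 v = 0.
Proof.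
apply: is_sum_unique (is_sum_dot _ _) (is_sum_eq is_sum0 _ erefl).
by move=> j; rewrite dot0l.
Qed.

Lemma l2_dotBl v : zmod_morphism (l2_dot^~ v).
Proof. by move=> u w; rewrite addrC -scaleN1r l2_dot_lin mulN1r addrC. Qed.

Lemma l2_dotBr v : zmod_morphism (l2_dot v).
Proof. by move=> u w; rewrite l2_dot_conj l2_dotBl rmorphB /= -!l2_dot_conj. Qed.

Lemma l2_dotZl v : scalable_for *%R (l2_dot^~ v).
Proof. by move=> k u; rewrite -[k *: u]addr0 l2_dot_lin l2_dot0 addr0. Qed.

Lemma l2_dotZr v : scalable_for ((@Num.conj (complexClosedField R)) \; *%R) (l2_dot v).
Proof. by move=> k u; rewrite l2_dot_conj l2_dotZl rmorphM /= -l2_dot_conj. Qed.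

Lemma l2_dot_herm u v : l2_dot u v = (-1) ^+ false * Num.conj (l2_dot v u : complexClosedField R).
Proof. by rewrite expr0 mul1r l2_dot_conj. Qed.

Lemma l2_dotxx u : l2_dot u u = (nr u ^+ 2)%:C.
Proof.
apply: is_sum_unique (is_sum_dot _ _) (is_sum_eq (is_sum_nr2 u) _ erefl).
by move=> j; rewrite dotxx.
Qed.

Lemma l2_dot_gt0 u : u != 0 -> 0 < l2_dot u u.
Proof.
move=> x0; rewrite l2_dotxx ltcR exprn_gt0 // lt_neqAle nr_ge0 andbT eq_sym.
by apply: contra_neq x0 => /nr_eq0.
Qed.

HB.instance Definition _ := isBilinear.Build (complexField R) T T (complexField R)
  *%R ((@Num.conj (complexClosedField R)) \; *%R) l2_dot l2_dotBl l2_dotBr l2_dotZl l2_dotZr.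
HB.instance Definition _ := isHermitianSesquilinear.Build (complexField R) T
  false (@Num.conj (complexClosedField R)) l2_dot l2_dot_herm.
HB.instance Definition _ := isDotProduct.Build (complexField R) T l2_dot l2_dot_gt0.

Lemma l2_normE (u : T) : `|u| ^+ 2 = l2_dot u u.
Proof. by rewrite l2_dotxx nrE rmorphXn. Qed.

Definition l2_sum : hilbert_space R :=
  @HilbertSpace R (gauge_module l2_gauge) l2_dot l2_normE.
End L2.

(** * The C*-algebra of bounded operators *)

Section BoundedOperators.
Context {R : realType} (K : hilbert_space R).
Implicit Types (f g h : K -> K) (x y : K) (c d e : R).

Definition adjoint_pair f g := forall x y, dot (f x) y = dot x (g y).

Lemma adjoint_sym f g : adjoint_pair f g -> adjoint_pair g f.
Proof. by move=> fg x y; rewrite dotC -fg -dotC. Qed.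

Lemma adjoint_unique f g h : adjoint_pair f g -> adjoint_pair f h -> g = h.
Proof.
move=> fg fh; apply/funext => y; apply: dot_inj => x.
by rewrite [LHS]dotC [RHS]dotC -fg -fh.
Qed.

Lemma adjointP (k : R[i]) f g f' g' : adjoint_pair f f' -> adjoint_pair g g' ->
  adjoint_pair (fun x => k *: f x + g x) (fun x => conjc k *: f' x + g' x).
Proof.
by move=> ff' gg' x y; rewrite dotDl dotZl ff' gg' dotDr dotZr conjcK.
Qed.

Lemma adjoint_linear f g (k : R[i]) x y : adjoint_pair f g -> f (k *: x + y) = k *: f x + f y.
Proof. by move=> fg; apply: dot_inj => z; rewrite dotDl dotZl !fg dotDl dotZl. Qed.

Definition op_bnd f c : Prop := 0 <= c /\ forall x, nr (f x) <= c * nr x.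

(** |g y|^2 = <f (g y), y> <= c |g y| |y|. *)
Lemma op_bnd_adjoint f g c : adjoint_pair f g -> op_bnd f c -> op_bnd g c.
Proof.
move=> fg [c0 fc]; split=> // y.
have [->|y0] := eqVneq (g y) 0; first by rewrite nr0 mulr_ge0 ?nr_ge0.
have g0 : 0 < nr (g y) by exact: nr_gt0.
rewrite -(ler_pM2l g0).
have : complex.Re (dot (g y) (g y)) = nr (g y) ^+ 2 by rewrite dotxx.
rewrite -fg -expr2 => <-; apply: le_trans (le_Re_nr _) _.
apply: le_trans (cauchy_schwarz _ _) _; by rewrite mulrCA mulrA ler_wpM2r ?nr_ge0.
Qed.

(** Demanding an adjoint at the outset replaces the Riesz representation
    theorem. *)
Definition op_dom : set (K -> K) :=
  [set f | (exists g, adjoint_pair f g) /\ exists c, op_bnd f c].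

Lemma op_bnd0 : op_bnd (fun => 0) 0.
Proof. by split=> // x; rewrite nr0 mul0r. Qed.

Lemma op_dom0 : op_dom (fun => 0).
Proof.
split; first by exists (fun => 0) => x y; rewrite dot0l dot0r.
by exists 0; exact: op_bnd0.
Qed.

Lemma op_bndD f g c d : op_bnd f c -> op_bnd g d -> op_bnd (fun x => f x + g x) (c + d).
Proof.
move=> [c0 fc] [d0 gd]; split=> [|x]; first exact: addr_ge0.
by rewrite mulrDl; apply: le_trans (nrD _ _) _; rewrite lerD.
Qed.

Lemma op_bndZ (k : R[i]) f c : op_bnd f c ->
  op_bnd (fun x => k *: f x) (nr (k : complexField R) * c).
Proof.
move=> [c0 fc]; split=> [|x]; first by rewrite mulr_ge0 ?nr_ge0.
by rewrite nrZ -mulrA ler_wpM2l ?nr_ge0.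
Qed.

Lemma op_domP (k : R[i]) f g : op_dom f -> op_dom g -> op_dom (fun x => k *: f x + g x).
Proof.
move=> [[f' ff'] [c fc]] [[g' gg'] [d gd]]; split.
  by exists (fun x => conjc k *: f' x + g' x); exact: adjointP.
by exists (nr (k : complexField R) * c + d); apply: op_bndD => //; exact: op_bndZ.
Qed.

Lemma op_bnd_le f c d : op_bnd f c -> c <= d -> op_bnd f d.
Proof.
move=> [c0 fc] cd; split=> [|x]; first exact: le_trans cd.
by apply: le_trans (fc x) _; rewrite ler_wpM2r ?nr_ge0.
Qed.

Lemma op_bnd_inf f c : 0 <= c -> (forall e, 0 < e -> op_bnd f (c + e)) -> op_bnd f c.
Proof.
move=> c0 h; split=> // x; apply/ler_addgt0Pr => e e0.
have x0 := nr_ge0 x; have x1 : 0 < nr x + 1 by lra.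
have [_ /(_ x) hx] := h _ (divr_gt0 e0 x1).
apply: le_trans hx _; rewrite mulrDl lerD2l mulrAC ler_pdivrMr // ler_pM2l //; lra.
Qed.

Lemma op_bnd_coord x : exists2 k, 0 <= k & forall f c, op_bnd f c -> nr (f x) <= k * c.
Proof. by exists (nr x); [exact: nr_ge0|move=> f c [_ fc]; rewrite mulrC]. Qed.

Lemma op_bnd_lsc f c : 0 <= c ->
  (forall (F : seq K) d, 0 < d -> exists2 g, op_bnd g c &
       forall x, x \in F -> nr (g x - f x) <= d) -> op_bnd f c.
Proof.
move=> c0 h; split=> // x; apply/ler_addgt0Pr => e e0.
have [g [_ gc] gf] := h [:: x] e e0.
have := gf x (mem_head _ _); have := gc x.
have := nrD (g x) (f x - g x); rewrite addrC subrK [nr (f x - _)]nrBC; lra.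
Qed.

(** The adjoints of a sequence of operators that approximate f form a Cauchy
    sequence at every vector, and their limits define an adjoint of f. *)
Lemma op_dom_lim f : (forall e, 0 < e -> exists2 g, op_dom g &
  op_bnd (fun x => f x - g x) e) -> op_dom f.
Proof.
move=> h; split; last first.
  have [g [_ [c gc]] fg] := h 1 ltr01; exists (1 + c).
  have -> : f = (fun x => (f x - g x) + g x) by apply/funext => x; rewrite subrK.
  exact: op_bndD.
pose e n : R := n.+1%:R^-1.
have e0 n : 0 < e n by rewrite invr_gt0.
have en n m : (n <= m)%N -> e m <= e n.
  by move=> nm; rewrite lef_pV2 ?posrE ?ltr0n // ler_nat ltnS.
have elim (d : R) : 0 < d -> exists n, e n <= d.
  move=> d0; exists (Num.truncn d^-1); rewrite /e.
  rewrite -[leRHS]invrK lef_pV2 ?posrE ?ltr0n ?invr_gt0 //.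
  by rewrite ltW // truncnS_gt // invr_ge0 ltW.
have /choice[u hu] : forall n, exists gg : (K -> K) * (K -> K), adjoint_pair gg.1 gg.2 /\
    op_bnd (fun x => f x - gg.1 x) (e n).
  by move=> n; have [g [[g' gg'] _] fg] := h _ (e0 n); exists (g, g').
have cauchy y n m : (n <= m)%N -> nr ((u m).2 y - (u n).2 y) <= 2 * e n * nr y.
  move=> nm.
  have adj : adjoint_pair (fun x => (u m).1 x - (u n).1 x) (fun x => (u m).2 x - (u n).2 x).
    by move=> x z; rewrite dotBl dotBr (hu m).1 (hu n).1.
  have [_] : op_bnd (fun x => (u m).2 x - (u n).2 x) (2 * e n); last exact.
  apply: op_bnd_adjoint adj _; split=> [|x]; first by rewrite mulr_ge0 ?ltW.
  have := nrBD (f x) ((u m).1 x) ((u n).1 x); rewrite [nr ((u m).1 x - f x)]nrBC.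
  have [_ /(_ x) /= h1] := (hu n).2; have [_ /(_ x) /= h2] := (hu m).2.
  by have := nr_ge0 x; have := en _ _ nm; nra.
have lim y : exists l, forall n, nr (l - (u n).2 y) <= 2 * e n * nr y.
  apply: cauchy_seq_cvg; first exact: cauchy.
  move=> d d0; have y0 := nr_ge0 y; have y1 : 0 < 2 * (nr y + 1) by lra.
  have [n hn] := elim _ (divr_gt0 d0 y1); exists n.
  by move: hn; rewrite ler_pdivlMr //; have := e0 n; nra.
have {lim}[g hg] := choice lim.
exists g => x y; apply/eqP; rewrite -subr_eq0; apply/eqP/nr_small => d d0.
have x0 := nr_ge0 x; have y0 := nr_ge0 y; have x1 : 0 < 3 * (nr x * nr y + 1) by nra.
have [n hn] := elim _ (divr_gt0 d0 x1).
rewrite -(subrK ((u n).1 x) (f x)) -(subrK ((u n).2 y) (g y)) dotDl dotDr (hu n).1.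
rewrite opprD addrACA subrr addr0; apply: le_trans (nrB _ _) _.
have h1 := cauchy_schwarz (f x - (u n).1 x) y; have h2 := cauchy_schwarz x (g y - (u n).2 y).
have [_ /(_ x) /= h3] := (hu n).2; have h4 := hg y n.
by move: hn; rewrite ler_pdivlMr //; have := e0 n; nra.
Qed.

Definition op_gauge : gauge R := @Gauge R K (fun _ => K) op_dom op_bnd
  op_dom0 op_domP (fun f c => @proj1 _ _) op_bnd_le op_bnd0 op_bndD op_bndZ
  (fun f df => proj2 df) op_bnd_inf op_bnd_coord op_bnd_lsc op_dom_lim.

Local Notation T := (gauge_type op_gauge).
Implicit Types (a b : T).

Definition op a : K -> K := sval a.

Lemma op_ext a b : (forall x, op a x = op b x) -> a = b.
Proof. exact: (@gauge_ext _ op_gauge a b). Qed.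

Definition op_adj_fun a : K -> K := sval (cid (svalP a).1).

Lemma op_adj_funP a : adjoint_pair (op a) (op_adj_fun a).
Proof. exact: svalP (cid (svalP a).1). Qed.

Lemma op_adj_dom a : op_dom (op_adj_fun a).
Proof.
split; first by exists (op a); apply: adjoint_sym; exact: op_adj_funP.
by have [c ac] := (svalP a).2; exists c; apply: op_bnd_adjoint ac; exact: op_adj_funP.
Qed.

Definition op_adj a : T := exist _ _ (op_adj_dom a).

Lemma op_adjP a : adjoint_pair (op a) (op (op_adj a)).
Proof. exact: op_adj_funP. Qed.

Lemma op_adjE a (g : K -> K) : adjoint_pair (op a) g -> op (op_adj a) = g.
Proof. by move=> ag; apply: adjoint_unique ag; exact: op_adjP. Qed.

Lemma op_comp_adjoint a b :
  adjoint_pair (fun x => op a (op b x)) (fun x => op (op_adj b) (op (op_adj a) x)).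
Proof. by move=> x y; rewrite !op_adjP. Qed.

Lemma op_comp_bnd a b c d : op_bnd (op a) c -> op_bnd (op b) d ->
  op_bnd (fun x => op a (op b x)) (c * d).
Proof.
move=> [c0 ac] [d0 bd]; split=> [|x]; first exact: mulr_ge0.
by apply: le_trans (ac _) _; rewrite -mulrA ler_wpM2l.
Qed.

Lemma op_comp_dom a b : op_dom (fun x => op a (op b x)).
Proof.
split; first by eexists; exact: op_comp_adjoint.
have [c ac] := (svalP a).2; have [d bd] := (svalP b).2.
by exists (c * d); exact: op_comp_bnd.
Qed.

Definition op_mul a b : T := exist _ _ (op_comp_dom a b).

Lemma op_lin a (k : R[i]) x y : op a (k *: x + y) = k *: op a x + op a y.
Proof. exact: adjoint_linear (op_adjP a). Qed.

Lemma op_linear_subproof a : linear (op a : K -> K).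
Proof. by move=> k x y; exact: op_lin. Qed.

HB.instance Definition _ a := GRing.isLinear.Build (complexField R) K K *:%R (op a)
  (op_linear_subproof a).

Lemma nr_op a x : nr (op a x) <= nr a * nr x.
Proof. by have /(bndP (g := op_gauge))[_] := lexx (nr a); exact. Qed.

Lemma nr_op_le a c : 0 <= c -> (forall x, nr (op a x) <= c * nr x) -> nr a <= c.
Proof. by move=> c0 h; apply/(bndP (g := op_gauge)); split. Qed.

Lemma op_normM a b : `|op_mul a b| <= `|a| * `|b|.
Proof.
rewrite !nrE -rmorphM lecR; apply/(bndP (g := op_gauge)).
by apply: op_comp_bnd; apply/(bndP (g := op_gauge)).
Qed.

Lemma op_norm_adjM a : `|op_mul (op_adj a) a| = `|a| ^+ 2.
Proof.
rewrite !nrE -rmorphXn; congr (_%:C); apply/eqP; rewrite eq_le; apply/andP; split.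
  apply/(bndP (g := op_gauge)); rewrite expr2; apply: op_comp_bnd.
    by apply: op_bnd_adjoint (op_adjP a) _; apply/(bndP (g := op_gauge)).
  exact/(bndP (g := op_gauge)).
set c := nr (op_mul _ _); have c0 : 0 <= c := nr_ge0 _.
rewrite -[leRHS]sqr_sqrtr // ler_pXn2r ?nnegrE ?nr_ge0 ?sqrtr_ge0 //.
apply: nr_op_le (sqrtr_ge0 _) _ => x.
rewrite -(@ler_pXn2r _ 2) ?nnegrE ?mulr_ge0 ?nr_ge0 ?sqrtr_ge0 // exprMn sqr_sqrtr //.
have -> : nr (op a x) ^+ 2 = complex.Re (dot x (op (op_mul (op_adj a) a) x)).
  by rewrite -op_adjP dotxx.
apply: le_trans (le_Re_nr _) _; apply: le_trans (cauchy_schwarz _ _) _.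
rewrite mulrC expr2 mulrA ler_wpM2r ?nr_ge0 //; exact: nr_op.
Qed.

Definition bounded_operators : cstar_algebra R.
Proof.
apply: (@CStarAlgebra R (gauge_module op_gauge) op_mul op_adj) op_normM op_norm_adjM.
- by move=> a b c; exact: op_ext.
- by move=> a b c; exact: op_ext.
- by move=> a b c; apply: op_ext => x; exact: (linearD (op a)).
- by move=> k a b; exact: op_ext.
- by move=> k a b; apply: op_ext => x; exact: (linearZ_LR (op a)).
- move=> a; apply: op_ext => x; congr (_ x); apply: op_adjE.
  by apply: adjoint_sym; exact: op_adjP.
- move=> a b; apply: op_ext => x.
  rewrite (@op_adjE _ (fun x => op (op_adj a) x + op (op_adj b) x)) // => y z.
  by rewrite dotDl dotDr !op_adjP.
- move=> k a; apply: op_ext => x.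
  rewrite (@op_adjE _ (fun x => conjc k *: op (op_adj a) x)) // => y z.
  by rewrite dotZl dotZr conjcK op_adjP.
- move=> a b; apply: op_ext => x.
  by rewrite (@op_adjE _ (fun x => op (op_adj b) (op (op_adj a) x))) //; exact: op_comp_adjoint.
Defined.

End BoundedOperators.

(** * Generated subalgebras and closed star subalgebras *)

Section Generated.
Context {R : realType} {B : cstar_algebra R}.
Implicit Types (G : set B).

Lemma closed_subalgebra_genP G : closed_subalgebra (closed_subalgebra_gen G).
Proof.
split.
- apply/nr_closedP => x h M hM; have [[cM M0 ML MM] GM] := hM.
  have /nr_closedP := cM; apply => e e0; have [y yG xy] := h e e0.
  by exists y => //; exact: yG.
- by move=> M [[]].
- by move=> k a b ha hb M hM; have [[cM M0 ML MM] GM] := hM; apply: ML; [exact: ha|exact: hb].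
- by move=> a b ha hb M hM; have [[cM M0 ML MM] GM] := hM; apply: MM; [exact: ha|exact: hb].
Qed.

Lemma cstar_genP G : cstar_subalgebra (cstar_gen G).
Proof.
split; first split.
- apply/nr_closedP => x h M hM; have [[[cM M0 ML MM] adjM] GM] := hM.
  have /nr_closedP := cM; apply => e e0; have [y yG xy] := h e e0.
  by exists y => //; exact: yG.
- by move=> M [[[]]].
- by move=> k a b ha hb M hM; have [[[cM M0 ML MM] adjM] GM] := hM; apply: ML; [exact: ha|exact: hb].
- by move=> a b ha hb M hM; have [[[cM M0 ML MM] adjM] GM] := hM; apply: MM; [exact: ha|exact: hb].
- by move=> a ha M hM; have [[[cM M0 ML MM] adjM] GM] := hM; apply: adjM; exact: ha.
Qed.
End Generated.

Section SubCStar.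
Context {R : realType} (B : cstar_algebra R) (S : set B) (SP : cstar_subalgebra S).

Definition sub_bnd (x : unit -> B) (c : R) : Prop := nr (x tt) <= c.
Definition sub_dom : set (unit -> B) := [set x | S (x tt)].

Lemma sub_domP (k : R[i]) x y : sub_dom x -> sub_dom y -> sub_dom (fun j => k *: x j + y j).
Proof. by move=> Sx Sy; apply: (subalg_lin (proj1 SP)). Qed.

Lemma sub_bnd_lsc y (c : R) : 0 <= c ->
    (forall (F : seq unit) (d : R), 0 < d -> exists2 x, sub_bnd x c &
       forall j, j \in F -> nr (x j - y j) <= d) -> sub_bnd y c.
Proof.
move=> c0 h; apply/ler_addgt0Pr => e e0.
have [x xc xy] := h [:: tt] e e0; have := xy tt isT.
rewrite /sub_bnd in xc.
have := nrD (x tt) (y tt - x tt); rewrite addrC subrK [nr (y tt - _)]nrBC; lra.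
Qed.

Lemma sub_dom_lim (y : unit -> B) : (forall e : R, 0 < e -> exists2 x, sub_dom x &
      sub_bnd (fun j => y j - x j) e) -> sub_dom y.
Proof.
move=> h; have [[/nr_closedP cS _ _ _] _] := SP; apply: cS => e e0.
by have [x Sx xy] := h e e0; exists (x tt).
Qed.

Definition sub_gauge : gauge R.
Proof.
apply: (@Gauge R unit (fun _ => B) sub_dom sub_bnd) sub_bnd_lsc sub_dom_lim.
- exact: (subalg_0 (proj1 SP)).
- exact: sub_domP.
- by move=> x c; apply: le_trans; exact: nr_ge0.
- by move=> x c d xc; exact: le_trans.
- by rewrite /sub_bnd nr0.
- by move=> x y c d xc yd; apply: le_trans (nrD _ _) _; exact: lerD.
- by move=> k x c xc; rewrite /sub_bnd nrZ ler_wpM2l ?nr_ge0.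
- by move=> x _; exists (nr (x tt)); exact: lexx.
- by move=> x c c0 h; apply/ler_addgt0Pr => e /h.
- by move=> []; exists 1 => // x c; rewrite mul1r.
Defined.

Local Notation T := (gauge_type sub_gauge).
Implicit Types (a b : T).

Definition sub_val a : B := sval a tt.

Lemma sub_ext a b : sub_val a = sub_val b -> a = b.
Proof. by move=> ab; apply: (@gauge_ext _ sub_gauge) => -[]. Qed.

Lemma sub_valP a : S (sub_val a). Proof. exact: svalP a. Qed.

Definition sub_mk (x : B) (Sx : S x) : T := exist _ (fun _ => x) Sx.

Lemma nr_sub a : nr a = nr (sub_val a).
Proof.
apply/eqP; rewrite eq_le; apply/andP; split; first by apply/(bndP (g := sub_gauge)); exact: lexx.
by have /(bndP (g := sub_gauge)) := lexx (nr a).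
Qed.

Definition sub_mul a b : T := sub_mk (subalg_mul (proj1 SP) (sub_valP a) (sub_valP b)).
Definition sub_adj a : T := sub_mk (proj2 SP _ (sub_valP a)).

Definition cstar_sub : cstar_algebra R.
Proof.
apply: (@CStarAlgebra R (gauge_module sub_gauge) sub_mul sub_adj).
- by move=> a b c; apply: sub_ext; exact: cmulA.
- by move=> a b c; apply: sub_ext; exact: cmulDl.
- by move=> a b c; apply: sub_ext; exact: cmulDr.
- by move=> k a b; apply: sub_ext; exact: cmulZl.
- by move=> k a b; apply: sub_ext; exact: cmulZr.
- by move=> a; apply: sub_ext; exact: adjK.
- by move=> a b; apply: sub_ext; exact: adjD.
- by move=> k a; apply: sub_ext; exact: adjZ.
- by move=> a b; apply: sub_ext; exact: adjM.
- by move=> a b; rewrite !nrE -rmorphM lecR !nr_sub; exact: nr_cmul.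
- by move=> a; rewrite !nrE -rmorphXn !nr_sub; congr (_%:C); exact: nr_adjM.
Defined.

Lemma sub_val_hom : star_hom (sub_val : cstar_sub -> B).
Proof. by []. Qed.

End SubCStar.

(** A closed star subalgebra of the subalgebra generated by G is closed in B as
    well, by completeness; if it contains G, it contains what G generates. *)
Lemma sub_cstar_gen (R : realType) (B : cstar_algebra R) (G : set B) :
  let C := cstar_sub (cstar_genP G) in
  cstar_gen [set c : C | G (@sub_val _ _ _ (cstar_genP G) c)] = setT.
Proof.
move=> C; apply/seteqP; split=> // c _ D [[[cD D0 DL DM] Dadj] GD].
pose E := [set x : B | exists2 d : C, D d & @sub_val _ _ _ (cstar_genP G) d = x].
suff : E (@sub_val _ _ _ (cstar_genP G) c) by move=> [d Dd /sub_ext <-].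
have : cstar_gen G (@sub_val _ _ _ (cstar_genP G) c) by exact: sub_valP.
apply; split; last first.
  move=> x Gx; have gx : cstar_gen G x by move=> M [_]; exact.
  by exists (sub_mk (cstar_genP G) gx) => //; exact: GD.
split; first split.
- apply/nr_closedP => x h.
  have gx : cstar_gen G x.
    have [[/nr_closedP cG _ _ _] _] := cstar_genP G; apply: cG => e e0.
    by have [_ [d Dd <-] xd] := h e e0; exists (@sub_val _ _ _ (cstar_genP G) d) => //; exact: sub_valP.
  exists (sub_mk (cstar_genP G) gx) => //.
  have /nr_closedP := cD; apply => e e0; have [_ [d Dd <-] xd] := h e e0.
  by exists d => //; rewrite nr_sub.
- by exists 0.
- move=> k _ _ [d Dd <-] [d' Dd' <-]; exists (k *: d + d') => //; exact: DL.
- move=> _ _ [d Dd <-] [d' Dd' <-]; exists (d ** d') => //; exact: DM.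
- by move=> _ [d Dd <-]; exists (adj d) => //; exact: Dadj.
Qed.

(** * Representations of a correspondence prescribed on a dense span *)

Section StarHom.
Context {R : realType} {A B : cstar_algebra R} (f : A -> B) (hf : star_hom f).

Lemma star_hom0 : f 0 = 0.
Proof.
have := star_hom_lin hf (-1) 0 0.
by rewrite scaleN1r addNr scaleN1r addNr.
Qed.

Lemma star_homD a b : f (a + b) = f a + f b.
Proof. by have := star_hom_lin hf 1 a b; rewrite !scale1r. Qed.

Lemma star_homZ (k : R[i]) a : f (k *: a) = k *: f a.
Proof. by have := star_hom_lin hf k a 0; rewrite star_hom0 !addr0. Qed.

Lemma star_homB a b : f (a - b) = f a - f b.
Proof. by rewrite -scaleN1r star_homD star_homZ scaleN1r. Qed.

Lemma star_hom_sum (I : Type) (s : seq I) (P : pred I) (F : I -> A) :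
  f (\sum_(i <- s | P i) F i) = \sum_(i <- s | P i) f (F i).
Proof. exact: (big_morph f star_homD star_hom0). Qed.
End StarHom.

Section Inner.
Context {R : realType} {A : cstar_algebra R} {X : correspondence A}.
Implicit Types (x y z : X) (k : R[i]).

Lemma innerDl x y z : inner (x + y) z = inner x z + inner y z.
Proof. by rewrite -inner_adj innerD adjD !inner_adj. Qed.

Lemma innerZl k x y : inner (k *: x) y = conjc k *: inner x y.
Proof. by rewrite -inner_adj innerZ adjZc inner_adj. Qed.

Lemma innerNl x y : inner (- x) y = - inner x y.
Proof. by rewrite -scaleN1r innerZl rmorphN1 scaleN1r. Qed.

Lemma innerNr x y : inner x (- y) = - inner x y.
Proof. by rewrite -scaleN1r innerZ scaleN1r. Qed.

Lemma innerBl x y z : inner (x - y) z = inner x z - inner y z.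
Proof. by rewrite innerDl innerNl. Qed.

Lemma innerBr x y z : inner x (y - z) = inner x y - inner x z.
Proof. by rewrite innerD innerNr. Qed.

Lemma inner0r x : inner x 0 = 0.
Proof. by rewrite -(subrr (0 : X)) innerBr subrr. Qed.

Lemma inner0l x : inner 0 x = 0.
Proof. by rewrite -inner_adj inner0r adj0. Qed.

Lemma nr_inner x : nr (inner x x) = nr x ^+ 2.
Proof. by apply/complexI; rewrite rmorphXn /= -!nrE inner_normE. Qed.

(** The form is definite: <d, d> = 0 implies d = 0. *)
Lemma inner_inj x y : (forall z, inner z x = inner z y) -> x = y.
Proof.
move=> xy; apply/eqP; rewrite -subr_eq0; apply/eqP/nr_eq0/eqP.
by rewrite -(sqrf_eq0 (nr _)) -nr_inner innerBr xy subrr nr0.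
Qed.

(** An adjointable map is linear. *)
Lemma left_actP (a : A) k x y : left_act a (k *: x + y) = k *: left_act a x + left_act a y.
Proof.
apply: inner_inj => z; rewrite innerD innerZ.
by rewrite -(adjK a) -!left_act_adj innerD innerZ.
Qed.

Lemma nr_inner_add x y : nr (inner x y) <= 2 * (nr x + nr y) ^+ 2.
Proof.
have sym (u v : X) : inner u v + inner v u = inner (u + v) (u + v) - (inner u u + inner v v).
  apply/eqP; rewrite eq_sym subr_eq; apply/eqP; rewrite innerD !innerDl.
  by rewrite addrACA [in RHS]addrACA [inner u v + _ in RHS]addrC.
have bound (u v : X) : nr (inner u v + inner v u) <= 2 * (nr u + nr v) ^+ 2.
  rewrite sym; apply: le_trans (nrB _ _) _.
  have := nrD (inner u u) (inner v v); rewrite !nr_inner.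
  have := nrD u v; have := nr_ge0 u; have := nr_ge0 v; have := nr_ge0 (u + v); nra.
pose i : R[i] := 'i%C.
have ci : conjc i = - i by rewrite /i /conjc; apply/eqP; rewrite eq_complex /= oppr0 !eqxx.
have ii : i * i = -1 by rewrite -expr2 sqr_i.
have ni : nr (i : complexField R) = 1.
  by rewrite /i /nr /Num.norm /= expr0n /= expr1n add0r sqrtr1.
have e : (2 : R)%:C *: inner x y = (inner x y + inner y x) -
    i *: (inner x (i *: y) + inner (i *: y) x).
  have -> : i *: (inner x (i *: y) + inner (i *: y) x) = inner y x - inner x y.
    by rewrite innerZ innerZl ci scalerDr !scalerA mulrN ii opprK scale1r scaleN1r addrC.
  by rewrite opprB addrACA subrr addr0 rmorphD rmorph1 scalerDl scale1r.
have h : 2 * nr (inner x y) <= 4 * (nr x + nr y) ^+ 2.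
  rewrite -{1}[2]ger0_norm // -nrZr e; apply: le_trans (nrB _ _) _.
  have := bound x y; have := bound x (i *: y); rewrite !nrZ ni !mul1r; lra.
lra.
Qed.

(** A Cauchy-Schwarz inequality with a lossy constant, obtained from
    polarization alone; continuity of the inner product is all that it is for. *)
Lemma nr_inner_le x y : nr (inner x y) <= 8 * nr x * nr y.
Proof.
have [->|x0] := eqVneq x 0; first by rewrite inner0l !nr0 mulr0 mul0r.
have [->|y0] := eqVneq y 0; first by rewrite inner0r !nr0 mulr0.
have X0 : 0 < nr x by exact: nr_gt0.
have Y0 : 0 < nr y by exact: nr_gt0.
have := nr_inner_add ((nr x)^-1%:C *: x) ((nr y)^-1%:C *: y).
rewrite innerZl innerZ conjc_real !nrZr !ger0_norm ?invr_ge0 ?nr_ge0 //.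
rewrite !mulVf ?gt_eqF // mulrA -invfM ler_pdivrMl ?mulr_gt0 //; lra.
Qed.
End Inner.

Section Extension.
Context {R : realType} {A B : cstar_algebra R} {X : correspondence A} {I : Type}.
Variables (x : I -> X) (s : A -> B) (S : I -> B) (c : A -> I -> R[i]).

Definition lincomb (V : lmodType (complexField R)) (v : I -> V) (l : seq (R[i] * I)) : V :=
  \sum_(p <- l) p.1 *: v p.2.

Lemma lincomb_cat (V : lmodType (complexField R)) (v : I -> V) l m :
  lincomb v (l ++ m) = lincomb v l + lincomb v m.
Proof. by rewrite /lincomb big_cat. Qed.

Definition lscale (k : R[i]) (l : seq (R[i] * I)) := [seq (k * p.1, p.2) | p <- l].

Lemma lincomb_scale (V : lmodType (complexField R)) (v : I -> V) k l :
  lincomb v (lscale k l) = k *: lincomb v l.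
Proof.
rewrite /lincomb big_map scaler_sumr; apply: eq_bigr => p _.
by rewrite scalerA.
Qed.

Hypothesis dense : forall (y : X) (e : R), 0 < e ->
  exists l, nr (y - lincomb x l) <= e.
Hypothesis hs : star_hom s.
Hypothesis s_le : forall a, nr (s a) <= nr a.
Hypothesis SS : forall i j, adj (S i) ** S j = s (inner (x i) (x j)).
Hypothesis left_x : forall a i, left_act a (x i) = c a i *: x i.
Hypothesis left_S : forall a i, s a ** S i = c a i *: S i.

Lemma ext_inner l m :
  adj (lincomb S l) ** lincomb S m = s (inner (lincomb x l) (lincomb x m)).
Proof.
rewrite /lincomb; elim: l => [|p l IH]; first by rewrite !big_nil adj0 cmul0l inner0l star_hom0.
rewrite !big_cons adjD cmulDl innerDl (star_homD hs) IH; congr (_ + _).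
elim: m {IH} => [|q m IH]; first by rewrite !big_nil cmul0r inner0r (star_hom0 hs).
rewrite !big_cons cmulDr innerD (star_homD hs) IH; congr (_ + _).
by rewrite adjZc cmulZl cmulZr innerZl innerZ !(star_homZ hs) SS.
Qed.

Lemma ext_le l : nr (lincomb S l) <= nr (lincomb x l).
Proof.
rewrite -(@ler_pXn2r _ 2) ?nnegrE ?nr_ge0 // -nr_adjM ext_inner -nr_inner.
exact: s_le.
Qed.

Lemma ext_leB l m : nr (lincomb S l - lincomb S m) <= nr (lincomb x l - lincomb x m).
Proof.
have e (V : lmodType (complexField R)) (v : I -> V) :
  lincomb v l - lincomb v m = lincomb v (l ++ lscale (-1) m).
  by rewrite lincomb_cat lincomb_scale scaleN1r.
by rewrite !e ext_le.
Qed.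

(** The closure of the graph of the linear map that takes x i to S i. *)
Definition ext_rel (y : X) (b : B) := forall e : R, 0 < e ->
  exists l, nr (y - lincomb x l) <= e /\ nr (b - lincomb S l) <= e.

Lemma ext_rel_le y b : ext_rel y b -> nr b <= nr y.
Proof.
move=> yb; apply/ler_addgt0Pr => e e0.
have [l [yl bl]] := yb (e / 2) (divr_gt0 e0 (ltr0Sn _ 1)).
have := nrD (b - lincomb S l) (lincomb S l); have := nrD (lincomb x l - y) y.
by rewrite !subrK [nr (lincomb x l - y)]nrBC; have := ext_le l; lra.
Qed.

Lemma ext_relP (k : R[i]) y b z d : ext_rel y b -> ext_rel z d ->
  ext_rel (k *: y + z) (k *: b + d).
Proof.
move=> yb zd e e0; set K := nr (k : complexField R) + 1.
have K0 : 0 < K by rewrite ltr_wpDl ?nr_ge0.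
have [l [yl bl]] := yb (e / 2 / K) (divr_gt0 (divr_gt0 e0 (ltr0Sn _ 1)) K0).
have [m [zm dm]] := zd (e / 2) (divr_gt0 e0 (ltr0Sn _ 1)).
have bound (V : normedModType (complexField R)) (u u' w w' : V) : nr (u - u') <= e / 2 / K ->
    nr (w - w') <= e / 2 -> nr (k *: u + w - (k *: u' + w')) <= e.
  move=> hu hw; rewrite opprD addrACA -scalerBr; apply: le_trans (nrD _ _) _.
  rewrite nrZ; have := nr_ge0 (k : complexField R); have := nr_ge0 (u - u').
  by move: hu; rewrite ler_pdivlMr // /K; nra.
exists (lscale k l ++ m); rewrite !lincomb_cat !lincomb_scale.
by split; apply: bound.
Qed.

Lemma ext_rel_lincomb l : ext_rel (lincomb x l) (lincomb S l).
Proof. by move=> e e0; exists l; rewrite !subrr !nr0 ltW. Qed.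

Lemma ext_rel_unique y b d : ext_rel y b -> ext_rel y d -> b = d.
Proof.
move=> yb yd; have := ext_rel_le (ext_relP (-1) yb yd).
rewrite !scaleN1r !addNr nr0 => h; apply/eqP; rewrite eq_sym -subr_eq0 addrC; apply/eqP.
by apply: nr_eq0; apply/eqP; rewrite eq_le h nr_ge0.
Qed.

Lemma inv_small (e : R) : 0 < e -> exists n : nat, (n.+1%:R)^-1 <= e.
Proof.
move=> d0; exists (Num.truncn e^-1).
rewrite -[leRHS]invrK lef_pV2 ?posrE ?ltr0n ?invr_gt0 //.
by rewrite ltW // truncnS_gt // invr_ge0 ltW.
Qed.

Lemma ext_rel_total y : exists b, ext_rel y b.
Proof.
pose e n : R := n.+1%:R^-1.
have e0 n : 0 < e n by rewrite invr_gt0.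
have en n m : (n <= m)%N -> e m <= e n.
  by move=> nm; rewrite lef_pV2 ?posrE ?ltr0n // ler_nat ltnS.
have [l hl'] := choice (fun n => dense y (e0 n)).
have hl n : nr (y - lincomb x (l n)) <= e n by exact: hl'.
have [b hb] : exists b, forall n, nr (b - lincomb S (l n)) <= 2 * e n.
  apply: cauchy_seq_cvg => [n m nm|d d0].
    apply: le_trans (ext_leB _ _) _; apply: le_trans (nrBD y _ _) _.
    by rewrite [nr (_ - y)]nrBC; have := hl n; have := hl m; have := en _ _ nm; lra.
  have [n hn] := inv_small (divr_gt0 d0 (ltr0Sn _ 1)); exists n.
  by have {}hn : e n <= d / 2 := hn; lra.
exists b => d d0; have [n hn] := inv_small (divr_gt0 d0 (ltr0Sn _ 1)).
exists (l n); have := hl n; have := hb n; have := e0 n.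
by have {}hn : e n <= d / 2 := hn; split; lra.
Qed.

(** The relations between the S i make the linear map x i |-> S i isometric up to
    the contraction s, so that it extends by continuity to a map t that respects
    inner products.  For the left action, d = s(a) t(y) - t(a y) is orthogonal
    to all t(z), as one sees for z in the span of the x i; but d is a difference
    of limits of such t(z), so d^* d = 0. *)
Lemma corr_rep_extension : exists t : X -> B, is_corr_rep s t /\ forall i, t (x i) = S i.
Proof.
have [t ht] := choice ext_rel_total.
have tX l : t (lincomb x l) = lincomb S l.
  exact: ext_rel_unique (ht _) (ext_rel_lincomb l).
have tlin (k : R[i]) y z : t (k *: y + z) = k *: t y + t z.
  exact: ext_rel_unique (ht _) (ext_relP k (ht y) (ht z)).
have tle y : nr (t y) <= nr y by exact: ext_rel_le (ht y).
have tinner y z : adj (t y) ** t z = s (inner y z).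
  apply/eqP; rewrite -subr_eq0; apply/eqP/nr_small => e e0.
  have y0 := nr_ge0 y; have z0 := nr_ge0 z.
  have M0 : 0 < 9 * (nr y + nr z + 1) by lra.
  pose d := Num.min 1 (e / (9 * (nr y + nr z + 1))).
  have d0 : 0 < d by rewrite lt_min ltr01 divr_gt0.
  have d1 : d <= 1 by rewrite ge_min lexx.
  have de : d * (9 * (nr y + nr z + 1)) <= e by rewrite -ler_pdivlMr // ge_min lexx orbT.
  have [l [yl tl]] := ht y d d0; have [m [zm tm]] := ht z d d0.
  rewrite -[adj (t y) ** t z](subrK (adj (lincomb S l) ** lincomb S m)) ext_inner.
  rewrite -addrA -(star_homB hs).
  have -> : inner (lincomb x l) (lincomb x m) - inner y z =
      - (inner (y - lincomb x l) z + inner (lincomb x l) (z - lincomb x m)).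
    by rewrite innerBl innerBr addrA subrK opprB.
  rewrite -ext_inner.
  have -> : adj (t y) ** t z - adj (lincomb S l) ** lincomb S m =
      adj (t y - lincomb S l) ** t z + adj (lincomb S l) ** (t z - lincomb S m).
    by rewrite adjB cmulBl cmulBr addrA subrK.
  have lx : nr (lincomb x l) <= nr y + 1.
    by have := nrD (lincomb x l - y) y; rewrite subrK [nr (_ - y)]nrBC; lra.
  have h1 := nr_cmul (adj (t y - lincomb S l)) (t z).
  have h2 := nr_cmul (adj (lincomb S l)) (t z - lincomb S m).
  rewrite !nr_adj in h1 h2.
  have h3 := nr_inner_le (y - lincomb x l) z.
  have h4 := nr_inner_le (lincomb x l) (z - lincomb x m).
  have h5 := nrD (adj (t y - lincomb S l) ** t z) (adj (lincomb S l) ** (t z - lincomb S m)).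
  have h6 := nrD (inner (y - lincomb x l) z) (inner (lincomb x l) (z - lincomb x m)).
  apply: le_trans (nrD _ _) _.
  have h7 := s_le (- (inner (y - lincomb x l) z + inner (lincomb x l) (z - lincomb x m))).
  rewrite nrN in h7.
  have := tle z; have := ext_le l; have := nr_ge0 (lincomb x l).
  have := nr_ge0 (t z); have := nr_ge0 (lincomb S l).
  have := nr_ge0 (t y - lincomb S l); have := nr_ge0 (t z - lincomb S m).
  have := nr_ge0 (y - lincomb x l); have := nr_ge0 (z - lincomb x m).
  nra.
exists t; split; last by move=> i; have := tX [:: (1, i)]; rewrite /lincomb !big_seq1 !scale1r.
split=> // a y.
have aS b l : exists2 m, s b ** lincomb S l = lincomb S m & left_act b (lincomb x l) = lincomb x m.
  exists [seq (p.1 * c b p.2, p.2) | p <- l].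
    rewrite /lincomb cmul_sumr big_map; apply: eq_bigr => p _.
    by rewrite cmulZr left_S scalerA.
  rewrite /lincomb; elim: l => [|p l IH].
    rewrite !big_nil; have := left_actP b (-1) (0 : X) 0.
    by rewrite scaler0 addr0 scaleN1r addNr.
  by rewrite big_cons left_actP IH /= big_cons left_x scalerA.
have ts b l : s b ** t (lincomb x l) = t (left_act b (lincomb x l)).
  by have [m e1 e2] := aS b l; rewrite e2 !tX.
have [d dE] : exists d, d = s a ** t y - t (left_act a y) by eexists.
have orthX l : adj (t (lincomb x l)) ** d = 0.
  have lr z w : inner z (left_act a w) = inner (left_act (adj a) z) w.
    by rewrite left_act_adj adjK.
  by rewrite dE cmulBr tinner lr -tinner -ts adjM -(star_hom_adj hs) adjK cmulA subrr.
have orth z : adj (t z) ** d = 0.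
  apply: nr_small => e e0; have d0 := nr_ge0 d; have D0 : 0 < nr d + 1 by lra.
  have [l [_ zl]] := ht z _ (divr_gt0 e0 D0).
  rewrite -[t z](subrK (t (lincomb x l))) adjD cmulDl orthX addr0.
  apply: le_trans (nr_cmul _ _) _; rewrite nr_adj tX.
  by move: zl; rewrite ler_pdivlMr //; have := nr_ge0 (t z - lincomb S l); nra.
have dd : adj d ** d = 0.
  rewrite {1}dE adjB cmulBl orth subr0.
  apply: nr_small => e e0; have d0 := nr_ge0 d; have s0 := nr_ge0 (s a).
  have D0 : 0 < (nr (s a) + 1) * (nr d + 1) by nra.
  have [l [_ zl]] := ht y _ (divr_gt0 e0 D0).
  rewrite -[t y](subrK (t (lincomb x l))) cmulDr adjD cmulDl ts orth addr0.
  apply: le_trans (nr_cmul _ _) _; rewrite nr_adj tX.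
  have h := nr_cmul (s a) (t y - lincomb S l).
  apply: le_trans (ler_wpM2r d0 h) _.
  move: zl; rewrite ler_pdivlMr //; set u := nr (t y - _) => zl; have u0 : 0 <= u := nr_ge0 _.
  have : 0 <= u * nr (s a) by exact: mulr_ge0.
  have : 0 <= u * nr d by exact: mulr_ge0.
  nra.
have d0 : d = 0.
  by apply/nr_eq0/eqP; rewrite -(sqrf_eq0 (nr d)) -nr_adjM dd nr0.
by apply/eqP; rewrite -subr_eq0 -dE d0.
Qed.
End Extension.

(** * Vertex projections and edge isometries *)

Section C0.
Context {R : realType} {I : choiceType} {A : cstar_algebra R} {ev : A -> I -> R[i]}.
Hypothesis (c0 : is_c0 ev).

Lemma ev0 p : ev 0 p = 0.
Proof.
have := c0_lin c0 (-1) 0 0 p.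
by rewrite scaleN1r addNr mulN1r addNr.
Qed.

Lemma evZ (k : R[i]) a p : ev (k *: a) p = k * ev a p.
Proof. by have := c0_lin c0 k a 0 p; rewrite !addr0 ev0 addr0. Qed.

Lemma evB a b p : ev (a - b) p = ev a p - ev b p.
Proof. by rewrite addrC -scaleN1r (c0_lin c0) mulN1r addrC. Qed.

Lemma evD a b p : ev (a + b) p = ev a p + ev b p.
Proof. by have := c0_lin c0 1 a b p; rewrite scale1r mul1r. Qed.

Lemma ev_sum (J : Type) (s : seq J) (F : J -> A) p :
  ev (\sum_(j <- s) F j) p = \sum_(j <- s) ev (F j) p.
Proof. by elim/big_rec2: _ => [|j a b _ IH]; rewrite ?ev0 // evD IH. Qed.

Lemma nr_evP a (k : R) : 0 <= k ->
  nr a <= k <-> (forall p, nr (ev a p : complexField R) <= k).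
Proof.
move=> k0; have := c0_norm c0 a k0; rewrite nrE lecR => -[h1 h2]; split=> h.
  by move=> p; have := h1 h p; rewrite (nrE (ev a p : complexField R)) lecR.
by apply: h2 => p; rewrite (nrE (ev a p : complexField R)) lecR.
Qed.

Lemma ev_inj a b : (forall p, ev a p = ev b p) -> a = b.
Proof.
move=> ab; apply/eqP; rewrite -subr_eq0; apply/eqP/nr_eq0/eqP.
rewrite eq_le nr_ge0 andbT; apply/(nr_evP _ (lexx 0)) => p.
by rewrite evB ab subrr nr0.
Qed.

Lemma indicator_ex p : exists a, forall q, ev a q = (q == p)%:R.
Proof.
have : range ev (fun q => (q == p)%:R).
  rewrite (c0_range c0) /= => e e0; apply: sub_finite_set (finite_set1 p) => q /=.
  by case: eqVneq => // _; rewrite normr0 lecR leNgt e0.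
by move=> [a _ av]; exists a => q; rewrite av.
Qed.

Definition indicator p : A := sval (cid (indicator_ex p)).

Lemma indicatorE p q : ev (indicator p) q = (q == p)%:R.
Proof. exact: svalP (cid (indicator_ex p)) q. Qed.

(** Cut a function vanishing at infinity off where it is smaller than e. *)
Lemma indicator_dense a (e : R) : 0 < e ->
  exists l, nr (a - lincomb indicator l) <= e.
Proof.
move=> e0.
have : range ev (ev a) by exists a.
rewrite (c0_range c0) /= => /(_ e e0)/finite_seqP[s sE].
exists [seq (ev a p, p) | p <- undup s].
apply/(nr_evP _ (ltW e0)) => p; rewrite evB /lincomb big_map ev_sum.
under eq_bigr do rewrite evZ indicatorE.
have [ps|ps] := boolP (p \in undup s).
  rewrite (bigD1_seq p) ?undup_uniq //= eqxx mulr1 big1 ?addr0 ?subrr ?nr0 ?(ltW e0) //.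
  by move=> q qp; rewrite eq_sym (negbTE qp) mulr0.
rewrite big_seq big1 ?subr0 => [|q qs]; last first.
  by case: (eqVneq p q) ps => [->|_ _]; rewrite ?qs ?mulr0.
rewrite leNgt; apply/negP => lt; move/negP: ps; apply.
have : [set` s] p by rewrite -sE /= (nrE (ev a p : complexField R)) lecR ltW.
by rewrite /= mem_undup.
Qed.
End C0.

Section GraphCorrespondence.
Context {R : realType} {G : digraph} {A : cstar_algebra R} {ev : A -> vertex G -> R[i]}
  {X : correspondence A} {chi : (edge G -> R[i]) -> X}.
Hypothesis (gc : is_graph_correspondence ev chi).
Let c0 := graph_corr_c0 gc.
Local Notation vproj := (indicator c0).

Definition single (e : edge G) : edge G -> R[i] := fun e' => (e' == e)%:R.

Lemma finsupp_single e : finsupp_fun (single e).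
Proof.
apply: sub_finite_set (finite_set1 e) => e' /=; rewrite /single.
by case: (eqVneq e' e) => //; rewrite eqxx.
Qed.

Lemma finsupp0 : finsupp_fun (fun _ : edge G => 0 : R[i]).
Proof. by apply: sub_finite_set (finite_set0 _) => e' /=; rewrite eqxx. Qed.

Lemma chi0 : chi (fun _ => 0) = 0.
Proof.
have := graph_corr_lin gc (-1) finsupp0 finsupp0.
rewrite scaleN1r addNr => <-; congr chi; apply/funext => e.
by rewrite mulr0 addr0.
Qed.

Lemma chiZ k u : finsupp_fun u -> chi (fun e => k * u e) = k *: chi u.
Proof.
move=> fu; have := graph_corr_lin gc k fu finsupp0; rewrite chi0 addr0 => <-.
by congr chi; apply/funext => e; rewrite addr0.
Qed.

Definition edge_vec (e : edge G) : X := chi (single e).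

Lemma chi_lincomb u : finsupp_fun u -> exists l, chi u = lincomb edge_vec l.
Proof.
move=> /finite_seqP[s sE].
have {sE} : forall e, e \notin s -> u e = 0.
  move=> e es; apply/eqP; apply: contraNT es => ue.
  by have : [set` s] e by rewrite -sE.
elim: s u => [|e s IH] u us.
  exists [::]; rewrite /lincomb big_nil -chi0; congr chi.
  by apply/funext => e; rewrite us.
pose u' := fun e' => if e' == e then 0 else u e'.
have us' e' : e' \notin s -> u' e' = 0.
  rewrite /u'; case: eqVneq => // ne es; apply: us.
  by rewrite inE (negbTE ne).
have fu' : finsupp_fun u'.
  apply: sub_finite_set (finite_seq s) => e' /=; apply: contraNT => es.
  by rewrite us'.
have [l hl] := IH u' us'.
exists ((u e, e) :: l); rewrite /lincomb big_cons -/(lincomb _ _) -hl /=.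
rewrite -(graph_corr_lin gc _ (finsupp_single e) fu'); congr chi.
apply/funext => e'; rewrite /single /u'.
by case: eqVneq => [->|]; rewrite ?mulr1 ?addr0 ?mulr0 ?add0r.
Qed.

Lemma edge_vec_dense (y : X) (e : R) : 0 < e -> exists l, nr (y - lincomb edge_vec l) <= e.
Proof.
move=> e0; have : closure (chi @` @finsupp_fun R (edge G)) y by rewrite (graph_corr_dense gc).
move=> /nr_closureP/(_ e e0)[_ [u fu <-] yu].
by have [l hl] := chi_lincomb fu; exists l; rewrite -hl.
Qed.

Lemma inner_edge_vec e f : inner (edge_vec e) (edge_vec f) = if e == f then vproj (src e) else 0.
Proof.
apply: (ev_inj c0) => p.
rewrite (graph_corr_inner gc (finsupp_single e) (finsupp_single f)).
case: eqVneq => [<-|ne]; last first.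
  rewrite (ev0 c0) fsbig1 // => e' _; rewrite /single.
  case: (eqVneq e' e) => [->|_]; last by rewrite conjCE conjc0 mul0r.
  by rewrite (negbTE ne) mulr0.
rewrite indicatorE; case: eqVneq => [->|ne].
  rewrite -(fsbig_widen [set e]) => [|e' /= ->//|e' [/= _ ne]].
    by rewrite fsbig_set1 /single eqxx conjCE conjc1 mulr1.
  rewrite /single; case: eqVneq ne => // _ _; by rewrite mulr0.
rewrite fsbig1 // => e' /= e'p; rewrite /single.
case: eqVneq => [e'e|_]; last by rewrite mulr0.
by rewrite -e'p e'e eqxx in ne.
Qed.

Lemma left_edge_vec a e : left_act a (edge_vec e) = ev a (rng e) *: edge_vec e.
Proof.
rewrite /edge_vec (graph_corr_left gc a (finsupp_single e)) -chiZ; last exact: finsupp_single.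
congr chi; apply/funext => e'; rewrite /single.
by case: eqVneq => [->|]; rewrite ?mulr0.
Qed.

Section Toeplitz.
Context {T : cstar_algebra R} { pi : A -> T} {t : X -> T}.
Hypothesis (rep : is_corr_rep pi t).
Let hpi := corr_rep_hom rep.

Definition vertex_proj (p : vertex G) : T := pi (vproj p).
Definition edge_iso (e : edge G) : T := t (edge_vec e).
Local Notation P := vertex_proj.
Local Notation S := edge_iso.

Lemma edge_iso_orth e f : adj (S e) ** S f = if e == f then P (src e) else 0.
Proof.
rewrite (corr_rep_inner rep) inner_edge_vec; case: ifP => // _.
exact: star_hom0.
Qed.

Lemma left_edge_iso a e : pi a ** S e = ev a (rng e) *: S e.
Proof.
rewrite (corr_rep_left rep) left_edge_vec.
have t0 : t 0 = 0.
  have := corr_rep_lin rep (-1) 0 0.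
  by rewrite scaleN1r addNr scaleN1r addNr.
by have := corr_rep_lin rep (ev a (rng e)) (edge_vec e) 0; rewrite !addr0 t0 addr0.
Qed.

Lemma vertex_proj_edge_iso p e : P p ** S e = if rng e == p then S e else 0.
Proof.
by rewrite left_edge_iso indicatorE; case: eqP; rewrite ?scale1r ?scale0r.
Qed.

Lemma left_vertex_proj a p : pi a ** P p = ev a p *: P p.
Proof.
rewrite -(star_hom_mul hpi) -(star_homZ hpi); congr pi; apply: (ev_inj c0) => q.
rewrite (c0_mul c0) (evZ c0) indicatorE.
by case: eqVneq => [->|]; rewrite ?mulr0.
Qed.

Lemma vertex_proj_idem p : P p ** P p = P p.
Proof. by rewrite left_vertex_proj indicatorE eqxx scale1r. Qed.

Lemma adj_vertex_proj p : adj (P p) = P p.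
Proof.
rewrite -(star_hom_adj hpi); congr pi; apply: (ev_inj c0) => q.
rewrite (c0_adj c0) indicatorE.
by case: eqVneq; rewrite conjCE ?conjc0 ?conjc1.
Qed.

(** The difference d of both sides satisfies d^* d = 0. *)
Lemma edge_iso_vertex_proj e : S e ** P (src e) = S e.
Proof.
set d := S e ** P (src e).
have Se : adj (S e) ** S e = P (src e) by rewrite edge_iso_orth eqxx.
have : adj (d - S e) ** (d - S e) = 0.
  have e1 : adj (S e) ** d = P (src e) by rewrite /d cmulA Se vertex_proj_idem.
  have e2 : adj d ** S e = P (src e) by rewrite /d adjM adj_vertex_proj -cmulA Se vertex_proj_idem.
  have e3 : adj d ** d = P (src e) by rewrite {1}/d adjM adj_vertex_proj -cmulA e1 vertex_proj_idem.
  by rewrite adjB cmulBl !cmulBr e1 e2 e3 Se !subrr.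
move=> h; apply/eqP; rewrite -subr_eq0; apply/eqP/nr_eq0/eqP.
by rewrite -(sqrf_eq0 (nr _)) -nr_adjM h nr0.
Qed.

Hypothesis rf : row_finite G.

Lemma incoming_ex p : exists s : seq (edge G), uniq s /\ forall e, (e \in s) = (rng e == p).
Proof.
have /finite_seqP[s sE] := rf p; exists (undup s); split; first exact: undup_uniq.
move=> e; rewrite mem_undup; apply/idP/eqP => [es|ep].
  by have : [set` s] e by []; rewrite -sE.
by have : [set` s] e by rewrite -sE.
Qed.

Definition incoming p : seq (edge G) := sval (cid (incoming_ex p)).
Lemma incoming_uniq p : uniq (incoming p).
Proof. by have [] := svalP (cid (incoming_ex p)). Qed.
Lemma mem_incoming p e : (e \in incoming p) = (rng e == p).
Proof. by have [_ ->] := svalP (cid (incoming_ex p)). Qed.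

(** The defect of the Cuntz-Krieger relation at p. *)
Definition gap p : T := P p - \sum_(e <- incoming p) S e ** adj (S e).

Lemma adj_gap p : adj (gap p) = gap p.
Proof.
rewrite /gap adjB adj_vertex_proj adj_sum; congr (_ - _); apply: eq_bigr => e _.
by rewrite adjM adjK.
Qed.

Lemma gap_edge_iso p e : gap p ** S e = 0.
Proof.
rewrite /gap cmulBl vertex_proj_edge_iso cmul_suml.
under eq_bigr do rewrite -cmulA edge_iso_orth.
case: (boolP (e \in incoming p)) => [ep|ep].
  rewrite (bigD1_seq e) ?incoming_uniq //= eqxx edge_iso_vertex_proj big1 => [|f fe].
    by rewrite -mem_incoming ep addr0 subrr.
  by rewrite (negbTE fe) cmul0r.
rewrite -mem_incoming (negbTE ep) big_seq big1 ?subr0 // => f fp.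
by case: eqVneq fp => [->|_ _]; rewrite ?(negbTE ep) ?cmul0r.
Qed.

Lemma adj_edge_iso_gap p e : adj (S e) ** gap p = 0.
Proof. by rewrite -adj_gap -adjM gap_edge_iso adj0. Qed.

Lemma left_gap a p : pi a ** gap p = ev a p *: gap p.
Proof.
rewrite /gap cmulBr left_vertex_proj scalerBr cmul_sumr scaler_sumr; congr (_ - _).
rewrite big_seq [RHS]big_seq; apply: eq_bigr => e; rewrite mem_incoming => /eqP <-.
by rewrite cmulA left_edge_iso cmulZl.
Qed.

Lemma gap_left a p : gap p ** pi a = ev a p *: gap p.
Proof.
have := congr1 adj (left_gap (adj a) p).
rewrite adjM adj_gap -(star_hom_adj hpi) adjK adjZc adj_gap => ->.
by rewrite (c0_adj c0) conjCE conjcK.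
Qed.

Lemma gap_gap p : gap p ** gap p = gap p.
Proof.
rewrite {2}/gap cmulBr gap_left indicatorE eqxx scale1r cmul_sumr.
by rewrite big1 ?subr0 // => e _; rewrite cmulA gap_edge_iso cmul0l.
Qed.

End Toeplitz.
End GraphCorrespondence.

Arguments vertex_proj {R G A ev X chi} gc {T} pi p.
Arguments edge_vec {R G A X} chi e.
Arguments edge_iso {R G A X} chi {T} t e.
Arguments gap {R G A ev X chi} gc {T} pi t rf p.

(** * Dilations of completely contractive representations *)

Section MatrixNorm.
Context {R : realType}.

Definition opmx_le (H : hilbert_space R) (n : nat)
    (F : 'I_n -> 'I_n -> {linear H -> H}) (c : R) : Prop :=
  forall x : 'I_n -> H, \sum_i nr (\sum_j F i j (x j)) ^+ 2 <= c ^+ 2 * \sum_j nr (x j) ^+ 2.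

Lemma opmx_boundP (H : hilbert_space R) n (F : 'I_n -> 'I_n -> {linear H -> H}) c :
  opmx_bound F c <-> 0 <= c /\ opmx_le F c.
Proof.
have nr2 m (y : 'I_m -> H) : \sum_i `|y i| ^+ 2 = (\sum_i nr (y i) ^+ 2)%:C.
  by rewrite rmorph_sum; apply: eq_bigr => i _; rewrite nrE rmorphXn.
split=> -[c0 h]; split=> // x.
  by have := h x; rewrite !nr2 -rmorphM lecR.
by rewrite !nr2 -rmorphM lecR.
Qed.

Lemma opmx_normP (H : hilbert_space R) n (F : 'I_n -> 'I_n -> {linear H -> H}) c :
  0 <= c -> (opmx_norm F <= c%:E)%E <-> opmx_le F c.
Proof.
move=> c0; split=> [h x|h]; last first.
  by apply: ereal_inf_lbound; exists c => //; apply/opmx_boundP.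
set M := \sum_j nr (x j) ^+ 2; set z := \sum_i _.
have M0 : 0 <= M by apply: sumr_ge0 => i _; exact: sqr_ge0.
have le e : 0 < e -> z <= (c + e) ^+ 2 * M.
  move=> e0; have : (opmx_norm F < (c + e)%:E)%E by apply: le_lt_trans h _; rewrite lte_fin; lra.
  move=> /ereal_inf_lt[_ [k /opmx_boundP[k0 kF] <-]]; rewrite lte_fin => kc.
  apply: le_trans (kF x) _; rewrite -/M ler_wpM2r // ler_pXn2r ?nnegrE ?addr_ge0 ?(ltW e0) //.
  exact: ltW.
have [M1|M1] := eqVneq M 0; first by have := le 1 ltr01; rewrite M1 !mulr0.
have {}M1 : 0 < M by rewrite lt_neqAle eq_sym M1.
rewrite -ler_pdivrMr //; apply: sqr_lim => // e e0.
by rewrite ler_pdivrMr //; exact: le.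
Qed.

Lemma cmx_norm_ub (C : cstar_algebra R) n (a : 'M[C]_n) (H : hilbert_space R)
    (pi : C -> {linear H -> H}) : is_star_rep pi ->
  (opmx_norm (fun i j => pi (a i j)) <= cmx_norm a)%E.
Proof. by move=> spi; apply: ereal_sup_ubound; exists H, pi. Qed.

Lemma cmx_norm_le (C : cstar_algebra R) n (a : 'M[C]_n) (y : \bar R) :
  (forall (H : hilbert_space R) (pi : C -> {linear H -> H}), is_star_rep pi ->
    (opmx_norm (fun i j => pi (a i j)) <= y)%E) -> (cmx_norm a <= y)%E.
Proof. by move=> h; apply: ge_ereal_sup => _ [H [pi [spi ->]]]; exact: h. Qed.

(** A completely contractive map inherits every matrix estimate that holds in
    all star representations. *)
Lemma cc_bound (C : cstar_algebra R) (A : set C) (K : hilbert_space R)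
    (mu : C -> {linear K -> K}) n (a : 'M[C]_n) (c : R) :
  completely_contractive A mu -> (forall i j, A (a i j)) -> 0 <= c ->
  (forall (H : hilbert_space R) (pi : C -> {linear H -> H}), is_star_rep pi ->
     opmx_le (fun i j => pi (a i j)) c) ->
  opmx_le (fun i j => mu (a i j)) c.
Proof.
move=> cc Aa c0 h; apply/opmx_normP => //; apply: le_trans (cc n a Aa) _.
by apply: cmx_norm_le => H pi spi; apply/opmx_normP => //; exact: h.
Qed.

Lemma star_rep_cc (C : cstar_algebra R) (A : set C) (H : hilbert_space R)
  (pi : C -> {linear H -> H}) : is_star_rep pi -> is_cc_rep A pi.
Proof.
move=> spi; split; last by move=> n a _; exact: cmx_norm_ub.
have [[pc pl pm] _] := spi.
by split=> [a _|k a b _ _|a b _ _]; [exact: pc|exact: pl|exact: pm].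
Qed.

Lemma nr_sum_orth (H : hilbert_space R) (I : finType) (v : I -> H) :
  (forall i j, i != j -> dot (v i) (v j) = 0) ->
  nr (\sum_i v i) ^+ 2 = \sum_i nr (v i) ^+ 2.
Proof.
move=> orth; apply: complexI; rewrite -dotxx dot_suml rmorph_sum.
apply: eq_bigr => i _; rewrite dot_sumr (bigD1 i) //= big1 ?addr0 ?dotxx // => j ji.
by rewrite orth // eq_sym.
Qed.

End MatrixNorm.

(** Estimates in all star representations, which is what complete contractivity
    gives access to. *)
Definition rep_le (R : realType) (T : cstar_algebra R) (b : T) (c : R) :=
  forall (L : hilbert_space R) (rho : T -> {linear L -> L}), is_star_rep rho ->
    forall x, nr (rho b x) <= c * nr x.

Lemma rep_le_mono (R : realType) (T : cstar_algebra R) (b : T) (c d : R) :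
  rep_le b c -> c <= d -> rep_le b d.
Proof.
by move=> h cd L rho srho x; apply: le_trans (h L rho srho x) _; rewrite ler_wpM2r ?nr_ge0.
Qed.

Lemma rep_le_of_nr (R : realType) (T : cstar_algebra R) (b : T) (c : R) :
  nr b <= c -> rep_le b c.
Proof.
by apply: rep_le_mono => L rho srho x; exact: star_rep_contractive.
Qed.

Section Dilation.
Context {R : realType} {T : cstar_algebra R} {Alg : set T} {H K : hilbert_space R}.
Variables (theta : T -> {linear H -> H}) (V : {linear H -> K}) (mu : T -> {linear K -> K}).
Hypothesis subA : closed_subalgebra Alg.
Hypothesis sth : is_star_rep theta.
Hypothesis Visom : forall x y, dot (V x) (V y) = dot x y.
Hypothesis mu_rep : is_rep Alg mu.
Hypothesis mu_cc : completely_contractive Alg mu.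
Hypothesis compress : forall a, Alg a -> forall x y,
  dot (mu a (V x)) (V y) = dot (theta a x) y.

Lemma nr_V x : nr (V x) = nr x.
Proof.
apply/eqP; rewrite -(@eqrXn2 _ 2) ?nr_ge0 //; apply/eqP/complexI.
by rewrite -!dotxx Visom.
Qed.

Lemma mu0 y : mu 0 y = 0.
Proof.
have := rep_lin mu_rep (-1) (subalg_0 subA) (subalg_0 subA) y.
by rewrite scaleN1r addNr scaleN1r addNr.
Qed.

(** The row is completed by zeros to a square matrix with the same norm. *)
Lemma mu_row n (i0 : 'I_n) (b : 'I_n -> T) : (forall j, Alg (b j)) ->
  (forall (L : hilbert_space R) (rho : T -> {linear L -> L}), is_star_rep rho ->
     forall x, nr (\sum_j rho (b j) (x j)) ^+ 2 <= \sum_j nr (x j) ^+ 2) ->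
  forall x, nr (\sum_j mu (b j) (x j)) ^+ 2 <= \sum_j nr (x j) ^+ 2.
Proof.
move=> Ab h x; pose a : 'M[T]_n := \matrix_(i, j) if i == i0 then b j else 0.
have Aa i j : Alg (a i j) by rewrite mxE; case: ifP => // _; exact: subalg_0.
have row (L : hilbert_space R) (rho : T -> {linear L -> L}) (y : 'I_n -> L) :
    (forall z, rho 0 z = 0) ->
    \sum_i nr (\sum_j rho (a i j) (y j)) ^+ 2 = nr (\sum_j rho (b j) (y j)) ^+ 2.
  move=> r0; rewrite (bigD1 i0) //= [X in _ + X]big1 => [|i ii].
    by rewrite addr0; under eq_bigr do rewrite mxE eqxx.
  by rewrite big1 ?nr0 ?expr0n // => j _; rewrite mxE (negbTE ii).
have := @cc_bound _ _ _ _ _ _ a 1 mu_cc Aa ler01.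
rewrite /opmx_le => /(_ _ x); rewrite row; last exact: mu0.
rewrite expr1n mul1r; apply => L rho srho y.
rewrite row; last exact: star_rep0.
by rewrite mul1r; exact: h.
Qed.

Lemma mu_bound b c : Alg b -> 0 <= c -> rep_le b c ->
  forall y, nr (mu b y) <= c * nr y.
Proof.
move=> Ab c0 h y; pose a : 'M[T]_1 := \matrix_(i, j) b.
have Aa i j : Alg (a i j) by rewrite mxE.
have := @cc_bound _ _ _ _ _ _ a c mu_cc Aa c0; rewrite /opmx_le => /(_ _ (fun => y)).
rewrite !big_ord1 mxE -exprMn ler_pXn2r ?nnegrE ?mulr_ge0 ?nr_ge0 //; apply.
move=> L rho srho x; rewrite !big_ord1 mxE -exprMn ler_pXn2r ?nnegrE ?mulr_ge0 ?nr_ge0 //.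
exact: h.
Qed.

Lemma mu_le b y : Alg b -> nr (mu b y) <= nr b * nr y.
Proof.
by move=> Ab; apply: mu_bound (nr_ge0 b) _ y => //; exact: rep_le_of_nr.
Qed.

Lemma muB a b y : Alg a -> Alg b -> mu (a - b) y = mu a y - mu b y.
Proof.
move=> Aa Ab; have := rep_lin mu_rep (-1) Ab Aa y.
by rewrite !scaleN1r addrC => ->; rewrite addrC.
Qed.

Lemma AlgB a b : Alg a -> Alg b -> Alg (a - b).
Proof.
by move=> Aa Ab; rewrite addrC -scaleN1r; exact: subalg_lin.
Qed.

(** With k = e (conj c), the left side is 2 e |c|^2 and the right side is of order
    e^2. *)
Lemma quad_zero (c : R[i]) (Y : R) :
  (forall k : R[i], 2 * complex.Re (k * c) <= nr (k : complexField R) ^+ 2 * Y) -> c = 0.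
Proof.
move=> h; set n := nr (c : complexField R) ^+ 2.
have n0 : 0 <= n by exact: sqr_ge0.
have small (e : R) : 0 < e -> 2 * n <= e * n * Y.
  move=> e0; have := h (e%:C * conjc c).
  have -> : complex.Re (e%:C * conjc c * c) = e * n.
    by rewrite -mulrA [conjc c * c]mulrC -nr_sqr -rmorphM.
  rewrite nrCM nrC_real nr_conj (ger0_norm (ltW e0)) !exprMn -/n.
  by rewrite mulrCA expr2 -!mulrA ler_pM2l.
have n1 : n <= 0.
  pose e := (1 + `|Y|)^-1.
  have Y0 : 0 < 1 + `|Y| by rewrite ltr_pwDl.
  have e0 : 0 < e by rewrite invr_gt0.
  have eY : e * Y <= 1.
    by rewrite mulrC ler_pdivrMr // mul1r; have := ler_norm Y; lra.
  by have := small e e0; nra.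
have : nr (c : complexField R) = 0.
  by apply/eqP; rewrite -sqrf_eq0 eq_le n1 n0.
exact: nr_eq0.
Qed.

Lemma test_orth (a b : K) (Y : R) :
  (forall k : R[i], nr (a + k *: b) ^+ 2 <= nr a ^+ 2 + nr (k : complexField R) ^+ 2 * Y) ->
  dot b a = 0.
Proof.
move=> h; apply: (@quad_zero _ Y) => k.
have := h k; rewrite nrD2 dotZr.
have -> : complex.Re (conjc k * dot a b) = complex.Re (k * dot b a).
  by rewrite [dot b a]dotC; case: k (dot a b) => ? ? [? ?] /=; ring.
by have := sqr_ge0 (nr (k *: b)); lra.
Qed.

(** |u - v|^2 = |u|^2 - 2 Re <u,v> + |v|^2 <= 0. *)
Lemma eq_of_compress (u v : K) : nr u <= nr v -> dot u v = dot v v -> u = v.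
Proof.
move=> uv d; apply/eqP; rewrite -subr_eq0; apply/eqP/nr_eq0/eqP; rewrite -sqrf_eq0 eq_le sqr_ge0 andbT.
rewrite nrB2 d dotxx /=.
have : nr u ^+ 2 <= nr v ^+ 2 by rewrite ler_pXn2r ?nnegrE ?nr_ge0.
lra.
Qed.

Definition perp (y : K) := forall x, dot y (V x) = 0.

Definition intertwined b := forall x, mu b (V x) = V (theta b x).
Definition coinvariant b := forall y, perp y -> perp (mu b y).
Definition reduced b := [/\ Alg b, intertwined b & coinvariant b].

(** Both conditions are estimates on mu(b - d) and theta(b - d). *)
Lemma reduced_lim b : Alg b ->
  (forall e : R, 0 < e -> exists2 d, reduced d & rep_le (b - d) e) -> reduced b.
Proof.
move=> Ab h; split=> //.
  move=> x; apply/eqP; rewrite -subr_eq0; apply/eqP/nr_small => e e0.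
  have x0 := nr_ge0 x; have x1 : 0 < 2 * (nr x + 1) by lra.
  have d0 := divr_gt0 e0 x1; have [d [Ad iv _] bd] := h _ d0.
  have h1 := mu_bound (AlgB Ab Ad) (ltW d0) bd (V x); rewrite nr_V muB // iv in h1.
  have h2 := bd _ _ sth x; rewrite (star_repB sth) -[nr (theta b x - _)]nr_V linearB /= in h2.
  have := nrBD (V (theta d x)) (mu b (V x)) (V (theta b x)).
  rewrite [nr (V (theta d x) - _)]nrBC.
  have e1 : e / (2 * (nr x + 1)) * (2 * (nr x + 1)) = e by rewrite divfK // gt_eqF.
  nra.
move=> y yp x; apply: (@nr_small _ (complexField R)) => e e0.
have M0 : 0 < nr y * nr x + 1 by have := nr_ge0 x; have := nr_ge0 y; nra.
have d0 := divr_gt0 e0 M0; have [d [Ad _ ci] bd] := h _ d0.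
have -> : dot (mu b y) (V x) = dot (mu (b - d) y) (V x).
  by rewrite muB // dotBl (ci y yp x) subr0.
apply: le_trans (cauchy_schwarz _ _) _; rewrite nr_V.
have h1 := mu_bound (AlgB Ab Ad) (ltW d0) bd y.
have e1 : e / (nr y * nr x + 1) * (nr y * nr x + 1) = e by rewrite divfK // gt_eqF.
have := nr_ge0 x; have := nr_ge0 y; have := nr_ge0 (mu (b - d) y); nra.
Qed.

Lemma reduced0 : reduced 0.
Proof.
split; first exact: (subalg_0 subA).
  by move=> x; rewrite mu0 (star_rep0 sth) linear0.
by move=> y _ x; rewrite mu0 dot0l.
Qed.

Lemma reducedP (k : R[i]) a b : reduced a -> reduced b -> reduced (k *: a + b).
Proof.
move=> [Aa ia ca] [Ab ib cb]; split; first exact: subalg_lin.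
  by move=> x; rewrite (rep_lin mu_rep) // ia ib (star_repD sth) (star_repZ sth) linearP.
by move=> y yp x; rewrite (rep_lin mu_rep) // dotDl dotZl ca // cb // mulr0 addr0.
Qed.

Lemma reducedM a b : reduced a -> reduced b -> reduced (a ** b).
Proof.
move=> [Aa ia ca] [Ab ib cb]; split; first exact: subalg_mul.
  by move=> x; rewrite (rep_mul mu_rep) // ib ia (star_repM sth).
by move=> y yp; move=> x; rewrite (rep_mul mu_rep) // (ca _ (cb _ yp)).
Qed.

(** Test the row contraction on the column with entries V theta(b_j^* ) x, with k y
    added to entry i0.  It is mapped to V x + k mu(b_i0) y, and the square of its
    norm is |x|^2 + |k|^2 |y|^2.  As k is arbitrary, mu(b_i0) y and V x are
    orthogonal. *)
Lemma row_orth n (i0 : 'I_n) (b : 'I_n -> T) x y : (forall j, Alg (b j)) ->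
  (forall (L : hilbert_space R) (rho : T -> {linear L -> L}), is_star_rep rho ->
     forall z, nr (\sum_j rho (b j) (z j)) ^+ 2 <= \sum_j nr (z j) ^+ 2) ->
  (forall j, mu (b j) (V (theta (adj (b j)) x)) = V (theta (b j) (theta (adj (b j)) x))) ->
  \sum_j theta (b j) (theta (adj (b j)) x) = x ->
  perp y -> dot (mu (b i0) y) (V x) = 0.
Proof.
move=> Ab row ib bx yp; apply: (@test_orth _ _ (nr y ^+ 2)) => k.
pose z j := V (theta (adj (b j)) x) + (if j == i0 then k *: y else 0).
have := mu_row i0 Ab row z.
have -> : \sum_j mu (b j) (z j) = V x + k *: mu (b i0) y.
  rewrite -{1}bx linear_sum /=.
  under eq_bigr do rewrite linearD /= ib.
  rewrite big_split /=; congr (_ + _).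
  rewrite (bigD1 i0) //= eqxx linearZ_LR /= big1 ?addr0 // => j ji.
  by rewrite (negbTE ji) linear0.
move=> h; apply: le_trans h _.
have -> : \sum_j nr (z j) ^+ 2 = \sum_j nr (theta (adj (b j)) x) ^+ 2 + nr (k *: y) ^+ 2.
  rewrite [RHS]addrC (bigD1 i0) //= [in RHS](bigD1 i0) //= addrA; congr (_ + _).
    by rewrite /z eqxx nrD2 dotC dotZl yp mulr0 conjc0 mulr0 addr0 nr_V addrC.
  by apply: eq_bigr => j ji; rewrite /z (negbTE ji) addr0 nr_V.
rewrite nrZ exprMn nr_V lerD2r.
rewrite le_eqVlt; apply/orP; left; apply/eqP/complexI.
rewrite rmorph_sum -dotxx -[X in dot _ X]bx dot_sumr; apply: eq_bigr => j _.
by rewrite /= -dotxx [RHS](star_rep_adjr sth).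
Qed.

Section Projection.
Variable p : T.
Hypothesis (Ap : Alg p) (adj_p : adj p = p) (pp : p ** p = p).

Lemma nr_proj : nr p <= 1.
Proof.
have : nr p = nr p ^+ 2 by rewrite -nr_adjM adj_p pp.
have := nr_ge0 p; nra.
Qed.

Lemma mu_proj y : nr (mu p y) <= nr y.
Proof.
by apply: le_trans (mu_le y Ap) _; rewrite ler_piMl ?nr_ge0 // nr_proj.
Qed.

Lemma mu_projK y : mu p (mu p y) = mu p y.
Proof. by rewrite -(rep_mul mu_rep) // pp. Qed.

(** mu(p) V x is no longer than V x and compresses to it. *)
Lemma mu_proj1 x : theta p x = x -> mu p (V x) = V x.
Proof.
move=> px; apply: eq_of_compress; first exact: mu_proj.
by rewrite compress // px Visom.
Qed.

(** The vector z = mu(p) V x is orthogonal to the range of V and fixed by mu(p).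
    So mu(p) (V x + k z) = (1 + k) z, whose squared norm (1 + k)^2 |z|^2 would for
    large k exceed |x|^2 + k^2 |z|^2 if z were not 0. *)
Lemma mu_proj0 x : theta p x = 0 -> mu p (V x) = 0.
Proof.
move=> px; set z := mu p (V x).
have zp : perp z by move=> y; rewrite compress // px dot0l.
have le (k : R) : (1 + k) ^+ 2 * nr z ^+ 2 <= nr x ^+ 2 + k ^+ 2 * nr z ^+ 2.
  have := mu_proj (V x + k%:C *: z).
  rewrite -(@ler_pXn2r _ 2) ?nnegrE ?nr_ge0 // linearD linearZ_LR /= mu_projK -/z.
  rewrite -{1}[z]scale1r -scalerDl -(rmorph1 (real_complex R)) -rmorphD nrZr exprMn.
  rewrite real_normK ?num_real // nrD2 nr_V dotZr dotC zp conjc0 mulr0 /= mulr0 addr0.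
  by rewrite nrZr exprMn real_normK ?num_real.
set Z := nr z ^+ 2 in le; have Z0 : 0 <= Z by exact: sqr_ge0.
have Z1 : Z <= 0.
  rewrite leNgt; apply/negP => Z1.
  have := le (nr x ^+ 2 / Z); set X := nr x ^+ 2.
  have e : X = (X / Z) * Z by rewrite divfK // gt_eqF.
  have X0 : 0 <= X / Z by rewrite divr_ge0 ?sqr_ge0.
  by rewrite {2}e; nra.
by apply/nr_eq0/eqP; rewrite -sqrf_eq0 eq_le Z1.
Qed.

Lemma theta_split x : x = theta p x + (x - theta p x).
Proof. by rewrite addrC subrK. Qed.

Lemma theta_pp x : theta p (theta p x) = theta p x.
Proof. by rewrite -(star_repM sth) pp. Qed.

Lemma theta_p0 x : theta p (x - theta p x) = 0.
Proof. by rewrite linearB /= theta_pp subrr. Qed.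

Lemma proj_intertwined : intertwined p.
Proof.
move=> x; rewrite {1}[x]theta_split (linearD V) (linearD (mu p)) /= mu_proj1 ?theta_pp //.
by rewrite mu_proj0 ?theta_p0 // addr0.
Qed.

(** For all k, w = mu(p) (w - k V x) is no longer than w - k V x. *)
Lemma proj_range_orth w x : mu p w = w -> theta p x = 0 -> dot w (V x) = 0.
Proof.
move=> pw px; apply: (@quad_zero _ (nr x ^+ 2)) => k.
have := mu_proj (w - conjc k *: V x).
rewrite -(@ler_pXn2r _ 2) ?nnegrE ?nr_ge0 // linearB linearZ_LR /= mu_proj0 // scaler0 subr0 pw.
rewrite nrB2 dotZr conjcK nrZ nr_conj nr_V exprMn; lra.
Qed.

Lemma proj_row (L : hilbert_space R) (rho : T -> {linear L -> L}) : is_star_rep rho ->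
  forall z : 'I_1 -> L, nr (\sum_j rho p (z j)) ^+ 2 <= \sum_j nr (z j) ^+ 2.
Proof.
move=> srho z; rewrite !big_ord1 ler_pXn2r ?nnegrE ?nr_ge0 //.
apply: le_trans (star_rep_contractive srho _ _) _.
by rewrite ler_piMl ?nr_ge0 // nr_proj.
Qed.

Lemma proj_coinvariant : coinvariant p.
Proof.
move=> y yp x; rewrite [x]theta_split linearD dotDr /=.
rewrite (@proj_range_orth (mu p y) (x - theta p x)) ?mu_projK ?theta_p0 // addr0.
apply: (@row_orth 1 ord0 (fun => p) (theta p x) y) => //.
- exact: proj_row.
- by move=> j; exact: proj_intertwined.
- by rewrite big_ord1 adj_p !theta_pp.
Qed.

Lemma proj_reduced : reduced p.
Proof. by split=> //; [exact: proj_intertwined|exact: proj_coinvariant]. Qed.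

End Projection.

(** mu(s) V x = mu(s) V theta(p) x is no longer than theta(p) x, which has the
    length of theta(s) x; and it compresses to theta(s) x. *)
Lemma isometry_intertwined s p : Alg s -> Alg p -> adj p = p -> p ** p = p ->
  adj s ** s = p -> s ** p = s -> intertwined s.
Proof.
move=> As Ap adj_p pp ssp sp x.
have -> : mu s (V x) = mu s (V (theta p x)).
  by rewrite -(proj_intertwined Ap adj_p pp) -(rep_mul mu_rep) // sp.
have ns : nr s <= 1.
  by have := nr_adjM s; rewrite ssp; have := nr_proj adj_p pp; have := nr_ge0 s; nra.
have d : dot (theta s x) (theta s x) = dot (theta p x) (theta p x).
  by rewrite (star_rep_adj sth) -(star_repM sth) ssp [RHS](star_rep_adj sth) adj_p theta_pp.
have nn : nr (theta s x) = nr (theta p x).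
  by apply/eqP; rewrite -(@eqrXn2 _ 2) ?nr_ge0 //; apply/eqP/complexI; rewrite -!dotxx.
apply: eq_of_compress.
  rewrite nr_V nn -[leRHS]nr_V; apply: le_trans (mu_le _ As) _.
  by rewrite ler_piMl ?nr_ge0.
by rewrite compress // -(star_repM sth) sp Visom.
Qed.

End Dilation.

(** * Dilations of the tensor algebra *)

Lemma star_rep_comp (R : realType) (A B : cstar_algebra R) (f : A -> B)
    (H : hilbert_space R) (rho : B -> {linear H -> H}) :
  star_hom f -> is_star_rep rho -> is_star_rep (fun a => rho (f a)).
Proof.
move=> hf srho; split; last first.
  by move=> a x y; rewrite (star_rep_adj srho) (star_hom_adj hf).
split.
- by move=> a _; exact: (rep_cont (proj1 srho)).
- by move=> k a b _ _ x; rewrite (star_hom_lin hf) (star_repD srho) (star_repZ srho).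
- by move=> a b _ _ x; rewrite (star_hom_mul hf) (star_repM srho).
Qed.

Section CorrRep.
Context {R : realType} {A : cstar_algebra R} {X : correspondence A} {T : cstar_algebra R}
  { pi : A -> T} {t : X -> T}.
Hypothesis (rep : is_corr_rep pi t).

Lemma corr_rep0 : t 0 = 0.
Proof.
have := corr_rep_lin rep (-1) 0 0.
by rewrite scaleN1r addNr scaleN1r addNr.
Qed.

Lemma corr_repB x y : t (x - y) = t x - t y.
Proof. by rewrite addrC -scaleN1r (corr_rep_lin rep) scaleN1r addrC. Qed.

Lemma corr_rep_lincomb (I : Type) (x : I -> X) l :
  t (lincomb x l) = lincomb (fun i => t (x i)) l.
Proof.
rewrite /lincomb; elim: l => [|p l IH]; first by rewrite !big_nil corr_rep0.
by rewrite !big_cons (corr_rep_lin rep) IH.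
Qed.

Lemma rep_le_left a : rep_le (pi a) (nr a).
Proof.
move=> L rho srho x; exact: (star_rep_contractive (star_rep_comp (corr_rep_hom rep) srho)).
Qed.

(** |rho(t x) z|^2 = <rho(pi <x,x>) z, z>, and rho o pi is contractive. *)
Lemma rep_le_t x : rep_le (t x) (nr x).
Proof.
move=> L rho srho z.
rewrite -(@ler_pXn2r _ 2) ?nnegrE ?mulr_ge0 ?nr_ge0 //.
have := star_rep_nr2 srho (t x) z; rewrite (corr_rep_inner rep) => e.
have -> : nr (rho (t x) z) ^+ 2 = complex.Re (dot (rho (pi (inner x x)) z) z) by rewrite -e.
apply: le_trans (le_Re_nr _) _; apply: le_trans (cauchy_schwarz _ _) _.
have := @rep_le_left (inner x x) L rho srho z; rewrite nr_inner exprMn => h.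
by rewrite [X in _ <= _ * X]expr2 mulrA ler_wpM2r ?nr_ge0.
Qed.
End CorrRep.

Section Tensor.
Context {R : realType} {G : digraph} {A : cstar_algebra R} {ev : A -> vertex G -> R[i]}
  {X : correspondence A} {chi : (edge G -> R[i]) -> X} {T : cstar_algebra R}
  { pi : A -> T} {t : X -> T}.
Hypothesis (gc : is_graph_correspondence ev chi) (rep : is_corr_rep pi t).
Hypothesis (rf : row_finite G).
Let c0 := graph_corr_c0 gc.
Let hpi := corr_rep_hom rep.
Local Notation Alg := (tensor_algebra pi t).
Local Notation P := (vertex_proj gc pi).
Local Notation S := (edge_iso chi t).

Lemma tensor_subalgebra : closed_subalgebra Alg.
Proof. exact: closed_subalgebra_genP. Qed.

Lemma tensor_pi a : Alg (pi a).
Proof. by move=> M [_]; apply; left; exists a. Qed.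

Lemma tensor_t x : Alg (t x).
Proof. by move=> M [_]; apply; right; exists x. Qed.

(** An induction principle: the linear spans of the vertex projections and of the
    edge isometries are dense in the copies of c_0 and of X, in the sense of
    [rep_le]. *)
Lemma tensor_ind (M : set T) :
  M 0 -> (forall (k : R[i]) a b, M a -> M b -> M (k *: a + b)) ->
  (forall a b, M a -> M b -> M (a ** b)) ->
  (forall b, Alg b -> (forall e : R, 0 < e -> exists2 d, M d & rep_le (b - d) e) -> M b) ->
  M `<=` Alg -> (forall p, M (P p)) -> (forall e, M (S e)) -> Alg `<=` M.
Proof.
move=> M0 ML MM Mlim MA MP MS.
have Mlin (I : Type) (f : I -> T) l : (forall i, M (f i)) -> M (lincomb f l).
  move=> Mf; rewrite /lincomb; elim: l => [|p l IH]; rewrite ?big_nil // big_cons.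
  exact: ML.
suff MG : range pi `|` range t `<=` M.
  move=> b; apply; split=> //; split=> //.
  apply/nr_closedP => x h; apply: Mlim.
    have /nr_closedP := subalg_closed tensor_subalgebra; apply => e e0.
    by have [y /MA Ay xy] := h e e0; exists y.
  move=> e e0; have [y My xy] := h e e0; exists y => //.
  exact: rep_le_of_nr.
move=> _ [[a _ <-]|[x _ <-]]; apply: Mlim.
- exact: tensor_pi.
- move=> e e0; have [l al] := indicator_dense c0 a e0.
  exists (lincomb P l); first exact: Mlin.
  have -> : lincomb P l = pi (lincomb (indicator c0) l).
    by rewrite /lincomb (star_hom_sum hpi); apply: eq_bigr => p _; rewrite (star_homZ hpi).
  by rewrite -(star_homB hpi); apply: rep_le_mono (rep_le_left rep _) al.
- exact: tensor_t.
- move=> e e0; have [l xl] := edge_vec_dense gc x e0.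
  exists (lincomb S l); first exact: Mlin.
  rewrite -(corr_rep_lincomb rep) -(corr_repB rep).
  exact: rep_le_mono (rep_le_t rep _) xl.
Qed.

Lemma tensor_vertex_proj p : Alg (P p). Proof. exact: tensor_pi. Qed.
Lemma tensor_edge_iso e : Alg (S e). Proof. exact: tensor_t. Qed.

Section Dilation.
Context {H K : hilbert_space R}.
Variables (theta : T -> {linear H -> H}) (V : {linear H -> K}) (mu : T -> {linear K -> K}).
Hypothesis sth : is_star_rep theta.
Hypothesis Visom : forall x y, dot (V x) (V y) = dot x y.
Hypothesis mu_rep : is_rep Alg mu.
Hypothesis mu_cc : completely_contractive Alg mu.
Hypothesis compress : forall a, Alg a -> forall x y,
  dot (mu a (V x)) (V y) = dot (theta a x) y.
Let subA := tensor_subalgebra.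

Lemma vertex_proj_reduced p : reduced (Alg := Alg) theta V mu (P p).
Proof.
apply: proj_reduced => //; [exact: tensor_vertex_proj|exact: (adj_vertex_proj gc rep _)|exact: (vertex_proj_idem gc rep _)].
Qed.

Lemma edge_iso_intertwined e : intertwined theta V mu (S e).
Proof.
refine (isometry_intertwined sth Visom mu_rep mu_cc compress
  (s := S e) (p := P (src e)) _ _ _ _ _ _).
- exact: tensor_edge_iso.
- exact: tensor_vertex_proj.
- exact: (adj_vertex_proj gc rep _).
- exact: (vertex_proj_idem gc rep _).
- by rewrite (edge_iso_orth gc rep) eqxx.
- exact: (edge_iso_vertex_proj gc rep _).
Qed.

(** On the range of p_v the row of all s_e with r(e) = v, a finite row, is
    coisometric in theta because the gap vanishes; off that range the claim is
    one about p_v. *)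
Lemma edge_iso_coinvariant f : (forall x, theta (gap gc pi t rf (rng f)) x = 0) ->
  coinvariant V mu (S f).
Proof.
move=> gap0 y yp x; set v := rng f.
have tP z : theta (P v) z = \sum_(e <- incoming rf v) theta (S e) (theta (adj (S e)) z).
  have := gap0 z; rewrite /gap (star_repB sth) (star_rep_sum sth) => /eqP.
  rewrite subr_eq0 => /eqP ->; apply: eq_bigr => e _; exact: star_repM.
rewrite [x](theta_split theta (P v)) linearD dotDr /=.
have pp := vertex_proj_idem gc rep v; have ap := adj_vertex_proj gc rep v.
have -> : dot (mu (S f) y) (V (x - theta (P v) x)) = 0.
  apply: (proj_range_orth Visom mu_rep mu_cc compress (tensor_vertex_proj v) ap pp); last exact: theta_p0.
  rewrite -(rep_mul mu_rep) ?(vertex_proj_edge_iso gc rep) ?eqxx //; [exact: tensor_vertex_proj|exact: tensor_edge_iso].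
rewrite addr0; pose s := in_tuple (incoming rf v).
have fs : f \in incoming rf v by rewrite mem_incoming.
have fi : (index f (incoming rf v) < size (incoming rf v))%N by rewrite index_mem.
pose i0 := Ordinal fi; pose b j := S (tnth s j).
have bi0 : b i0 = S f by rewrite /b (tnth_nth f) nth_index.
have tnthE j k : (tnth s j == tnth s k) = (j == k).
  by rewrite !(tnth_nth f) nth_uniq ?incoming_uniq.
rewrite -bi0; apply: (row_orth subA sth Visom mu_rep mu_cc i0 (b := b)) => //.
- by move=> j; exact: tensor_edge_iso.
- move=> L rho srho z.
  rewrite nr_sum_orth; last first.
    move=> j k jk; rewrite (star_rep_adj srho) -(star_repM srho) (edge_iso_orth gc rep).
    by rewrite tnthE (negbTE jk) (star_rep0 srho) dot0r.
  apply: ler_sum => j _; rewrite ler_pXn2r ?nnegrE ?nr_ge0 //.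
  apply: le_trans (star_rep_contractive srho _ _) _.
  rewrite ler_piMl ?nr_ge0 //.
  have := nr_adjM (b j); rewrite (edge_iso_orth gc rep) eqxx.
  have := nr_proj (adj_vertex_proj gc rep (src (tnth s j))) (vertex_proj_idem gc rep _).
  by have := nr_ge0 (b j); nra.
- by move=> j; exact: edge_iso_intertwined.
- rewrite -[RHS](theta_pp sth pp) [RHS]tP [RHS]big_tnth.
  by apply: eq_bigr.
Qed.

Lemma tensor_reduced : (forall e, coinvariant V mu (S e)) ->
  forall b, Alg b -> reduced (Alg := Alg) theta V mu b.
Proof.
move=> co; apply: tensor_ind.
- exact: reduced0.
- by move=> k a b; exact: reducedP.
- by move=> a b; exact: reducedM.
- by move=> b; exact: reduced_lim.
- by move=> b [].
- exact: vertex_proj_reduced.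
- by move=> e; split; [exact: tensor_edge_iso|exact: edge_iso_intertwined|exact: co].
Qed.

End Dilation.
End Tensor.

(** * Weighted shifts on Hilbert sums *)

Lemma bounded_continuous (R : realType) (H K : hilbert_space R) (f : {linear H -> K}) c :
  (forall x, nr (f x) <= c * nr x) -> continuous f.
Proof.
move=> fc x B /nbhs_nrP[e e0 eB]; apply/nbhs_nrP.
have c0 : 0 < `|c| + 1 by rewrite ltr_wpDl.
exists (e / (`|c| + 1)); first by rewrite divr_gt0.
move=> y; rewrite ltr_pdivlMr // => xy; apply: eB.
rewrite -linearB /=; apply: le_lt_trans (fc _) _; apply: le_lt_trans xy.
by have := ler_norm c; have := nr_ge0 (x - y); nra.
Qed.

Definition bop_rep (R : realType) (K : hilbert_space R) (a : bounded_operators K) :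
  {linear K -> K} := op a.

Lemma bop_star_rep (R : realType) (K : hilbert_space R) : is_star_rep (@bop_rep R K).
Proof.
split; last exact: op_adjP.
split=> // a _; apply: (@bounded_continuous _ _ _ _ (nr a)) => x; exact: nr_op.
Qed.

(** Phi and Psi are mutually inverse between the supports of a and b. *)
Lemma is_sum_reindex (R : realType) (J : eqType) (a b : J -> R[i]) (Phi Psi : J -> J)
    (sa sb : pred J) l :
  (forall j, ~~ sa j -> a j = 0) -> (forall j, ~~ sb j -> b j = 0) ->
  (forall j, sa j -> sb (Phi j) /\ Psi (Phi j) = j) ->
  (forall j, sb j -> sa (Psi j) /\ Phi (Psi j) = j) ->
  (forall j, sa j -> b (Phi j) = a j) ->
  is_sum a l -> is_sum b l.
Proof.
move=> a0 b0 hPhi hPsi ab al e e0; have [s0 hs0] := al e e0.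
exists [seq Phi j | j <- s0 & sa j] => s us s0s.
pose u := [seq Psi j | j <- s & sb j].
have uu : uniq u.
  rewrite map_inj_in_uniq ?filter_uniq // => i j; rewrite !mem_filter => /andP[bi _] /andP[bj _] ij.
  by rewrite -(hPsi i bi).2 ij (hPsi j bj).2.
have sau j : j \in u -> sa j.
  rewrite /u => /mapP[k]; rewrite mem_filter => /andP[bk _] ->.
  by have [] := hPsi k bk.
have -> : \sum_(j <- s) b j = \sum_(j <- u) a j.
  rewrite (bigID sb) /= [X in _ + X]big1 ?addr0 => [|j]; last exact: b0.
  rewrite big_map big_filter; apply: eq_bigr => j bj.
  by have [aj e1] := hPsi j bj; rewrite -ab // e1.
have -> : \sum_(j <- u) a j = \sum_(j <- u ++ [seq j <- undup s0 | j \notin u]) a j.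
  rewrite big_cat big_filter /= [X in _ = _ + X]big_seq_cond.
  rewrite [X in _ = _ + X]big1 ?addr0 // => j /andP[]; rewrite mem_undup => js ju.
  apply: a0; apply: contra ju => aj; apply/mapP; exists (Phi j); last by have [_ ->] := hPhi j aj.
  rewrite mem_filter (hPhi j aj).1 /=; apply: s0s; apply/mapP; exists j => //.
  by rewrite mem_filter aj.
apply: hs0.
  rewrite cat_uniq uu filter_uniq ?undup_uniq // andbT.
  by apply/hasPn => j; rewrite mem_filter => /andP[].
by move=> j js; rewrite mem_cat mem_filter mem_undup js andbT; case: (j \in u).
Qed.

Section WeightedShift.
Context {R : realType} {T : cstar_algebra R} {I O : eqType}.
Variables (Hf : I -> hilbert_space R) (sg : forall i, T -> {linear Hf i -> Hf i}).
Hypothesis ssg : forall i, is_star_rep (sg i).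

Definition shift_space : hilbert_space R := l2_sum (fun j : I * O => Hf j.1).
Local Notation K := shift_space.

Definition coord (x : K) (i : I) (o : O) : Hf i := sval x (i, o).

Lemma coord_ext (x y : K) : (forall i o, coord x i o = coord y i o) -> x = y.
Proof. by move=> xy; apply: (@gauge_ext _ (l2_gauge _)) => -[i o]; exact: xy. Qed.

Lemma coordP (k : R[i]) (x y : K) i o : coord (k *: x + y) i o = k *: coord x i o + coord y i o.
Proof. by []. Qed.

Lemma coordD (x y : K) i o : coord (x + y) i o = coord x i o + coord y i o.
Proof. by []. Qed.

(** A weighted shift: coordinate o of the image is the weight wt o, acting in the
    representation at hand, applied to coordinate phi o.  On the support of the
    weights phi is injective with inverse phi', and (phi', wt') gives the
    adjoint. *)
Record shift_data := ShiftData {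
  phi : O -> O; wt : O -> T; phi' : O -> O; wt' : O -> T; shift_norm : R;
  shift_adj : forall o, wt o != 0 -> phi' (phi o) = o /\ wt' (phi o) = adj (wt o);
  shift_adj' : forall o, wt' o != 0 -> phi (phi' o) = o /\ wt (phi' o) = adj (wt' o);
  shift_norm_ge0 : 0 <= shift_norm;
  shift_le : forall o, rep_le (wt o) shift_norm;
  shift_le' : forall o, rep_le (wt' o) shift_norm
}.

Definition shift_swap (d : shift_data) := ShiftData (shift_adj' (s := d)) (shift_adj (s := d))
  (shift_norm_ge0 d) (shift_le' d) (shift_le d).

Definition shift_fun (ph : O -> O) (w : O -> T) (x : forall j : I * O, Hf j.1) :
  forall j : I * O, Hf j.1 := fun j => sg j.1 (w j.2) (x (j.1, ph j.2)).

Lemma shift_bnd (d : shift_data) x (c : R) :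
  l2_bnd (H := fun j : I * O => Hf j.1) x c ->
  l2_bnd (H := fun j : I * O => Hf j.1) (shift_fun (phi d) (wt d) x) (shift_norm d * c).
Proof.
have M0 := shift_norm_ge0 d.
move=> [c0 xc]; split=> [|s us]; first exact: mulr_ge0.
pose Phi (j : I * O) := (j.1, phi d j.2).
pose u := [seq Phi j | j <- s & wt d j.2 != 0].
have uu : uniq u.
  rewrite map_inj_in_uniq ?filter_uniq // => -[i o] [i' o'].
  rewrite !mem_filter /= => /andP[wo _] /andP[wo' _] [-> po].
  by rewrite -(shift_adj wo).1 po (shift_adj wo').1.
rewrite (bigID (fun j => wt d j.2 != 0)) /= [X in _ + X]big1 ?addr0; last first.
  move=> -[i o] /=; rewrite negbK /shift_fun /= => /eqP->.
  by rewrite (star_rep0 (ssg i)) nr0 expr0n.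
have le : \sum_(j <- s | wt d j.2 != 0) nr (shift_fun (phi d) (wt d) x j) ^+ 2 <=
    \sum_(j <- u) (shift_norm d) ^+ 2 * nr (x j) ^+ 2.
  rewrite big_map big_filter; apply: ler_sum => -[i o] _.
  rewrite -exprMn ler_pXn2r ?nnegrE ?mulr_ge0 ?nr_ge0 //.
  exact: shift_le.
by apply: le_trans le _; rewrite -mulr_sumr exprMn ler_wpM2l ?sqr_ge0 ?xc.
Qed.

Lemma shift_dom (d : shift_data) (x : K) : l2_dom (shift_fun (phi d) (wt d) (sval x)).
Proof. by have [c xc] := svalP x; exists (shift_norm d * c); exact: shift_bnd. Qed.

Definition shift_map (d : shift_data) (x : K) : K := exist _ _ (shift_dom d x).

Lemma shift_adjoint d : adjoint_pair (shift_map d) (shift_map (shift_swap d)).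
Proof.
move=> x y; apply: is_sum_unique (is_sum_dot x (shift_map (shift_swap d) y)).
apply: (@is_sum_reindex _ _ _ _ (fun j => (j.1, phi d j.2)) (fun j => (j.1, phi' d j.2))
  (fun j => wt d j.2 != 0) (fun j => wt' d j.2 != 0)) (is_sum_dot (shift_map d x) y).
- move=> -[i o] /=; rewrite negbK /shift_fun /= => /eqP->.
  by rewrite (star_rep0 (ssg i)) dot0l.
- move=> -[i o] /=; rewrite negbK /shift_fun /= => /eqP->.
  by rewrite (star_rep0 (ssg i)) dot0r.
- move=> -[i o] /= wo; have [-> wE] := shift_adj wo; split=> //.
  by rewrite wE; apply: contra wo => /eqP w0; rewrite -[wt d o]adjK w0 adj0.
- move=> -[i o] /= wo; have [-> wE] := shift_adj' wo; split=> //.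
  by rewrite wE; apply: contra wo => /eqP w0; rewrite -[wt' d o]adjK w0 adj0.
- move=> -[i o] /= wo; have [e1 e2] := shift_adj wo.
  by rewrite /shift_fun /= e1 e2 (star_rep_adj (ssg i)).
Qed.

Lemma shift_op_bnd d : op_bnd (shift_map d) (shift_norm d).
Proof.
split=> [|x]; first exact: shift_norm_ge0.
apply/(bndP (g := l2_gauge _)); apply: shift_bnd.
exact/(bndP (g := l2_gauge _)).
Qed.

Lemma shift_op_dom d : op_dom (shift_map d).
Proof.
split; first by exists (shift_map (shift_swap d)); exact: shift_adjoint.
by exists (shift_norm d); exact: shift_op_bnd.
Qed.

Definition shift_op d : bounded_operators K := exist _ _ (shift_op_dom d).

Lemma coord_shift_adj d x i o :
  coord (op (adj (shift_op d)) x) i o = sg i (wt' d o) (coord x i (phi' d o)).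
Proof.
suff -> : op (adj (shift_op d)) = shift_map (shift_swap d) by [].
by apply: op_adjE; exact: shift_adjoint.
Qed.

Lemma nr_shift_op d : nr (shift_op d) <= shift_norm d.
Proof. by apply/(bndP (g := op_gauge _)); exact: shift_op_bnd. Qed.

(** The vector h at coordinate (i, o), transported along i = j.1 where this
    equation holds, and 0 elsewhere. *)
Definition delta_fun i o (h : Hf i) : forall j : I * O, Hf j.1 := fun j =>
  match @eqP _ i j.1 with
  | ReflectT e => if j.2 == o then eq_rect i Hf h j.1 e else 0
  | _ => 0
  end.

Lemma delta_funE i o h : delta_fun o h (i, o) = h.
Proof.
rewrite /delta_fun /=; case: eqP => // e; rewrite eqxx.
by rewrite (eq_axiomK e).
Qed.

Lemma delta_fun0 i o (h : Hf i) j : j != (i, o) -> delta_fun o h j = 0.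
Proof.
case: j => i' o'; rewrite /delta_fun /= xpair_eqE => ne; case: eqP => // e.
by case: eqP => // oo; rewrite -e oo !eqxx in ne.
Qed.

Lemma delta_bnd i o (h : Hf i) : l2_bnd (H := fun j : I * O => Hf j.1) (delta_fun o h) (nr h).
Proof.
split=> [|s us]; first exact: nr_ge0.
have [js|js] := boolP ((i, o) \in s).
  rewrite (bigD1_seq (i, o)) //= delta_funE big1 ?addr0 // => j jn.
  by rewrite delta_fun0 // nr0 expr0n.
rewrite big_seq big1 ?sqr_ge0 // => j jj; rewrite delta_fun0 ?nr0 ?expr0n //.
by apply: contra js => /eqP <-.
Qed.

Definition delta i o (h : Hf i) : K := exist _ _ (ex_intro _ _ (delta_bnd o h)).

Lemma coord_delta i o h : coord (delta o h) i o = h.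
Proof. exact: delta_funE. Qed.

Lemma coord_delta0 i o (h : Hf i) i' o' : (i', o') != (i, o) -> coord (delta o h) i' o' = 0.
Proof. exact: delta_fun0. Qed.

Lemma nr_delta i o (h : Hf i) : nr (delta o h) = nr h.
Proof.
apply/eqP; rewrite eq_le; apply/andP; split.
  by apply/(bndP (g := l2_gauge _)); exact: delta_bnd.
have /(bndP (g := l2_gauge _))[n0 /(_ [:: (i, o)] isT)] := lexx (nr (delta o h)).
by rewrite big_seq1 -/(coord (delta o h) i o) coord_delta ler_pXn2r ?nnegrE ?nr_ge0.
Qed.

Lemma deltaP i o (k : R[i]) (h h' : Hf i) : delta o (k *: h + h') = k *: delta o h + delta o h'.
Proof.
apply: coord_ext => i' o'; rewrite coordP.
have [[-> ->]|ne] := eqVneq (i', o') (i, o); first by rewrite !coord_delta.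
by rewrite !coord_delta0 // scaler0 addr0.
Qed.

Lemma deltaB i o (h h' : Hf i) : delta o (h - h') = delta o h - delta o h'.
Proof. by rewrite addrC -scaleN1r deltaP scaleN1r addrC. Qed.

Lemma delta_sum i o (B : Type) (s : seq B) (F : B -> Hf i) :
  \sum_(b <- s) delta o (F b) = delta o (\sum_(b <- s) F b).
Proof.
have d0 : delta o (0 : Hf i) = 0 by apply/nr_eq0; rewrite nr_delta nr0.
elim: s => [|b s IH]; first by rewrite !big_nil d0.
by rewrite !big_cons IH -{1}[delta o (F b)]scale1r -deltaP scale1r.
Qed.

End WeightedShift.

(** * The path model that closes the gap at one vertex *)

Section PathModel.
Context {R : realType} {G : digraph} {A : cstar_algebra R} {ev : A -> vertex G -> R[i]}
  {X : correspondence A} {chi : (edge G -> R[i]) -> X} {T : cstar_algebra R}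
  { pi : A -> T} {t : X -> T}.
Hypothesis (gc : is_graph_correspondence ev chi) (rep : is_corr_rep pi t).
Hypothesis (rf : row_finite G).
Variable (f : edge G).
Context {I : eqType} (Hf : I -> hilbert_space R) (sg : forall i, T -> {linear Hf i -> Hf i}).
Hypothesis ssg : forall i, is_star_rep (sg i).

Let c0 := graph_corr_c0 gc.
Let hpi := corr_rep_hom rep.
Local Notation P := (vertex_proj gc pi).
Local Notation S := (edge_iso chi t).
Local Notation v := (rng f).
Local Notation w := (src f).
Local Notation q := (gap gc pi t rf v).
Local Notation O := (option (nat * seq (edge G))).
Local Notation K := (@shift_space R I O Hf).

(** A path is the list of its edges, the last one traversed first; the empty path
    is the vertex s(f). *)
Definition path_rng (mu : seq (edge G)) : vertex G := if mu is e :: _ then rng e else w.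

(** The pair (n, mu) names the image under mu of copy number n of gap_v H.  A path
    must not begin with f, since s_f maps copy n + 1 onto copy n and copy 0 onto
    gap_v H itself.  Copies other than copy 0 occur only if f is a loop. *)
Fixpoint path_ok (n : nat) (mu : seq (edge G)) : bool :=
  if mu is e :: mu' then
    [&& src e == path_rng mu', path_ok n mu' & ~~ ((mu' == [::]) && (e == f))]
  else (n == 0) || (w == v).

(** The projection onto the summand (n, mu), inside a full copy of H.  Pairs that
    are no paths get the summand 0. *)
Definition mult n mu : T := if path_ok n mu then q else 0.

Lemma adj_mult n mu : adj (mult n mu) = mult n mu.
Proof. by rewrite /mult; case: ifP => _; [exact: adj_gap|exact: adj0]. Qed.

Lemma mult_mult n mu : mult n mu ** mult n mu = mult n mu.
Proof. by rewrite /mult; case: ifP => _; [exact: gap_gap|exact: cmul0l]. Qed.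

Lemma nr_gap : nr q <= 1.
Proof. by apply: nr_proj; [exact: adj_gap|exact: gap_gap]. Qed.

Lemma nr_mult n mu : nr (mult n mu) <= 1.
Proof. by rewrite /mult; case: ifP => _; rewrite ?nr0 ?ler01 // nr_gap. Qed.

Lemma nr_edge_iso e : nr (S e) <= 1.
Proof.
have := nr_adjM (S e); rewrite (edge_iso_orth gc rep) eqxx.
have := nr_proj (adj_vertex_proj gc rep (src e)) (vertex_proj_idem gc rep _).
by have := nr_ge0 (S e); nra.
Qed.

(** None is the index of the original space H. *)
Definition diag_wt (a : A) (o : O) : T :=
  if o is Some (n, mu) then ev a (path_rng mu) *: mult n mu else pi a.

Lemma diag_wt_adj a o : adj (diag_wt a o) = diag_wt (adj a) o.
Proof.
case: o => [[n mu]|] /=; last by rewrite (star_hom_adj hpi).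
by rewrite adjZc adj_mult (c0_adj c0).
Qed.

Lemma diag_wt_le a o : rep_le (diag_wt a o) (nr a).
Proof.
case: o => [[n mu]|] /=; last exact: rep_le_left rep _.
apply: rep_le_of_nr; rewrite nrZ.
have h : nr (ev a (path_rng mu) : complexField R) <= nr a.
  by apply: (nr_evP c0 a (nr_ge0 a)).1; exact: lexx.
apply: le_trans h; rewrite ler_piMr ?nr_ge0 //; exact: nr_mult.
Qed.

Definition diag_data (a : A) : @shift_data R T O.
Proof.
apply: (@ShiftData R T O id (diag_wt a) id (diag_wt (adj a)) (nr a)).
- by move=> o _; rewrite diag_wt_adj.
- by move=> o _; rewrite diag_wt_adj adjK.
- exact: nr_ge0.
- exact: diag_wt_le.
- by move=> o; rewrite -nr_adj; exact: diag_wt_le.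
Defined.

(** Coordinate (n, e mu) is reached from (n, mu) along e, and coordinate
    (n, empty) from (n + 1, empty) along f. *)
Definition edge_src (o : O) : O :=
  match o with
  | Some (n, e' :: mu) => Some (n, mu)
  | Some (n, [::]) => Some (n.+1, [::])
  | None => None
  end.

Definition edge_wt (e : edge G) (o : O) : T :=
  match o with
  | Some (n, e' :: mu) => if e' == e then mult n (e' :: mu) else 0
  | Some (n, [::]) => if e == f then mult n.+1 [::] else 0
  | None => S e
  end.

Definition edge_tgt (e : edge G) (o : O) : O :=
  match o with
  | Some (n, mu) =>
      if (mu == [::]) && (e == f) then (if n is n'.+1 then Some (n', [::]) else None)
      else Some (n, e :: mu)
  | None => None
  end.

Definition edge_wt' (e : edge G) (o : O) : T :=
  match o with
  | Some (n, mu) =>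
      if (mu == [::]) && (e == f) then (if n is n'.+1 then mult n [::] else 0)
      else mult n (e :: mu)
  | None => adj (S e)
  end.

Definition edge_data (e : edge G) : @shift_data R T O.
Proof.
apply: (@ShiftData R T O edge_src (edge_wt e) (edge_tgt e) (edge_wt' e) 1).
- case=> [[n [|e' mu]]|] //=.
    by case: (eqVneq e f) => _; rewrite ?eqxx // adj_mult.
  case: (eqVneq e' e) => [->|_]; last by rewrite eqxx.
  rewrite /mult /=; case: ifP => [/and3P[_ _ /negbTE ->]|]; last by rewrite eqxx.
  by rewrite adj_gap.
- case=> [[n mu]|] //=; last by rewrite adjK.
  case: ifP => [/andP[/eqP -> /eqP ->]|].
    by case: n => [|n]; rewrite ?eqxx //= adj_mult eqxx.
  by rewrite /= eqxx adj_mult.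
- exact: ler01.
- by case=> [[n [|e' mu]]|] //=; [case: ifP|case: ifP|]; move=> *; apply: rep_le_of_nr;
    rewrite ?nr0 ?nr_mult ?nr_edge_iso.
- case=> [[n mu]|] /=; last by apply: rep_le_of_nr; rewrite nr_adj nr_edge_iso.
  case: ifP => _; last by apply: rep_le_of_nr; exact: nr_mult.
  by case: n => [|n]; apply: rep_le_of_nr; rewrite ?nr0 ?nr_mult.
Defined.

(** The part of s_f that maps copy 0 onto gap_v H inside the original space; the
    rest of s_f is in [edge_wt]. *)
Definition glue_wt (e : edge G) (o : O) : T :=
  if o is None then (if e == f then q else 0) else 0.

Definition glue_wt' (e : edge G) (o : O) : T :=
  if (o == Some (0%N, [::])) && (e == f) then q else 0.

Definition glue_data (e : edge G) : @shift_data R T O.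
Proof.
apply: (@ShiftData R T O (fun _ => Some (0%N, [::])) (glue_wt e) (fun _ => None) (glue_wt' e) 1).
- case=> [j|] /=; first by rewrite eqxx.
  by rewrite /glue_wt' eqxx /=; case: ifP; rewrite ?eqxx // adj_gap.
- move=> o; rewrite /glue_wt'; case: ifP; last by rewrite eqxx.
  by move=> /andP[/eqP -> /eqP ->] _; rewrite /glue_wt eqxx adj_gap.
- exact: ler01.
- by case=> [j|] /=; [|case: ifP => _]; apply: rep_le_of_nr; rewrite ?nr0 ?nr_gap.
- by move=> o; rewrite /glue_wt'; case: ifP => _; apply: rep_le_of_nr; rewrite ?nr0 ?nr_gap.
Defined.

Local Notation B := (bounded_operators K).

Definition diag_op (a : A) : B := shift_op ssg (diag_data a).
Definition edge_op (e : edge G) : B := shift_op ssg (edge_data e) + shift_op ssg (glue_data e).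

Implicit Types (x : K) (i : I) (n : nat) (mu : seq (edge G)).

Lemma opD (a b : B) x : op (a + b) x = op a x + op b x.
Proof. by []. Qed.

Lemma coord_diag a x i o : coord (op (diag_op a) x) i o = sg i (diag_wt a o) (coord x i o).
Proof. by []. Qed.

Lemma coord_edge e x i o : coord (op (edge_op e) x) i o =
  sg i (edge_wt e o) (coord x i (edge_src o)) + sg i (glue_wt e o) (coord x i (Some (0%N, [::]))).
Proof. by []. Qed.

Lemma coord_edge_adj e x i o : coord (op (adj (edge_op e)) x) i o =
  sg i (edge_wt' e o) (coord x i (edge_tgt e o)) + sg i (glue_wt' e o) (coord x i None).
Proof. by rewrite adjD opD coordD !coord_shift_adj. Qed.

Lemma model_ext (a b : B) : (forall x i o, coord (op a x) i o = coord (op b x) i o) -> a = b.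
Proof. by move=> ab; apply: op_ext => x; apply: coord_ext => i o. Qed.

Lemma diag_hom : star_hom (diag_op : A -> B).
Proof.
split.
- move=> k a b; apply: model_ext => x i [[n mu]|].
    rewrite coord_diag /= (c0_lin c0) scalerDl -scalerA (star_repD (ssg i)) (star_repZ (ssg i)).
    by [].
  by rewrite coord_diag /= (star_hom_lin hpi) (star_repD (ssg i)) (star_repZ (ssg i)).
- move=> a b; apply: model_ext => x i [[n mu]|]; rewrite coord_diag; last first.
    by rewrite /= (star_hom_mul hpi) (star_repM (ssg i)).
  rewrite -[RHS]/(sg i (diag_wt a _) (sg i (diag_wt b _) _)) -(star_repM (ssg i)) /=.
  by rewrite cmulZl cmulZr mult_mult (c0_mul c0) scalerA.
- move=> a; apply: model_ext => x i o.
  by rewrite coord_shift_adj.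
Qed.

Lemma nr_diag a : nr (diag_op a) <= nr a.
Proof. exact: nr_shift_op. Qed.

Lemma op_mulE (a b : B) x : op (a ** b) x = op a (op b x).
Proof. by []. Qed.

Lemma diag_edge a e : diag_op a ** edge_op e = ev a (rng e) *: edge_op e.
Proof.
apply: model_ext => x i o; rewrite op_mulE coord_diag coord_edge linearD /=.
rewrite -!(star_repM (ssg i)).
transitivity (ev a (rng e) *: (sg i (edge_wt e o) (coord x i (edge_src o)) +
   sg i (glue_wt e o) (coord x i (Some (0%N, [::]))))); last by [].
rewrite scalerDr -!(star_repZ (ssg i)).
case: o => [[n [|e' mu]]|] /=.
- rewrite cmul0r scaler0; congr (sg i _ _ + _); case: eqP => [->|_]; last by rewrite cmul0r scaler0.
  rewrite /mult /=; case: (eqVneq w v) => [->|_]; last by rewrite cmul0r scaler0.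
  by rewrite orbT cmulZl (gap_gap gc rep).
- rewrite cmul0r scaler0; congr (sg i _ _ + _); case: eqP => [->|_]; last by rewrite cmul0r scaler0.
  by rewrite cmulZl mult_mult.
- rewrite (left_edge_iso gc rep); case: eqP => [->|_]; last by rewrite cmul0r scaler0.
  by rewrite left_gap.
Qed.

(** The ranges of the pieces are orthogonal: s_e H is orthogonal to gap_v H, and
    every other summand is reached along one edge only. *)
Lemma edge_edge e e' : adj (edge_op e) ** edge_op e' = diag_op (inner (edge_vec chi e) (edge_vec chi e')).
Proof.
apply: model_ext => x i o; rewrite op_mulE coord_edge_adj !coord_edge coord_diag.
rewrite !linearD /= -!(star_repM (ssg i)) (inner_edge_vec gc).
case: o => [[n mu]|] /=; last first.
  rewrite /glue_wt' /= !cmul0l !(star_rep0 (ssg i)) !addr0 (edge_iso_orth gc rep).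
  have -> : adj (S e) ** (if e' == f then q else 0) = 0.
    by case: ifP => _; [exact: (adj_edge_iso_gap gc rep)|exact: cmul0r].
  rewrite (star_rep0 (ssg i)) addr0; case: ifP => _ //.
  by rewrite (star_hom0 hpi).
have [/andP[/eqP -> /eqP ->]|ne] := boolP ((mu == [::]) && (e == f)).
  rewrite /glue_wt' /= eqxx andbT.
  case: n => [|n] /=.
    rewrite !cmul0l !(star_rep0 (ssg i)) !add0r (gap_edge_iso gc rep) (star_rep0 (ssg i)) add0r.
    rewrite [f == e']eq_sym; case: ifP => _; last by rewrite cmul0r (ev0 c0) scale0r.
    by rewrite /= indicatorE eqxx scale1r gap_gap.
  rewrite !cmul0l cmul0r !(star_rep0 (ssg i)) !addr0 [f == e']eq_sym.
  case: ifP => _; last by rewrite cmul0r (ev0 c0) scale0r.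
  by rewrite /= indicatorE eqxx scale1r mult_mult.
have -> : glue_wt' e (Some (n, mu)) = 0.
  rewrite /glue_wt'; case: ifP => // /andP[/eqP[_ m0] ef].
  by rewrite m0 ef in ne.
rewrite !cmul0l /= cmul0r !(star_rep0 (ssg i)) !addr0.
case: ifP => ee; last by rewrite cmul0r (ev0 c0) scale0r.
rewrite mult_mult /= indicatorE /mult /= ne andbT eq_sym.
by case: eqP; rewrite ?scale1r ?scale0r.
Qed.

(** In the original space the glued copies of gap_v H fill the gap, and every
    summand under p_v is reached along some edge. *)
Lemma edge_sum : \sum_(e <- incoming rf v) edge_op e ** adj (edge_op e) = diag_op (indicator c0 v).
Proof.
apply: model_ext => x i o.
have -> : coord (op (\sum_(e <- incoming rf v) edge_op e ** adj (edge_op e)) x) i o =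
    \sum_(e <- incoming rf v) coord (op (edge_op e) (op (adj (edge_op e)) x)) i o.
  apply: (big_morph (fun a : B => coord (op a x) i o)) => //.
rewrite coord_diag.
under eq_bigr do rewrite coord_edge !coord_edge_adj !linearD /= -!(star_repM (ssg i)).
have fin : f \in incoming rf v by rewrite mem_incoming.
case: o => [[n [|e' mu]]|] /=.
- rewrite (bigD1_seq f) ?incoming_uniq //= big1 ?addr0; last first.
    by move=> e /negbTE ef; rewrite ef !cmul0l !(star_rep0 (ssg i)) !addr0.
  rewrite eqxx /glue_wt' /= cmul0r !cmul0l !(star_rep0 (ssg i)) !addr0 indicatorE.
  rewrite mult_mult /mult /=; case: eqP => _; rewrite ?orbT ?scale1r ?scale0r //.
- rewrite indicatorE; have [ein|eout] := boolP (e' \in incoming rf v); last first.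
    rewrite -mem_incoming (negbTE eout) scale0r (star_rep0 (ssg i)) big_seq big1 // => e ein.
    case: (eqVneq e' e) => [ee|_]; first by rewrite ee ein in eout.
    by rewrite !cmul0l !(star_rep0 (ssg i)) !addr0.
  rewrite -mem_incoming ein scale1r (bigD1_seq e') ?incoming_uniq //= big1 ?addr0; last first.
    by move=> e; rewrite eq_sym => /negbTE ->; rewrite !cmul0l !(star_rep0 (ssg i)) !addr0.
  rewrite eqxx !cmul0l !(star_rep0 (ssg i)) !addr0.
  have [ok|nok] := boolP (path_ok n (e' :: mu)); last first.
    have -> : mult n (e' :: mu) = 0 by rewrite /mult (negbTE nok).
    by rewrite !cmul0l !(star_rep0 (ssg i)) !addr0.
  have /and3P[_ _ /negbTE ne] := ok.
  rewrite ne mult_mult /glue_wt'; case: ifP => [/andP[/eqP[_ m0] ef]|_].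
    by rewrite m0 ef in ne.
  by rewrite cmul0r (star_rep0 (ssg i)) addr0.
- have z e : sg i (S e ** adj (S e)) (coord x i None) + sg i (S e ** glue_wt' e None) (coord x i None) +
     (sg i ((if e == f then q else 0) ** edge_wt' e (Some (0%N, [::]))) (coord x i (edge_tgt e (Some (0%N, [::])))) +
      sg i ((if e == f then q else 0) ** glue_wt' e (Some (0%N, [::]))) (coord x i None)) =
     sg i (S e ** adj (S e)) (coord x i None) + (if e == f then sg i q (coord x i None) else 0).
    rewrite /glue_wt' /= cmul0r (star_rep0 (ssg i)) addr0; congr (_ + _).
    case: (eqVneq e f) => _; last by rewrite !cmul0l !(star_rep0 (ssg i)) addr0.
    by rewrite cmul0r (star_rep0 (ssg i)) add0r (gap_gap gc rep).
  rewrite (eq_bigr _ (fun e _ => z e)) big_split /= -(star_rep_sum (ssg i)).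
  rewrite (bigD1_seq f (F := fun e => if e == f then _ else _)) ?incoming_uniq //= eqxx.
  rewrite [X in _ + (_ + X)]big1 ?addr0 => [|e /negbTE -> //].
  by rewrite -(star_repD (ssg i)) /gap addrC subrK.
Qed.

End PathModel.

(** * The path model extends a norming family *)

Section RepFamily.
Context {R : realType} (T : cstar_algebra R).

(** One representation is chosen for each matrix and each number below its norm;
    this gives a family indexed by a set that attains all matrix norms. *)
Definition norm_witness (z : {n & 'M[T]_n} * R)
    (r : {H : hilbert_space R & T -> {linear H -> H}}) : Prop :=
  is_star_rep (projT2 r) /\
  (z.2%:E < opmx_norm (fun i j => projT2 r (projT2 z.1 i j)))%E.

Definition rep_index := {z | exists r, norm_witness z r}.

HB.instance Definition _ := gen_eqMixin rep_index.

Definition rep_space (i : rep_index) : hilbert_space R := projT1 (sval (cid (svalP i))).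
Definition rep_map (i : rep_index) : T -> {linear rep_space i -> rep_space i} :=
  projT2 (sval (cid (svalP i))).

Lemma rep_map_star i : is_star_rep (rep_map i).
Proof. by have [] := svalP (cid (svalP i)). Qed.

Lemma rep_family_norming n (a : 'M[T]_n) (y : \bar R) :
  (forall i, (opmx_norm (fun k l => rep_map i (a k l)) <= y)%E) -> (cmx_norm a <= y)%E.
Proof.
move=> h; apply: cmx_norm_le => H rho srho; rewrite leNgt; apply/negP => lt.
have [r [yr ro]] : exists r : R, (y <= r%:E)%E /\ (r%:E < opmx_norm (fun i j => rho (a i j)))%E.
  have o0 : (0%:E <= opmx_norm (fun i j => rho (a i j)))%E.
    by apply: le_ereal_inf_tmp => _ [k [k0 _] <-]; rewrite lee_fin.
  case: y lt {h} => [r lt||_]; first by exists r.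
    by rewrite ltNge leey.
  exists (-1); split; first exact: leNye.
  by apply: lt_le_trans o0; rewrite lte_fin ltrN10.
pose z : {n & 'M[T]_n} * R := (existT _ n a, r).
have wz : exists r, norm_witness z r by exists (existT _ H rho).
pose i : rep_index := exist _ z wz.
have [_ /= lt'] := svalP (cid (svalP i)).
have := lt_le_trans lt' (h i).
by rewrite ltNge yr.
Qed.
End RepFamily.

Section Model.
Context {R : realType} {G : digraph} {A : cstar_algebra R} {ev : A -> vertex G -> R[i]}
  {X : correspondence A} {chi : (edge G -> R[i]) -> X} {T : cstar_algebra R}
  { pi : A -> T} {t : X -> T}.
Hypothesis (gc : is_graph_correspondence ev chi) (toep : is_toeplitz_algebra pi t).
Hypothesis (rf : row_finite G).
Variable (f : edge G).
Context {I : eqType} (Hf : I -> hilbert_space R) (sg : forall i, T -> {linear Hf i -> Hf i}).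
Hypothesis ssg : forall i, is_star_rep (sg i).

Let rep : is_corr_rep pi t. Proof. by case: toep. Qed.
Let c0 := graph_corr_c0 gc.
Local Notation P := (vertex_proj gc pi).
Local Notation S := (edge_iso chi t).
Local Notation Alg := (tensor_algebra pi t).
Local Notation K := (@shift_space R I (option (nat * seq (edge G))) Hf).
Local Notation B := (bounded_operators K).
Local Notation dop := (diag_op gc rep rf f ssg).
Local Notation eop := (edge_op gc rep rf f ssg).

Lemma model_rep : exists nu : T -> B,
  [/\ star_hom nu, forall a, nu (pi a) = dop a & forall e, nu (S e) = eop e].
Proof.
have [tau [trep tauE]] := @corr_rep_extension R A B X (edge G) (edge_vec chi) dop eop
  (fun a e => ev a (rng e)) (edge_vec_dense gc) (diag_hom gc rep rf f ssg)
  (nr_diag gc rep rf f ssg) (edge_edge gc rep rf f ssg) (left_edge_vec gc)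
  (diag_edge gc rep rf f ssg).
have [_ _ /(_ B dop tau trep)[nu [hnu nupi nut]]] := toep.
by exists nu; split=> // e; rewrite nut tauE.
Qed.

Variables (nu : T -> B) (hnu : star_hom nu).
Hypothesis (nu_pi : forall a, nu (pi a) = dop a) (nu_S : forall e, nu (S e) = eop e).

Lemma model_gap : nu (gap gc pi t rf (rng f)) = 0.
Proof.
rewrite /gap (star_homB hnu) (star_hom_sum hnu) nu_pi.
under eq_bigr do rewrite (star_hom_mul hnu) (star_hom_adj hnu) nu_S.
by rewrite edge_sum subrr.
Qed.

Lemma model_star_rep : is_star_rep (fun b => bop_rep (nu b)).
Proof. exact: star_rep_comp hnu (bop_star_rep K). Qed.

(** The edge operators map the original summand into itself by the old action,
    whereas their adjoints do not; so this holds on the tensor algebra only. *)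
Lemma model_extends b i (h : Hf i) : Alg b ->
  op (nu b) (delta None h) = delta None (sg i b h).
Proof.
pose M : set T := [set b | Alg b /\ forall i (h : Hf i),
  op (nu b) (delta None h) = delta None (sg i b h)].
suff : Alg `<=` M by move=> sub /sub[_]; exact.
have snu := model_star_rep.
refine (tensor_ind (gc := gc) rep (M := M) _ _ _ _ _ _ _); rewrite /M /=.
- split; first exact: (subalg_0 (tensor_subalgebra (t := t))).
  move=> j k; rewrite (star_hom0 hnu) (star_rep0 (ssg j)).
  by apply/esym/nr_eq0; rewrite nr_delta nr0.
- move=> k a b' [Aa ha] [Ab hb]; split; first exact: (subalg_lin (tensor_subalgebra (t := t))).
  move=> j l; rewrite (star_hom_lin hnu) (star_repD (ssg j)) (star_repZ (ssg j)) deltaP.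
  by rewrite -ha -hb.
- move=> a b' [Aa ha] [Ab hb]; split; first exact: (subalg_mul (tensor_subalgebra (t := t))).
  move=> j l; rewrite (star_hom_mul hnu) (star_repM (ssg j)) -ha -hb.
  by [].
- move=> b' Ab hb; split=> // j k; apply/eqP; rewrite -subr_eq0; apply/eqP/nr_small => e e0.
  have k0 := nr_ge0 k; have k1 : 0 < 2 * (nr k + 1) by lra.
  have [d [Ad hd] bd] := hb _ (divr_gt0 e0 k1).
  have h1 := bd _ _ snu (delta None k); rewrite (star_repB snu) nr_delta in h1.
  have h2 := bd _ _ (ssg j) k.
  have h3 : nr (delta (O := option (nat * seq (edge G))) None (sg j d k) - delta None (sg j b' k)) =
    nr (sg j (b' - d) k).
    by rewrite (star_repB (ssg j)) -deltaB nr_delta nrBC.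
  apply: le_trans (nrBD (delta None (sg j d k)) _ _) _.
  rewrite h3 -{1}hd; apply: le_trans (lerD h1 h2) _.
  rewrite -mulrDr mulrC -[leRHS](divfK (lt0r_neq0 k1)) mulrC ler_pM2l ?divr_gt0 //; lra.
- by move=> b' [].
- move=> p; split; first exact: tensor_vertex_proj.
  move=> j k; rewrite nu_pi; apply: coord_ext => j' o; rewrite coord_diag.
  have [[-> ->]|ne] := eqVneq (j', o) (j, None); first by rewrite !coord_delta.
  by rewrite !coord_delta0 // linear0.
- move=> e; split; first exact: tensor_edge_iso.
  move=> j k; rewrite nu_S; apply: coord_ext => j' o; rewrite coord_edge.
  rewrite [coord (delta None k) j' (Some _)]coord_delta0 ?linear0 ?addr0; last first.
    by rewrite xpair_eqE andbF.
  have [[-> ->]|ne] := eqVneq (j', o) (j, None); first by rewrite !coord_delta.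
  rewrite !coord_delta0 ?linear0 //; apply: contra ne.
  by case: o => [[n [|e' mu]]|] //; rewrite xpair_eqE andbF.
Qed.

(** The original summand is invariant and isometrically embedded. *)
Lemma model_norm n (a : 'M[T]_n) i : (forall k l, Alg (a k l)) ->
  (opmx_norm (fun k l => sg i (a k l)) <= opmx_norm (fun k l => bop_rep (nu (a k l))))%E.
Proof.
move=> Aa; apply: le_ereal_inf_tmp => _ [c /opmx_boundP[c0' hc] <-].
apply/opmx_normP => // x.
have := hc (fun k => delta None (x k)).
under eq_bigr => k _.
  under eq_bigr do rewrite /bop_rep /= model_extends //.
  rewrite delta_sum nr_delta; over.
by under [X in _ * X]eq_bigr do rewrite nr_delta.
Qed.

End Model.

(** * The Cuntz-Krieger relations in the envelope *)

Section Cover.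
Context {R : realType} {T : cstar_algebra R} {Alg G : set T} {K : hilbert_space R}.
Variable (nu : T -> bounded_operators K).
Hypothesis (hnu : star_hom nu) (GA : G `<=` Alg) (genG : cstar_gen G = setT).

Lemma nr_star_hom b : nr (nu b) <= nr b.
Proof.
apply: nr_op_le (nr_ge0 b) _ => x.
exact: (star_rep_contractive (star_rep_comp hnu (bop_star_rep K))).
Qed.

Local Notation S := (nu @` Alg).
Local Notation C := (cstar_sub (cstar_genP S)).

(** The preimage of a closed star subalgebra under a continuous star homomorphism
    is one as well. *)
Lemma star_hom_gen b : cstar_gen S (nu b).
Proof.
have gb : cstar_gen G b by rewrite genG.
have [[cS S0 SL SM] Sadj] := cstar_genP S.
apply: (gb [set b | cstar_gen S (nu b)]); split; last by move=> d Gd M [_]; apply; exists d => //; exact: GA.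
split; first split.
- apply/nr_closedP => x h; have /nr_closedP := cS; apply => e e0.
  have [y Sy xy] := h e e0; exists (nu y) => //.
  by rewrite -(star_homB hnu); apply: le_trans (nr_star_hom _) xy.
- by rewrite /= (star_hom0 hnu).
- by move=> k a d Sa Sd; rewrite /= (star_hom_lin hnu); exact: SL.
- by move=> a d Sa Sd; rewrite /= (star_hom_mul hnu); exact: SM.
- by move=> a Sa; rewrite /= (star_hom_adj hnu); exact: Sadj.
Qed.

Definition corestriction (b : T) : C := sub_mk (cstar_genP S) (star_hom_gen b).

Lemma corestriction_hom : star_hom corestriction.
Proof.
split.
- by move=> k a b; apply: sub_ext; exact: star_hom_lin.
- by move=> a b; apply: sub_ext; exact: star_hom_mul.
- by move=> a; apply: sub_ext; exact: star_hom_adj.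
Qed.

Definition sub_rep (c : C) : {linear K -> K} := bop_rep (sub_val c).

Lemma sub_star_rep : is_star_rep sub_rep.
Proof. exact: star_rep_comp (sub_val_hom (cstar_genP S)) (bop_star_rep K). Qed.

(** Star representations of the image pull back to T, so matrix norms do not grow;
    by hypothesis the representation on K makes sure that they do not shrink. *)
Lemma corestriction_cover :
  (forall n (a : 'M[T]_n), (forall i j, Alg (a i j)) ->
    (cmx_norm a <= opmx_norm (fun i j => bop_rep (nu (a i j))))%E) ->
  is_cstar_cover Alg corestriction.
Proof.
move=> norming; split.
- by move=> k a b _ _; exact: (star_hom_lin corestriction_hom).
- by move=> a b _ _; exact: (star_hom_mul corestriction_hom).
- move=> n a Aa; apply/eqP; rewrite eq_le; apply/andP; split.
    apply: cmx_norm_le => L rho srho.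
    have := cmx_norm_ub a (star_rep_comp corestriction_hom srho).
    by congr (_ <= _)%E; congr opmx_norm; apply/funext => i; apply/funext => j; rewrite mxE.
  apply: le_trans (norming n a Aa) _.
  have := cmx_norm_ub (map_mx corestriction a) sub_star_rep.
  by congr (_ <= _)%E; congr opmx_norm; apply/funext => i; apply/funext => j; rewrite mxE.
- have <- : [set c : C | S (sub_val c)] = corestriction @` Alg.
    apply/seteqP; split=> [c [b Ab bc]|_ [b Ab <-]]; last by exists b.
    by exists b => //; exact: sub_ext.
  exact: sub_cstar_gen.
Qed.
End Cover.

Section Envelope.
Context {R : realType} {G : digraph} {A : cstar_algebra R} {ev : A -> vertex G -> R[i]}
  {X : correspondence A} {chi : (edge G -> R[i]) -> X} {T : cstar_algebra R}
  { pi : A -> T} {t : X -> T}.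
Hypothesis (gc : is_graph_correspondence ev chi) (toep : is_toeplitz_algebra pi t).
Hypothesis (rf : row_finite G).
Context {E : cstar_algebra R} {iota : T -> E}.
Local Notation Alg := (tensor_algebra pi t).
Hypothesis (env : is_cstar_envelope Alg iota).

Let rep : is_corr_rep pi t. Proof. by case: toep. Qed.

Lemma generators_tensor : range pi `|` range t `<=` Alg.
Proof. by move=> b Gb M [_]; apply. Qed.

(** The Toeplitz algebra itself is a C*-cover. *)
Lemma envelope_of_toeplitz : exists Psi : T -> E, star_hom Psi /\ forall b, Alg b -> Psi b = iota b.
Proof.
have [_ gen _] := toep.
have cover : is_cstar_cover Alg (fun b : T => b).
  split=> // [n a _|]; first by congr cmx_norm; apply/matrixP => i j; rewrite mxE.
  apply/seteqP; split=> // b _; have : cstar_gen (range pi `|` range t) b by rewrite gen.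
  move=> gb M [sM AM]; apply: gb; split=> // d Gd; apply: AM; exists d => //.
  exact: generators_tensor.
have [Phi [hPhi _ PhiE]] := env.2 T _ cover.
by exists Phi.
Qed.

(** The C*-algebra generated by the path model is a C*-cover where the gap
    vanishes, and the envelope is a quotient of it. *)
Lemma envelope_gap f : exists Psi : T -> E,
  [/\ star_hom Psi, forall b, Alg b -> Psi b = iota b & Psi (gap gc pi t rf (rng f)) = 0].
Proof.
have [nu [hnu nu_pi nu_S]] := model_rep gc toep rf f (@rep_map_star R T).
have [_ gen _] := toep.
pose j := corestriction hnu generators_tensor gen.
have hj : star_hom j := corestriction_hom hnu generators_tensor gen.
have cover : is_cstar_cover Alg j.
  apply: corestriction_cover => n a Aa.
  apply: rep_family_norming => i; exact: (model_norm hnu nu_pi nu_S).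
have [Phi [hPhi _ PhiE]] := env.2 _ j cover.
exists (fun b => Phi (j b)); split=> //.
  by split=> *; rewrite ?(star_hom_lin hj) ?(star_hom_lin hPhi) ?(star_hom_mul hj)
    ?(star_hom_mul hPhi) ?(star_hom_adj hj) ?(star_hom_adj hPhi).
have -> : j (gap gc pi t rf (rng f)) = 0.
  by apply: sub_ext; exact: (model_gap hnu nu_pi nu_S).
exact: star_hom0.
Qed.

End Envelope.

Theorem theorem3p3 (R : realType) (G : digraph)
  (A : cstar_algebra R) (ev : A -> vertex G -> R[i])
  (X : correspondence A) (chi : (edge G -> R[i]) -> X)
  (T : cstar_algebra R) (pi : A -> T) (t : X -> T) :
  row_finite G ->
  is_graph_correspondence ev chi ->
  is_toeplitz_algebra pi t ->
  unique_extension_property (tensor_algebra pi t).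
Proof.
move=> rf gc toep E iota env H rho srho _.
split; first exact: star_rep_cc.
move=> K V nu [Visom [nu_rep nu_cc] compress].
have rep : is_corr_rep pi t by case: toep.
pose Alg := tensor_algebra pi t.
pose mu (b : T) := nu (iota b).
have [[ilin imul iisom _] _] := env.
have inA b : Alg b -> (iota @` Alg) (iota b) by move=> Ab; exists b.
have mu_rep : is_rep Alg mu.
  split.
  - by move=> b Ab; apply: (rep_cont nu_rep); exact: inA.
  - by move=> k a b Aa Ab x; rewrite /mu ilin // (rep_lin nu_rep) //; exact: inA.
  - by move=> a b Aa Ab x; rewrite /mu imul // (rep_mul nu_rep) //; exact: inA.
have mu_cc : completely_contractive Alg mu.
  move=> n a Aa; rewrite -(iisom n a Aa).
  have Ai k l : (iota @` Alg) (map_mx iota a k l) by rewrite mxE; exact: inA.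
  have := nu_cc n (map_mx iota a) Ai.
  by congr (_ <= _)%E; congr opmx_norm; apply/funext => i; apply/funext => j; rewrite mxE.
have comp (Psi : T -> E) : (forall b, Alg b -> Psi b = iota b) -> forall b, Alg b ->
    forall x y, dot (mu b (V x)) (V y) = dot (rho (Psi b) x) y.
  by move=> PsiE b Ab x y; rewrite PsiE // compress //; exact: inA.
(* The homomorphism from T depends on e, but all of them agree with iota on the
   tensor algebra. *)
have co e : coinvariant V mu (edge_iso chi t e).
  have [Psi [hPsi PsiE Psi0]] := envelope_gap gc toep rf env e.
  refine (edge_iso_coinvariant (gc := gc) rep (rf := rf) (f := e) (star_rep_comp hPsi srho) Visom mu_rep mu_cc (comp Psi PsiE) _).
  by move=> x; rewrite Psi0 (star_rep0 srho).
have [Psi [hPsi PsiE]] := envelope_of_toeplitz toep env.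
have red := tensor_reduced gc rep (star_rep_comp hPsi srho) Visom mu_rep mu_cc (comp Psi PsiE) co.
move=> _ [b Ab <-]; have [_ iv ci] := red b Ab; split.
  by move=> _ [x _ <-]; exists (rho (Psi b) x) => //; rewrite -iv.
have sym (y z : K) : dot y z = 0 -> dot z y = 0 by move=> yz; rewrite dotC yz conjc0.
move=> y yp _ [x _ <-]; apply: (sym _ _); apply: ci => z.
by apply: (sym _ _); apply: yp; exists z.
Qed.
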